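(* The vectors $\omega_{i,k}$ and the scale factors $\Delta x_\gamma$ (of the form described in the context) can be chosen so that the family $\{\phi_\gamma\}_{\gamma\in\Gamma}$ is a frame for $L^2(\mathbb{R}^n)$ and, moreover, the following holds. For any finite $m\ge 0$ and $f\in H^m(\mathbb{R}^n)$ there exist constants $C_1$ and $C_2$, independent of $\gamma$, with $0<C_1\le C_2$, such that $$C_1\|f\|_{\dot H^m(\mathbb{R}^n)}^2\le \sum_{\gamma}|2^{km}c(\gamma)|^2\le C_2\|f\|_{\dot H^m(\mathbb{R}^n)}^2,\qquad\text{where } c(\gamma)=\int_{\mathbb{R}^n}\overline{\phi_\gamma(x)}\,f(x)\,dx .$$
   Context: The index is $\gamma=(i,k,\alpha)\in\Gamma$ with $k\in\mathbb{N}$, $i\in I_k$ ($I_k$ a finite set of integers depending on $k$), and $\alpha\in\mathbb{Z}^n$. One takes $\xi_\gamma=2^k\omega_{i,k}\in\mathbb{R}^n$ with $\frac12\le|\omega_{i,k}|<1$, and $x_\gamma=\Delta x_\gamma\,\alpha\in\mathbb{R}^n$, where $\Delta x_\gamma>0$ is a scale factor depending on $k$ only, of the form $\Delta x_\gamma=C_\epsilon 2^{-\frac k2-\epsilon k}$ with $\epsilon>0$ and $C_\epsilon>0$ a small constant independent of $k$. The functions are $$\phi_\gamma(x)=\left(\frac{|\xi_\gamma|\Delta x_\gamma}{2\pi}\right)^{n/2}\exp\left(i\xi_\gamma\cdot(x-x_\gamma)-|\xi_\gamma||x-x_\gamma|^2\right).$$ The Fourier transform is $\widehat h(\eta)=\int_{\mathbb{R}^n}e^{-i\eta\cdot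 u}h(u)\,du$, and $\|f\|_{\dot H^m(\mathbb{R}^n)}=\||\xi|^m\widehat f(\xi)\|_{L^2(\mathbb{R}^n)}$ is the homogeneous Sobolev norm. In the sum, $k$ is the second component of $\gamma=(i,k,\alpha)$. *)

(* Defs.v *)
From HB Require Import structures.
From mathcomp Require Import all_boot all_order all_algebra.
From mathcomp Require Import finmap.
From mathcomp Require Import complex.
From mathcomp Require Import all_classical all_reals all_analysis.

Set Implicit Arguments.
Unset Strict Implicit.
Unset Printing Implicit Defensive.

Import Order.TTheory GRing.Theory Num.Theory.
Import numFieldNormedType.Exports.
Import ComplexField.Normc.

Local Open Scope classical_set_scope.
Local Open Scope ring_scope.
Local Open Scope complex_scope.

Notation euclidean R n := (n.-tuple (measurableTypeR R)).

Section lebesgue_cons.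
Context {R : realType} (n : nat).
Variable mu : {sigma_finite_measure set (euclidean R n) -> \bar R}.

Definition tcons (p : measurableTypeR R * euclidean R n) : euclidean R n.+1 :=
  [tuple of p.1 :: p.2].

Lemma measurable_tcons : measurable_fun [set: _] tcons.
Proof. exact: measurable_cons. Qed.

Lemma measurable_preimage_tcons A : measurable A -> measurable (tcons @^-1` A).
Proof.
by move=> mA; rewrite -[X in measurable X]setTI; exact: measurable_tcons.
Qed.

Definition lebesgue_cons : set (euclidean R n.+1) -> \bar R :=
  pushforward (@lebesgue_measure R \x mu)%E tcons.

Let lebesgue_cons0 : lebesgue_cons set0 = 0%E.
Proof. by rewrite /lebesgue_cons /pushforward preimage_set0 measure0. Qed.

Let lebesgue_cons_ge0 A : (0 <= lebesgue_cons A)%E.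
Proof. by rewrite /lebesgue_cons /pushforward; exact: measure_ge0. Qed.

Let lebesgue_cons_sigma_additive : semi_sigma_additive lebesgue_cons.
Proof.
move=> F mF tF mUF; rewrite /lebesgue_cons /pushforward preimage_bigcup.
apply: measure_semi_sigma_additive.
- by move=> k; exact: measurable_preimage_tcons.
- apply/trivIsetP => /= i j _ _ ij; rewrite -preimage_setI.
  by move/trivIsetP : tF => /(_ _ _ _ _ ij) ->//; rewrite preimage_set0.
- by rewrite -preimage_bigcup; exact: measurable_preimage_tcons.
Qed.

HB.instance Definition _ := isMeasure.Build _ _ _ lebesgue_cons
  lebesgue_cons0 lebesgue_cons_ge0 lebesgue_cons_sigma_additive.

Let lebesgue_cons_sigma_finite : sigma_finite setT lebesgue_cons.
Proof.
have /sigma_finiteP[F [TF ndF Foo]] := sigma_finiteT (@lebesgue_measure R).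
have /sigma_finiteP[G [TG ndG Goo]] := sigma_finiteT mu.
pose tuncons (t : euclidean R n.+1) : measurableTypeR R * euclidean R n :=
  (thead t, [tuple of behead t]).
have tunconsK : cancel tuncons tcons by move=> t; rewrite /tcons -tuple_eta.
have tconsK : cancel tcons tuncons.
  by move=> -[x t]; congr (_, _); apply: val_inj.
exists (fun k => tuncons @^-1` (F k `*` G k)).
  apply/esym; rewrite -subTset => t _.
  have [i _ Fi] : (\bigcup_k F k) (tuncons t).1 by rewrite -TF.
  have [j _ Gj] : (\bigcup_k G k) (tuncons t).2 by rewrite -TG.
  exists (maxn i j) => //; split.
  - by move: Fi; exact/subsetPset/ndF/leq_maxl.
  - by move: Gj; exact/subsetPset/ndG/leq_maxr.
move=> k; have [mFk Fk] := Foo k; have [mGk Gk] := Goo k; split.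
- rewrite -[X in measurable X]setTI.
  have mtuncons : measurable_fun [set: _] tuncons.
    apply: measurable_fun_pair; first exact: measurable_tnth.
    exact: measurable_behead.
  by apply: mtuncons => //; exact: measurableX.
- rewrite /lebesgue_cons /pushforward (_ : tcons @^-1` _ = F k `*` G k).
    by rewrite product_measure1E// lte_mul_pinfty// ge0_fin_numE.
  rewrite -comp_preimage (_ : tuncons \o tcons = id)//.
  by apply/funext => x; exact: tconsK.
Qed.

HB.instance Definition _ := Measure_isSigmaFinite.Build _ _ _ lebesgue_cons
  lebesgue_cons_sigma_finite.

End lebesgue_cons.

(* Lebesgue measure on (the Borel sets of) R^n: the n-fold product of the
   one-dimensional Lebesgue measure, transported to n-tuples along
   (x, t) |-> x :: t. *)
Fixpoint lebesgue_measure_n {R : realType} (n : nat) :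
    {sigma_finite_measure set (euclidean R n) -> \bar R} :=
  if n is n'.+1 then lebesgue_cons (lebesgue_measure_n n')
  else \d_([tuple] : euclidean R 0).

Section vectors.
Context {R : realType} {n : nat}.
Implicit Types x y : euclidean R n.

Definition dotv x y : R := \sum_(j < n) tnth x j * tnth y j.

Definition normv x : R := Num.sqrt (dotv x x).

Definition subv x y : euclidean R n := [tuple tnth x j - tnth y j | j < n].

Definition scalev (a : R) x : euclidean R n := [tuple a * tnth x j | j < n].

End vectors.

Section complex_functions.
Context {R : realType}.

Definition expC (z : R[i]) : R[i] :=
  (expR (complex.Re z))%:C * (cos (complex.Im z) +i* sin (complex.Im z)).

Context {n : nat}.
Implicit Types f g : euclidean R n -> R[i].

Definition measurableC f :=
  measurable_fun setT (fun x => complex.Re (f x)) /\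
  measurable_fun setT (fun x => complex.Im (f x)).

(* Meaningful when Re f and Im f are integrable. *)
Definition integralC f : R[i] :=
  (\int[@lebesgue_measure_n R n]_x complex.Re (f x))
  +i* (\int[@lebesgue_measure_n R n]_x complex.Im (f x)).

Definition L2norm f : \bar R :=
  'N[@lebesgue_measure_n R n]_2%:E[(fun x => (normc (f x))%:E)]%E.

Definition L2 f := measurableC f /\ (L2norm f < +oo)%E.

(* Antilinear in the second argument. *)
Definition innerL2 f g : R[i] := integralC (fun x => (g x)^*%C * f x).

Definition is_frame (I : choiceType) (G : set I)
    (phi : I -> euclidean R n -> R[i]) :=
  (forall i, G i -> L2 (phi i)) /\
  exists A B : R, [/\ 0 < A, A <= B & forall f, L2 f ->
    (A%:E * L2norm f ^+ 2 <= \esum_(i in G) (normc (innerL2 f (phi i)) ^+ 2)%:E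
     <= B%:E * L2norm f ^+ 2)%E].

Definition fourierL1 f (eta : euclidean R n) : R[i] :=
  integralC (fun u => expC (- ('i%C * (dotv eta u)%:C)) * f u).

Definition ball_truncation (N : nat) f : euclidean R n -> R[i] :=
  fun u => if normv u <= N%:R then f u else 0.

(* g is the Fourier-Plancherel transform of f: the limit in L^2 of the Fourier
   integrals of f over the balls |u| <= N, which is determined up to a null
   set and agrees a.e. with fourierL1 f when f is also integrable. *)
Definition is_fourierL2 f g :=
  L2 g /\
  L2norm (fun eta => g eta - fourierL1 (ball_truncation N f) eta)
    @[N --> \oo] --> 0%E.

(* The junk value 0 is never taken when f is in L^2. *)
Definition fourierL2 f : euclidean R n -> R[i] :=
  xget (fun=> 0) [set g | is_fourierL2 f g].

Definition sobolev (m : R) f := L2 f /\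
  (L2norm (fun xi => ((1 + normv xi ^+ 2) `^ (m / 2))%:C * fourierL2 f xi)%R
   < +oo)%E.

Definition homogeneous_sobolev_norm (m : R) f : \bar R :=
  L2norm (fun xi => (normv xi `^ m)%:C * fourierL2 f xi).

End complex_functions.

Section wave_packets.
Context {R : realType} {n : nat}.

(* The index (i, k, alpha). *)
Definition packet_index : choiceType := (int * nat * n.-tuple int)%type.

Definition packet_indices (I : nat -> {fset int}) : set packet_index :=
  [set g | g.1.1 \in I g.1.2].

Definition spacing (C eps : R) (k : nat) : R :=
  C * 2 `^ (- (k%:R / 2) - eps * k%:R).

Variables (omega : int -> nat -> euclidean R n) (dx : nat -> R).

Definition packet_freq (g : packet_index) : euclidean R n :=
  scalev (2 ^+ g.1.2) (omega g.1.1 g.1.2).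

Definition packet_center (g : packet_index) : euclidean R n :=
  [tuple dx g.1.2 * (tnth g.2 j)%:~R | j < n].

Definition packet (g : packet_index) (x : euclidean R n) : R[i] :=
  let xi := packet_freq g in let y := subv x (packet_center g) in
  ((normv xi * dx g.1.2 / (2 * pi)) `^ (n%:R / 2))%:C *
  expC ('i%C * (dotv xi y)%:C - (normv xi * normv y ^+ 2)%:C).

End wave_packets.

Arguments packet_index n : clear implicits.
Arguments packet_indices n I : clear implicits.

(* Main.v *)
Require Import Defs.
From HB Require Import structures.
From mathcomp Require Import all_boot all_order all_algebra.
From mathcomp Require Import finmap.
From mathcomp Require Import complex.
From mathcomp Require Import all_classical all_reals all_analysis.
From mathcomp Require Import measurable_realfun ring lra zify.

Import Order.TTheory GRing.Theory Num.Theory.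
Import numFieldNormedType.Exports.
Import ComplexField.Normc.

Local Open Scope classical_set_scope.
Local Open Scope ring_scope.
Local Open Scope complex_scope.

(** Write [xi] for a frequency, [l = |xi|], [a] for the spacing.  Summed over the
    translates [alpha], the squared coefficients of [f] become, by Poisson summation
    in the midpoint [(x + y) / 2], the energy of the Fourier transform of [f] against
    the Gaussian window [exp (- |eta - xi|^2 / (2 l))], up to cross terms which are at
    most a small multiple of the energy against the window of twice the width as soon
    as [l * a^2] is small.  The spacing [C * 2 ^ (- k / 2 - eps * k)] makes
    [l * a^2 <= C^2] at every scale.

    At scale [k] the frequencies [xi] are the points of a lattice of mesh
    [~ 2 ^ (k / 2)] in the annulus [2 ^ (k - 1) <= |xi| < 2 ^ k].  The sum of all
    narrow windows is then bounded below, and the sum of the wide windows weighted by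
    [2 ^ (2 k m)] is at most a multiple of [(1 + |eta|^2) ^ m].  With Plancherel's
    theorem this gives the frame inequalities, and the finiteness of the weighted
    coefficient sum for [f] in [H^m].

    For [m > 0] no upper constant independent of [f] exists, because the scales
    [k >= 0] also cover the low frequencies, which the homogeneous norm hardly sees.
    For a given
    [f] the weighted sum and the homogeneous norm are both finite, and both are
    positive unless [f] vanishes almost everywhere; their ratio serves as both
    constants. *)

Set Implicit Arguments.
Unset Strict Implicit.
Unset Printing Implicit Defensive.

(** * Complex-valued integrals *)

Section complex_basics.
Context {R : realType}.
Implicit Types z w : R[i].
Local Notation Rp := (@complex.Re R).
Local Notation Ip := (@complex.Im R).

(** The sampling step rests on the parallelogram law: a packet conjugated at x times the same packet
    at y is a Gaussian in x - y times a Gaussian in the distance from the lattice point to the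
    midpoint. The lattice sum touches the midpoint only, and the Gaussian in x - y is the transform
    of the window. A dual vector t shifts the two transforms by t / 2 and - t / 2; moving both back
    onto one window doubles its width, so the lower bound uses narrow windows while errors are
    measured in wide ones.

    This dictates the order of the choices: the frequencies and the bound B of their wide windows
    come before the spacing, then the defect d with d * B <= exp (- 1) / 2, then C.

    The sampling identity is proved for integrable f. General f in L^2 is reached by ball
    truncations, for finitely many coefficients at a time, where a crude Cauchy-Schwarz bound
    controls the error; only the final constants are uniform. The same truncations define the
    Fourier transform on L^2, so Plancherel's formula for integrable functions comes before it; it
    is derived from the L^2 continuity of translations. *)

Lemma ReD z w : Rp (z + w) = Rp z + Rp w. Proof. by case: z w => ? ? [? ?]. Qed.
Lemma ImD z w : Ip (z + w) = Ip z + Ip w. Proof. by case: z w => ? ? [? ?]. Qed.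
Lemma ReN z : Rp (- z) = - Rp z. Proof. by case: z. Qed.
Lemma ImN z : Ip (- z) = - Ip z. Proof. by case: z. Qed.
Lemma ReB z w : Rp (z - w) = Rp z - Rp w. Proof. by rewrite ReD ReN. Qed.
Lemma ImB z w : Ip (z - w) = Ip z - Ip w. Proof. by rewrite ImD ImN. Qed.
Lemma ReM z w : Rp (z * w) = Rp z * Rp w - Ip z * Ip w.
Proof. by case: z w => ? ? [? ?]. Qed.
Lemma ImM z w : Ip (z * w) = Rp z * Ip w + Ip z * Rp w.
Proof. by case: z w => ? ? [? ?]. Qed.
Lemma ReJ z : Rp (z^*)%C = Rp z. Proof. by case: z. Qed.
Lemma ImJ z : Ip (z^*)%C = - Ip z. Proof. by case: z. Qed.

Lemma Re_sum (I : Type) (r : seq I) (P : pred I) (F : I -> R[i]) :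
  Rp (\sum_(i <- r | P i) F i) = \sum_(i <- r | P i) Rp (F i).
Proof. by rewrite (big_morph _ ReD (erefl : Rp 0 = 0)). Qed.

Lemma complex_ext z w : Rp z = Rp w -> Ip z = Ip w -> z = w.
Proof. by case: z w => ? ? [? ?] /= -> ->. Qed.

Lemma normc_ge0 z : 0 <= normc z. Proof. by case: z => a b; exact: sqrtr_ge0. Qed.

Lemma normc_sqr z : normc z ^+ 2 = Rp z ^+ 2 + Ip z ^+ 2.
Proof. by case: z => a b /=; rewrite sqr_sqrtr// addr_ge0// sqr_ge0. Qed.

Lemma normc_sqrJ z : (normc z ^+ 2)%:C = z * (z^*)%C.
Proof.
apply: complex_ext; rewrite ?ReM ?ImM ReJ ImJ /= ?normc_sqr; ring.
Qed.

Lemma normcJ z : normc (z^*)%C = normc z.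
Proof. by case: z => a b /=; rewrite sqrrN. Qed.

Lemma normc_re (x : R) : normc x%:C = `|x|.
Proof. by rewrite /= expr0n/= addr0 sqrtr_sqr. Qed.

Lemma normr_Re z : `|Rp z| <= normc z.
Proof. by case: z => a b /=; rewrite -sqrtr_sqr ler_wsqrtr// lerDl sqr_ge0. Qed.

Lemma normr_Im z : `|Ip z| <= normc z.
Proof. by case: z => a b /=; rewrite -sqrtr_sqr ler_wsqrtr// lerDr sqr_ge0. Qed.

Lemma normc_le z : normc z <= `|Rp z| + `|Ip z|.
Proof.
rewrite -(@ler_pXn2r _ 2)// ?nnegrE ?normc_ge0 ?addr_ge0// normc_sqr.
rewrite -(real_normK (num_real (Rp z))) -(real_normK (num_real (Ip z))).
rewrite sqrrD; have : 0 <= `|Rp z| * `|Ip z| by rewrite mulr_ge0.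
by rewrite mulr2n; lra.
Qed.

Lemma normc_sqrD z w : normc (z + w) ^+ 2 <= 2 * normc z ^+ 2 + 2 * normc w ^+ 2.
Proof.
rewrite !normc_sqr ReD ImD.
have := sqr_ge0 (Rp z - Rp w); have := sqr_ge0 (Ip z - Ip w).
nra.
Qed.

Lemma normcB z w : normc (z - w) = normc (w - z).
Proof. by rewrite -normcN opprB. Qed.

Lemma normc_AM_GM z w : normc (z * w) <= (normc z ^+ 2 + normc w ^+ 2) / 2.
Proof.
rewrite normcM; have := sqr_ge0 (normc z - normc w); rewrite sqrrB mulr2n.
lra.
Qed.

Lemma normc_expC z : normc (expC z) = expR (Rp z).
Proof.
rewrite /expC normcM normc_re ger0_norm ?expR_ge0//= cos2Dsin2 sqrtr1 mulr1 //.
Qed.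

Lemma expCD z w : expC (z + w) = expC z * expC w.
Proof.
rewrite /expC ReD ImD expRD cosD sinD.
apply: complex_ext; rewrite !(ReM, ImM)/=; ring.
Qed.

Lemma expC0 : expC (0 : R[i]) = 1.
Proof. by rewrite /expC expR0 cos0 sin0 mul1r. Qed.

Lemma expCJ z : ((expC z)^*)%C = expC (z^*)%C.
Proof.
rewrite /expC ReJ ImJ cosN sinN.
by apply: complex_ext; rewrite ?(ReJ, ImJ, ReM, ImM)/=; ring.
Qed.

Lemma expC_sum (I : Type) (r : seq I) (P : pred I) (F : I -> R[i]) :
  expC (\sum_(i <- r | P i) F i) = \prod_(i <- r | P i) expC (F i).
Proof. by rewrite (big_morph _ expCD expC0). Qed.

Lemma expC_real (x : R) : expC x%:C = (expR x)%:C.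
Proof. by rewrite /expC/= cos0 sin0 mulr1. Qed.

Lemma Re_expC z : Rp (expC z) = expR (Rp z) * cos (Ip z).
Proof. by rewrite /expC ReM/= mul0r subr0. Qed.

Lemma Im_expC z : Ip (expC z) = expR (Rp z) * sin (Ip z).
Proof. by rewrite /expC ImM/= mul0r addr0. Qed.

End complex_basics.

Section complex_integral.
Context d (T : measurableType d) {R : realType}.
Variable mu : {measure set T -> \bar R}.
Implicit Types f g : T -> R[i].
Local Notation Rp := (@complex.Re R).
Local Notation Ip := (@complex.Im R).

Definition cmeas f := measurable_fun setT (fun x => Rp (f x)) /\
  measurable_fun setT (fun x => Ip (f x)).

Definition cint f : R[i] := (\int[mu]_x Rp (f x)) +i* (\int[mu]_x Ip (f x)).

Definition cintegrable f := mu.-integrable setT (EFin \o (fun x => Rp (f x))) /\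
  mu.-integrable setT (EFin \o (fun x => Ip (f x))).

Lemma cmeasD f g : cmeas f -> cmeas g -> cmeas (fun x => f x + g x).
Proof.
move=> [f1 f2] [g1 g2]; split.
  by under eq_fun do rewrite ReD; exact: measurable_funD.
by under eq_fun do rewrite ImD; exact: measurable_funD.
Qed.

Lemma cmeasM f g : cmeas f -> cmeas g -> cmeas (fun x => f x * g x).
Proof.
move=> [f1 f2] [g1 g2]; split.
  by under eq_fun do rewrite ReM; apply: measurable_funB; exact: measurable_funM.
by under eq_fun do rewrite ImM; apply: measurable_funD; exact: measurable_funM.
Qed.

Lemma cmeasJ f : cmeas f -> cmeas (fun x => (f x)^*%C).
Proof.
move=> [f1 f2]; split; first by under eq_fun do rewrite ReJ.
by under eq_fun do rewrite ImJ; exact: measurableT_comp.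
Qed.

Lemma cmeasN f : cmeas f -> cmeas (fun x => - f x).
Proof.
by move=> [f1 f2]; split; [under eq_fun do rewrite ReN|under eq_fun do rewrite ImN];
  exact: measurableT_comp.
Qed.

Lemma cmeasB f g : cmeas f -> cmeas g -> cmeas (fun x => f x - g x).
Proof. by move=> mf mg; apply: cmeasD => //; exact: cmeasN. Qed.

Lemma cmeas_cst c : cmeas (fun=> c).
Proof. by split; exact: measurable_cst. Qed.

Lemma cmeas_re (h : T -> R) : measurable_fun setT h -> cmeas (fun x => (h x)%:C).
Proof. by move=> mh; split => //=; exact: measurable_cst. Qed.

Lemma cmeas_expC f : cmeas f -> cmeas (fun x => expC (f x)).
Proof.
move=> [f1 f2]; split.
  under eq_fun do rewrite Re_expC; apply: measurable_funM.
    by apply: measurableT_comp => //; exact: measurable_expR.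
  apply: measurableT_comp => //.
  by apply: continuous_measurable_fun; exact: continuous_cos.
under eq_fun do rewrite Im_expC; apply: measurable_funM.
  by apply: measurableT_comp => //; exact: measurable_expR.
apply: measurableT_comp => //.
by apply: continuous_measurable_fun; exact: continuous_sin.
Qed.

Lemma cmeas_sum (I : Type) (r : seq I) (P : pred I) (F : I -> T -> R[i]) :
  (forall i, P i -> cmeas (F i)) -> cmeas (fun x => \sum_(i <- r | P i) F i x).
Proof.
move=> mF; elim: r => [|i r IH].
  by under eq_fun do rewrite big_nil; exact: cmeas_cst.
case: (boolP (P i)) => Pi; last by under eq_fun do rewrite big_cons (negbTE Pi).
by under eq_fun do rewrite big_cons Pi; apply: cmeasD => //; exact: mF.
Qed.

Lemma cmeas_norm f : cmeas f -> measurable_fun setT (fun x => normc (f x)).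
Proof.
move=> [f1 f2].
rewrite (_ : (fun _ => _) = (fun x => Num.sqrt (Rp (f x) ^+ 2 + Ip (f x) ^+ 2))).
  apply: (@measurableT_comp _ _ _ _ _ _ (@Num.sqrt R)).
    by apply: continuous_measurable_fun; exact: sqrt_continuous.
  by apply: measurable_funD; exact: measurable_funX.
by apply/funext => x; case: (f x).
Qed.

Lemma cmeas_norm2 f : cmeas f -> measurable_fun setT (fun x => normc (f x) ^+ 2).
Proof. by move=> mf; apply: measurable_funX; exact: cmeas_norm. Qed.

Lemma cintegrable_meas f : cintegrable f -> cmeas f.
Proof.
by move=> [/integrableP[+ _] /integrableP[+ _]] => m1 m2; split; exact/measurable_EFinP.
Qed.

Lemma cintegrableP f : cintegrable f <->
  cmeas f /\ mu.-integrable setT (EFin \o (fun x => normc (f x))).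
Proof.
split=> [cf|[mf nf]].
  split; first exact: cintegrable_meas.
  have mf := cintegrable_meas cf.
  case: cf => f1 f2.
  have := integrableD measurableT (integrable_norm f1) (integrable_norm f2).
  apply: le_integrable => //.
    by apply/measurable_EFinP; exact: cmeas_norm.
  move=> x _ /=; rewrite lee_fin ger0_norm ?normc_ge0//.
  by rewrite ger0_norm ?addr_ge0// normc_le.
case: (mf) => m1 m2; split; apply: le_integrable nf => //.
- exact/measurable_EFinP.
- by move=> x _ /=; rewrite lee_fin [leRHS]ger0_norm ?normc_ge0// normr_Re.
- exact/measurable_EFinP.
- by move=> x _ /=; rewrite lee_fin [leRHS]ger0_norm ?normc_ge0// normr_Im.
Qed.

Lemma cintegrable_le f (g : T -> R) : cmeas f ->
  mu.-integrable setT (EFin \o g) -> (forall x, normc (f x) <= g x) ->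
  cintegrable f.
Proof.
move=> mf ig fg; apply/cintegrableP; split => //.
apply: le_integrable ig => //; first by apply/measurable_EFinP; exact: cmeas_norm.
move=> x _ /=; rewrite lee_fin ger0_norm ?normc_ge0//.
by rewrite (le_trans (fg x))// ler_norm.
Qed.

Lemma cintegrableD f g : cintegrable f -> cintegrable g ->
  cintegrable (fun x => f x + g x).
Proof.
move=> [f1 f2] [g1 g2]; split.
  rewrite (_ : _ \o _ = (EFin \o (fun x => Rp (f x))) \+ (EFin \o (fun x => Rp (g x))))%E.
    exact: integrableD.
  by apply/funext => x /=; rewrite ReD.
rewrite (_ : _ \o _ = (EFin \o (fun x => Ip (f x))) \+ (EFin \o (fun x => Ip (g x))))%E.
  exact: integrableD.
by apply/funext => x /=; rewrite ImD.
Qed.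

Lemma cintegrableZ c f : cintegrable f -> cintegrable (fun x => c * f x).
Proof.
move=> cf; have mf := cintegrable_meas cf.
have [_ /(integrableZl measurableT (normc c)) h] := (cintegrableP f).1 cf.
apply: (@cintegrable_le _ (fun x => normc c * normc (f x))).
- by apply: cmeasM => //; exact: cmeas_cst.
- by [].
- by move=> x; rewrite normcM.
Qed.

Lemma cintegrable0 : cintegrable (fun=> 0).
Proof. by split => /=; exact: integrable0. Qed.

Lemma cintegrable_sum (I : Type) (r : seq I) (P : pred I) (F : I -> T -> R[i]) :
  (forall i, P i -> cintegrable (F i)) ->
  cintegrable (fun x => \sum_(i <- r | P i) F i x).
Proof.
move=> mF; elim: r => [|i r IH].
  by under eq_fun do rewrite big_nil; exact: cintegrable0.
case: (boolP (P i)) => Pi; last by under eq_fun do rewrite big_cons (negbTE Pi).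
by under eq_fun do rewrite big_cons Pi; apply: cintegrableD => //; exact: mF.
Qed.

Lemma eq_cint f g : f =1 g -> cint f = cint g.
Proof. by move=> fg; congr cint; apply/funext. Qed.

Lemma cintD f g : cintegrable f -> cintegrable g ->
  cint (fun x => f x + g x) = cint f + cint g.
Proof.
move=> [f1 f2] [g1 g2]; apply: complex_ext; rewrite ?ReD ?ImD /=.
  by under eq_Rintegral do rewrite ReD; rewrite RintegralD.
by under eq_Rintegral do rewrite ImD; rewrite RintegralD.
Qed.

Lemma cintZ c f : cintegrable f -> cint (fun x => c * f x) = c * cint f.
Proof.
move=> [f1 f2].
have zl a (h : T -> R) : mu.-integrable setT (EFin \o h) ->
    mu.-integrable setT (EFin \o (fun x => a * h x)).
  by move=> /(integrableZl measurableT a).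
apply: complex_ext; rewrite ?ReM ?ImM /=.
  under eq_Rintegral do rewrite ReM.
  by rewrite RintegralB// ?RintegralZl//; exact: zl.
under eq_Rintegral do rewrite ImM.
by rewrite RintegralD// ?RintegralZl//; exact: zl.
Qed.

Lemma cintB f g : cintegrable f -> cintegrable g ->
  cint (fun x => f x - g x) = cint f - cint g.
Proof.
move=> cf cg; rewrite -[in RHS]mulN1r -cintZ// -cintD//.
  by apply: eq_cint => x; rewrite mulN1r.
exact: cintegrableZ.
Qed.

Lemma cint0 : cint (fun=> 0) = 0.
Proof. by rewrite /cint Rintegral_cst// mul0r. Qed.

Lemma cint_sum (I : Type) (r : seq I) (P : pred I) (F : I -> T -> R[i]) :
  (forall i, P i -> cintegrable (F i)) ->
  cint (fun x => \sum_(i <- r | P i) F i x) = \sum_(i <- r | P i) cint (F i).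
Proof.
move=> mF; elim: r => [|i r IH].
  by under eq_cint do rewrite big_nil; rewrite big_nil cint0.
rewrite big_cons; case: (boolP (P i)) => Pi; last first.
  by under eq_cint do rewrite big_cons (negbTE Pi).
under eq_cint do rewrite big_cons Pi.
by rewrite cintD ?IH//; [exact: mF|exact: cintegrable_sum].
Qed.

Lemma cintegrableJ f : cintegrable f -> cintegrable (fun x => (f x)^*%C).
Proof.
move=> cf; have [mf nf] := (cintegrableP f).1 cf.
apply: (cintegrable_le (cmeasJ mf) nf) => x; by rewrite normcJ.
Qed.

Lemma cintJ f : cintegrable f -> cint (fun x => (f x)^*%C) = ((cint f)^*)%C.
Proof.
move=> [f1 f2]; apply: complex_ext; rewrite ?ReJ ?ImJ /=.
  by under eq_Rintegral do rewrite ReJ.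
by under eq_Rintegral do rewrite ImJ -mulN1r; rewrite RintegralZl// mulN1r.
Qed.

Lemma cint_re (h : T -> R) : cint (fun x => (h x)%:C) = (\int[mu]_x h x)%:C.
Proof. by rewrite /cint/= Rintegral_cst// mul0r. Qed.

(** Rotation to the real axis: with I the integral, |I|^2 is the real part of the integral of
    conj(I) f, hence at most |I| times the integral of |f|. *)
Lemma normc_cint_le f : cintegrable f ->
  normc (cint f) <= \int[mu]_x normc (f x).
Proof.
move=> cf; have [mf nf] := (cintegrableP f).1 cf.
have [->|n0] := eqVneq (cint f) 0.
  by rewrite normc0; apply: Rintegral_ge0 => x _; exact: normc_ge0.
have np : 0 < normc (cint f).
  by rewrite lt_def normc_ge0 andbT; apply/contra_neq: n0 => /eq0_normc.
have h : normc (cint f) ^+ 2 = Rp (cint (fun x => (cint f)^*%C * f x)).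
  by rewrite cintZ// mulrC -normc_sqrJ.
have : normc (cint f) ^+ 2 <= normc (cint f) * \int[mu]_x normc (f x).
  rewrite h -RintegralZl//; apply: le_Rintegral => //.
  - by have [] := cintegrableZ (cint f)^*%C cf.
  - by have /(integrableZl measurableT (normc (cint f))) := nf.
  move=> x _; rewrite -(normcJ (cint f)) -normcM.
  exact: le_trans (ler_norm _) (normr_Re _).
by rewrite expr2 ler_pM2l.
Qed.

End complex_integral.

(** * Fubini's theorem for real and complex integrals *)

Section fubini_real.
Context d1 d2 (T1 : measurableType d1) (T2 : measurableType d2) {R : realType}.
Variables (m1 : {sigma_finite_measure set T1 -> \bar R})
  (m2 : {sigma_finite_measure set T2 -> \bar R}).

(** No integrability is assumed: the extended integral is a difference of two Tonelli integrals,
    measurable even if infinite somewhere, and [fine] preserves measurability. *)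
Lemma measurable_Rintegral_param (g : T1 * T2 -> R) : measurable_fun setT g ->
  measurable_fun setT (fun x => \int[m2]_y g (x, y)).
Proof.
move=> mg; have mG : measurable_fun setT (EFin \o g) by exact/measurable_EFinP.
rewrite (_ : (fun _ => _) = fine \o ((fun x => \int[m2]_y ((EFin \o g)^\+ (x, y)))
   \- (fun x => \int[m2]_y ((EFin \o g)^\- (x, y))))%E); last first.
  apply/funext => x; rewrite /Rintegral integralE /=; congr (fine (_ - _)%E);
  by apply: eq_integral => y _; rewrite ?funeposE ?funenegE.
apply: measurableT_comp => //; apply: emeasurable_funB.
  by apply: measurable_fun_fubini_tonelli_F => //; exact: measurable_funepos.
by apply: measurable_fun_fubini_tonelli_F => //; exact: measurable_funeneg.
Qed.

Lemma measurable_Rintegral_param2 (g : T1 * T2 -> R) : measurable_fun setT g ->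
  measurable_fun setT (fun y => \int[m1]_x g (x, y)).
Proof.
move=> mg; have mG : measurable_fun setT (EFin \o g) by exact/measurable_EFinP.
rewrite (_ : (fun _ => _) = fine \o ((fun y => \int[m1]_x ((EFin \o g)^\+ (x, y)))
   \- (fun y => \int[m1]_x ((EFin \o g)^\- (x, y))))%E); last first.
  apply/funext => x; rewrite /Rintegral integralE /=; congr (fine (_ - _)%E);
  by apply: eq_integral => y _; rewrite ?funeposE ?funenegE.
apply: measurableT_comp => //; apply: emeasurable_funB.
  by apply: measurable_fun_fubini_tonelli_G => //; exact: measurable_funepos.
by apply: measurable_fun_fubini_tonelli_G => //; exact: measurable_funeneg.
Qed.

Let abse_fine_le (x : \bar R) : (`|(fine x)%:E| <= `|x|)%E.
Proof. by case: x => [r| |] //=; rewrite normr0 leey. Qed.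

(** The section at x is integrable for almost every x only; elsewhere [fine] turns the inner
    integral into 0, which the outer integral does not see. *)
Lemma Rintegral_prod1 (g : T1 * T2 -> R) :
  (m1 \x m2)%E.-integrable setT (EFin \o g) ->
  m1.-integrable setT (EFin \o (fun x => \int[m2]_y g (x, y))) /\
  \int[m1]_x \int[m2]_y g (x, y) = \int[(m1 \x m2)%E]_z g z.
Proof.
move=> ig; have mgE := measurable_int _ ig.
have mg : measurable_fun setT g by exact/measurable_EFinP.
have mG : measurable_fun setT (EFin \o (fun x => \int[m2]_y g (x, y))).
  by apply/measurable_EFinP; exact: measurable_Rintegral_param.
have iG : m1.-integrable setT (EFin \o (fun x => \int[m2]_y g (x, y))).
  apply/integrableP; split => //.
  apply: le_lt_trans ((integrable12ltyP m1 m2 mgE).1 ig).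
  apply: ge0_le_integral => //.
  - exact: measurableT_comp.
  - have := @measurable_fun_fubini_tonelli_F _ _ _ _ _ m2 (abse \o (EFin \o g)).
    apply; last by move=> z; exact: abse_ge0.
    exact: measurableT_comp.
  - move=> x _ /=; apply: le_trans (abse_fine_le _) _.
    apply: le_abse_integral => //; apply: (measurableT_comp mgE).
    exact: measurable_pair1.
split => //.
transitivity (fine (\int[(m1 \x m2)]_z (EFin \o g) z)%E) => //.
rewrite -(integral12_prod_meas1 ig); congr fine.
apply/esym; apply: ae_eq_integral => //.
  exact: (measurable_fubini_F ig).
have := ae_integrable1 ig; apply: filterS => x /= ix _.
by rewrite /Rintegral fineK//; exact: integrable_fin_num.
Qed.

Lemma Rintegral_prod2 (g : T1 * T2 -> R) :
  (m1 \x m2)%E.-integrable setT (EFin \o g) ->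
  m2.-integrable setT (EFin \o (fun y => \int[m1]_x g (x, y))) /\
  \int[m2]_y \int[m1]_x g (x, y) = \int[(m1 \x m2)%E]_z g z.
Proof.
move=> ig; have mgE := measurable_int _ ig.
have mg : measurable_fun setT g by exact/measurable_EFinP.
have mG : measurable_fun setT (EFin \o (fun y => \int[m1]_x g (x, y))).
  by apply/measurable_EFinP; exact: measurable_Rintegral_param2.
have iG : m2.-integrable setT (EFin \o (fun y => \int[m1]_x g (x, y))).
  apply/integrableP; split => //.
  apply: le_lt_trans ((integrable21ltyP m1 m2 mgE).1 ig).
  apply: ge0_le_integral => //.
  - exact: measurableT_comp.
  - have := @measurable_fun_fubini_tonelli_G _ _ _ _ _ m1 (abse \o (EFin \o g)).
    apply; last by move=> z; exact: abse_ge0.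
    exact: measurableT_comp.
  - move=> x _ /=; apply: le_trans (abse_fine_le _) _.
    apply: le_abse_integral => //; apply: (measurableT_comp mgE).
    exact: measurable_pair2.
split => //.
transitivity (fine (\int[(m1 \x m2)]_z (EFin \o g) z)%E) => //.
rewrite -(integral21_prod_meas1 ig); congr fine.
apply/esym; apply: ae_eq_integral => //.
  exact: (measurable_fubini_G ig).
have := ae_integrable2 ig; apply: filterS => x /= ix _.
by rewrite /Rintegral fineK//; exact: integrable_fin_num.
Qed.

End fubini_real.

Section fubini_complex.
Context d1 d2 (T1 : measurableType d1) (T2 : measurableType d2) {R : realType}.
Variables (m1 : {sigma_finite_measure set T1 -> \bar R})
  (m2 : {sigma_finite_measure set T2 -> \bar R}).

Lemma cmeas_cint_param (f : T1 * T2 -> R[i]) : cmeas f ->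
  cmeas (fun x => cint m2 (fun y => f (x, y))).
Proof.
by move=> [f1 f2]; split => /=;
 [exact: (@measurable_Rintegral_param _ _ _ _ R m2 _ f1)|
  exact: (@measurable_Rintegral_param _ _ _ _ R m2 _ f2)].
Qed.

Lemma cint_prod1 (f : T1 * T2 -> R[i]) : cintegrable (m1 \x m2)%E f ->
  cintegrable m1 (fun x => cint m2 (fun y => f (x, y))) /\
  cint m1 (fun x => cint m2 (fun y => f (x, y))) = cint (m1 \x m2)%E f.
Proof.
move=> [/Rintegral_prod1[f1 e1] /Rintegral_prod1[f2 e2]]; split; first by split.
by rewrite /cint/= e1 e2.
Qed.

Lemma cint_prod2 (f : T1 * T2 -> R[i]) : cintegrable (m1 \x m2)%E f ->
  cintegrable m2 (fun y => cint m1 (fun x => f (x, y))) /\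
  cint m2 (fun y => cint m1 (fun x => f (x, y))) = cint (m1 \x m2)%E f.
Proof.
move=> [/Rintegral_prod2[f1 e1] /Rintegral_prod2[f2 e2]]; split; first by split.
by rewrite /cint/= e1 e2.
Qed.

Lemma cmeas_comp d d' (T : measurableType d) (T' : measurableType d')
  (f : T' -> R[i]) (h : T -> T') : cmeas f -> measurable_fun setT h ->
  cmeas (fun x => f (h x)).
Proof.
by move=> [f1 f2] mh; split; [exact: (measurableT_comp f1)|exact: (measurableT_comp f2)].
Qed.

Lemma integrable_mul (f : T1 -> R) (g : T2 -> R) :
  m1.-integrable setT (EFin \o f) -> m2.-integrable setT (EFin \o g) ->
  (m1 \x m2)%E.-integrable setT (EFin \o (fun z => f z.1 * g z.2)).
Proof.
move=> /[dup] iF /integrableP[mf fy] /[dup] ig /integrableP[mg gy].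
have mfg : measurable_fun setT (EFin \o (fun z : T1 * T2 => f z.1 * g z.2)).
  by apply/measurable_EFinP; apply: measurable_funM; apply: measurableT_comp => //;
    exact/measurable_EFinP.
apply/integrable12ltyP => //=.
have -> : (fun x => \int[m2]_y `|f x * g y|%:E)%E =
    (fun x => `|f x|%:E * \int[m2]_y `|(EFin \o g) y|)%E.
  apply/funext => x; under eq_integral do rewrite normrM EFinM.
  rewrite ge0_integralZl//; apply/measurable_EFinP.
  by apply: measurableT_comp => //; exact/measurable_EFinP.
rewrite ge0_integralZr//=; last 2 first.
- by apply/measurable_EFinP; apply: measurableT_comp => //; exact/measurable_EFinP.
- exact: integral_ge0.
by rewrite lte_mul_pinfty//; [exact: integral_ge0|rewrite ge0_fin_numE//; exact: integral_ge0].
Qed.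

Lemma cint_mul (f : T1 -> R[i]) (g : T2 -> R[i]) :
  cintegrable m1 f -> cintegrable m2 g ->
  cintegrable (m1 \x m2)%E (fun z => f z.1 * g z.2) /\
  cint (m1 \x m2)%E (fun z => f z.1 * g z.2) = cint m1 f * cint m2 g.
Proof.
move=> cf cg; have [mf nf] := (cintegrableP _ f).1 cf.
have [mg ng] := (cintegrableP _ g).1 cg.
have ci : cintegrable (m1 \x m2)%E (fun z => f z.1 * g z.2).
  apply/cintegrableP; split.
    by apply: cmeasM; [apply: (cmeas_comp mf)|apply: (cmeas_comp mg)].
  rewrite (_ : _ \o _ = EFin \o (fun z => normc (f z.1) * normc (g z.2))).
    exact: (integrable_mul nf ng).
  by apply/funext => z /=; rewrite normcM.
split => //; rewrite -(cint_prod1 ci).2.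
transitivity (cint m1 (fun x => cint m2 g * f x)).
  by apply: eq_cint => x; rewrite mulrC -cintZ.
by rewrite cintZ// mulrC.
Qed.

End fubini_complex.

(* The library's canonical sigma-finite structure on [m1 \x m2] is only found
   for subprobabilities; this alias restores it in general. *)
Section prod_sigma_finite.
Context d1 d2 (T1 : measurableType d1) (T2 : measurableType d2) {R : realType}.
Variables (m1 : {sigma_finite_measure set T1 -> \bar R})
  (m2 : {sigma_finite_measure set T2 -> \bar R}).

Definition prodm : set (T1 * T2) -> \bar R := (m1 \x m2)%E.

HB.instance Definition _ := Measure.on prodm.

Let prodm_sigma_finite : sigma_finite setT prodm.
Proof.
have /sigma_finiteP[F [FT Fnd Ffin]] := sigma_finiteT m1.
have /sigma_finiteP[G [GT Gnd Gfin]] := sigma_finiteT m2.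
exists (fun k => F k `*` G k).
  apply/esym; rewrite -subTset => -[x y] _.
  have [i _ Fi] : (\bigcup_k F k) x by rewrite -FT.
  have [j _ Gj] : (\bigcup_k G k) y by rewrite -GT.
  exists (maxn i j) => //; split => /=.
    by move: Fi; exact/subsetPset/Fnd/leq_maxl.
  by move: Gj; exact/subsetPset/Gnd/leq_maxr.
move=> k; have [mF Fk] := Ffin k; have [mG Gk] := Gfin k.
split; first exact: measurableX.
by rewrite /prodm product_measure1E// lte_mul_pinfty// ge0_fin_numE.
Qed.

HB.instance Definition _ := Measure_isSigmaFinite.Build _ _ _ prodm
  prodm_sigma_finite.

End prod_sigma_finite.

(** * Lebesgue measure on R^n *)

Section lebesgue_n.
Context {R : realType}.
Local Notation lam := (@lebesgue_measure R).
Local Notation mun := (@lebesgue_measure_n R).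
Local Notation R1 := (measurableTypeR R).

Lemma ge0_integral_cons n (f : euclidean R n.+1 -> \bar R) :
  measurable_fun setT f -> (forall x, (0 <= f x)%E) ->
  (\int[mun n.+1]_x f x = \int[lam]_a \int[mun n]_t f (tcons (a, t)))%E.
Proof.
move=> mf f0.
rewrite (_ : (\int[_]_x _)%E =
  (\int[pushforward (lam \x mun n)%E (@tcons R n)]_x f x)%E); last by [].
rewrite ge0_integral_pushforward//; last exact: measurable_tcons.
rewrite preimage_setT fubini_tonelli1//.
  by apply: measurableT_comp => //; exact: measurable_tcons.
by move=> x; exact: f0.
Qed.

Lemma Rintegral_cons n (f : euclidean R n.+1 -> R) : measurable_fun setT f ->
  \int[mun n.+1]_x f x = \int[(lam \x mun n)%E]_z f (tcons z).
Proof.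
move=> mf; have mF : measurable_fun setT (EFin \o f) by exact/measurable_EFinP.
have mt := @measurable_tcons R n.
rewrite /Rintegral [in LHS]integralE [in RHS]integralE.
have p g : measurable_fun setT g -> (forall x, (0 <= g x)%E) ->
    (\int[mun n.+1]_x g x = \int[(lam \x mun n)]_z g (tcons z))%E.
  move=> mg g0; rewrite (_ : (\int[mun n.+1]_x _)%E =
    (\int[pushforward (lam \x mun n)%E (@tcons R n)]_x g x)%E)//.
  by rewrite ge0_integral_pushforward.
rewrite p//; last exact: measurable_funepos.
rewrite p//; last exact: measurable_funeneg.
by congr (fine (_ - _)%E); apply: eq_integral => z _; rewrite ?funeposE ?funenegE.
Qed.

Lemma cint_cons n (f : euclidean R n.+1 -> R[i]) : cmeas f ->
  cint (mun n.+1) f = cint (lam \x mun n)%E (fun z => f (tcons z)).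
Proof. by move=> [f1 f2]; rewrite /cint !Rintegral_cons. Qed.

Lemma Rintegral_nil (f : euclidean R 0 -> R) : \int[mun 0]_x f x = f [tuple].
Proof.
rewrite /Rintegral/= integral_dirac//.
  by rewrite diracT mul1e.
(* There is only one tuple of length 0, so every preimage is empty or the whole space. *)
by apply: measurableT_comp => //; move=> _ A _; rewrite setTI;
 have [->|->] : f @^-1` A = set0 \/ f @^-1` A = setT; rewrite ?measurableT//;
 have [fA|fA] := pselect (A (f [tuple])); [right|left]; apply/seteqP; split=> // x //=;
 rewrite (tuple0 x).
Qed.

(** Uniqueness of Lebesgue measure: a times the image measure under x -> h + a x gives every
    half-open interval its length. *)
Lemma ge0_integral_affine1 (f : R1 -> \bar R) (a h : R) : 0 < a ->
  measurable_fun setT f -> (forall x, (0 <= f x)%E) ->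
  (\int[lam]_x f x = a%:E * \int[lam]_x f (h + a * x)%R)%E.
Proof.
move=> a0 mf f0.
have mphi : measurable_fun setT ((fun x => h + a * x) : R1 -> R1).
  by apply: measurable_funD => //; apply: measurable_funM.
pose pf := measure_function_pushforward__canonical__measure_function_Measure lam mphi.
pose mu' : {measure set R1 -> \bar R} := mscale (NngNum (ltW a0)) pf.
have e A : measurable A -> lam A = mu' A.
  apply: (@lebesgue_measure_unique R mu') => _ [[b c] /= _ <-].
  change (lam `]b, c] = a%:E * lam ((fun x : R1 => h + a * x)%R @^-1` `]b, c]))%E.
  rewrite (_ : _ @^-1` _ = `](b - h) / a, (c - h) / a]%classic); last first.
    apply/seteqP; split => x /=; rewrite !in_itv/= ltr_pdivrMr// ler_pdivlMr//;
    rewrite ltrBlDl lerBrDl (mulrC x) //.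
  rewrite !lebesgue_measure_itv/= !lte_fin ltr_pM2r ?invr_gt0// ltrD2r.
  case: ifPn => _; last by rewrite mule0.
  by rewrite -!EFinB -EFinM; congr EFin; field; rewrite gt_eqF.
rewrite (eq_measure_integral mu')//; last by move=> A mA _; exact: e.
rewrite ge0_integral_mscale//; congr (_ * _)%E.
by rewrite ge0_integral_pushforward.
Qed.

Definition affv n (a : R) (h x : euclidean R n) : euclidean R n :=
  [tuple tnth h j + a * tnth x j | j < n].

Lemma measurable_affv n a (h : euclidean R n) : measurable_fun setT (affv a h).
Proof.
apply/measurable_fun_tnthP => j.
rewrite (_ : _ \o _ = (fun x => tnth h j + a * tnth x j)); last first.
  by apply/funext => x /=; rewrite tnth_mktuple.
apply: measurable_funD => //; apply: measurable_funM => //.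
exact: measurable_tnth.
Qed.

Lemma affv_tcons n a (h : euclidean R n.+1) x (t : euclidean R n) :
  affv a h (tcons (x, t)) =
  tcons (tnth h ord0 + a * x, affv a [tuple tnth h (lift ord0 j) | j < n] t).
Proof.
apply: eq_from_tnth => j; rewrite tnth_mktuple.
have [k ->|->] := unliftP ord0 j; last by rewrite !tnth0.
by rewrite !tnthS !tnth_mktuple.
Qed.

(** Induction on the dimension through Tonelli: the tail is substituted for each fixed first
    coordinate, then the first coordinate itself. The translation [h] is generalised because the
    tail has its own. *)
Lemma ge0_integral_affv n (f : euclidean R n -> \bar R) (a : R) h : 0 < a ->
  measurable_fun setT f -> (forall x, (0 <= f x)%E) ->
  (\int[mun n]_x f x = (a ^+ n)%:E * \int[mun n]_x f (affv a h x))%E.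
Proof.
move=> a0; elim: n => [|n IH] in f h * => mf f0.
  by rewrite expr0 mul1e; apply: eq_integral => x _; rewrite (tuple0 x) (tuple0 (affv _ _ _)).
rewrite ge0_integral_cons// ge0_integral_cons//; last first.
  by apply: measurableT_comp => //; exact: measurable_affv.
have mF : measurable_fun setT (fun z : R1 * euclidean R n => f (tcons z)).
  by apply: measurableT_comp => //; exact: measurable_tcons.
pose h' : euclidean R n := [tuple tnth h (lift ord0 j) | j < n].
have mfa : measurable_fun setT (fun x => f (affv a h x)).
  by apply: (measurableT_comp mf); exact: measurable_affv.
have -> : (fun x => \int[mun n]_t f (tcons (x, t)))%E =
    (fun x => (a ^+ n)%:E * \int[mun n]_t f (tcons (x, affv a h' t)))%E.
  apply/funext => x; rewrite (IH _ h')//.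
  by apply: (measurableT_comp mF); exact: measurable_pair1.
have mH : measurable_fun setT (fun x => \int[mun n]_t f (tcons (x, affv a h' t)))%E.
  have := @measurable_fun_fubini_tonelli_F _ _ _ _ _ (mun n)
    (fun z : R1 * euclidean R n => f (tcons (z.1, affv a h' z.2))).
  apply; last by move=> z; exact: f0.
  apply: (measurableT_comp mf); apply: (measurableT_comp (@measurable_tcons R n)).
  apply: measurable_fun_pair => //=; apply: measurableT_comp => //.
  exact: measurable_affv.
rewrite ge0_integralZl//; last 2 first.
- by move=> x _; exact: integral_ge0.
- by rewrite lee_fin exprn_ge0// ltW.
rewrite [in LHS](@ge0_integral_affine1 _ a (tnth h ord0))//; last first.
  by move=> x; exact: integral_ge0.
rewrite muleA exprSr EFinM; congr (_ * _)%E.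
by apply: eq_integral => x _; apply: eq_integral => t _; rewrite affv_tcons.
Qed.

End lebesgue_n.

(** * Dominated convergence and changes of variables *)

Section dominated_convergence_real.
Context d (T : measurableType d) {R : realType}.
Variable mu : {measure set T -> \bar R}.

Lemma Rintegral_dct (f_ : nat -> T -> R) (f g : T -> R) :
  (forall n, measurable_fun setT (f_ n)) ->
  (forall x, f_ ^~ x @ \oo --> f x) ->
  mu.-integrable setT (EFin \o g) -> (forall n x, `|f_ n x| <= g x) ->
  mu.-integrable setT (EFin \o f) /\
  \int[mu]_x f_ n x @[n --> \oo] --> \int[mu]_x f x.
Proof.
move=> mf_ f_f ig fg.
have mf : measurable_fun setT f.
  by apply: (measurable_fun_cvg (h := f_)) => // x _; exact: f_f.
have [||||i0 _ i1] := @dominated_convergence _ _ _ mu setT measurableT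
    (fun n x => (f_ n x)%:E) (EFin \o f) (EFin \o g) _ _ _ ig.
- by move=> n; exact/measurable_EFinP.
- exact/measurable_EFinP.
- by apply: aeW => x _; apply: cvg_EFin; [exact: nearW|exact: f_f].
- by apply: aeW => x n _; rewrite lee_fin.
split => //; rewrite /Rintegral; apply: fine_cvg.
by rewrite fineK//; exact: integrable_fin_num.
Qed.

Lemma cint_dct (f_ : nat -> T -> R[i]) (f : T -> R[i]) (g : T -> R) :
  (forall n, cmeas (f_ n)) ->
  (forall x, complex.Re (f_ n x) @[n --> \oo] --> complex.Re (f x)) ->
  (forall x, complex.Im (f_ n x) @[n --> \oo] --> complex.Im (f x)) ->
  mu.-integrable setT (EFin \o g) -> (forall n x, normc (f_ n x) <= g x) ->
  [/\ cintegrable mu f,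
   complex.Re (cint mu (f_ n)) @[n --> \oo] --> complex.Re (cint mu f) &
   complex.Im (cint mu (f_ n)) @[n --> \oo] --> complex.Im (cint mu f)].
Proof.
move=> mf cr ci ig fg.
have [i1 c1] := Rintegral_dct (fun n => (mf n).1) cr ig
  (fun n x => le_trans (normr_Re _) (fg n x)).
have [i2 c2] := Rintegral_dct (fun n => (mf n).2) ci ig
  (fun n x => le_trans (normr_Im _) (fg n x)).
by split.
Qed.

Lemma integrable_scale (k : R) (f : T -> R) : mu.-integrable setT (EFin \o f) ->
  mu.-integrable setT (EFin \o (fun x => k * f x)).
Proof. exact: (integrableZl measurableT k). Qed.

Lemma Rintegral_exhaust (A : nat -> set T) (f : T -> R) :
  (forall n, measurable (A n)) -> (forall x, \forall n \near \oo, A n x) ->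
  mu.-integrable setT (EFin \o f) ->
  \int[mu]_(x in A n) f x @[n --> \oo] --> \int[mu]_x f x.
Proof.
move=> mA Ax iF.
have mf : measurable_fun setT f by apply/measurable_EFinP; exact: measurable_int iF.
under eq_cvg do rewrite Rintegral_mkcond.
have [||||//] := @Rintegral_dct (fun n => f \_ (A n)) f (fun x => `|f x|).
- by move=> n; apply/(measurable_restrictT _ (mA n)); exact: measurable_funTS.
- move=> x; apply: cvg_near_cst; near=> n.
  by rewrite patchE mem_set//; near: n; exact: Ax.
- exact: integrable_norm iF.
- by move=> n x; rewrite patchE; case: ifPn => // _; rewrite normr0.
Unshelve. all: end_near. Qed.

End dominated_convergence_real.

Section affine_change.
Context {R : realType}.
Local Notation lam := (@lebesgue_measure R).
Local Notation mun := (@lebesgue_measure_n R).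
Local Notation R1 := (measurableTypeR R).

(** A change of variables known for nonnegative functions extends to integrable ones through
    positive and negative parts. The map [phi] is arbitrary so that affine maps and the reflection x
    -> - x are both covered. *)
Lemma Rintegral_transfer d (T : measurableType d) (mu : {measure set T -> \bar R})
    (phi : T -> T) (k : R) (f : T -> R) : 0 < k -> measurable_fun setT phi ->
  (forall g : T -> \bar R, measurable_fun setT g -> (forall x, (0 <= g x)%E) ->
    (\int[mu]_x g x = k%:E * \int[mu]_x g (phi x))%E) ->
  mu.-integrable setT (EFin \o f) ->
  mu.-integrable setT (EFin \o (f \o phi)) /\
  \int[mu]_x f x = k * \int[mu]_x f (phi x).
Proof.
move=> k0 mphi H iF; have mf := measurable_int _ iF.
have mfp : measurable_fun setT (EFin \o (f \o phi)) by exact: (measurableT_comp mf mphi).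
have iG : mu.-integrable setT (EFin \o (f \o phi)).
  apply/integrableP; split => //.
  move/integrableP : iF => [_]; rewrite H//; last by apply: measurableT_comp.
  have : (0 <= \int[mu]_x `|(EFin \o f) (phi x)|)%E by exact: integral_ge0.
  rewrite /comp; case: (\int[mu]_x _)%E => [r _ _||]//; first exact: ltry.
  by rewrite gt0_muley// lte_fin.
split => //.
transitivity (k * fine (\int[mu]_x (EFin \o (f \o phi)) x)%E) => //.
rewrite -[k in RHS]/(fine k%:E) -fineM//; last exact: integrable_fin_num.
rewrite /Rintegral; congr fine.
rewrite [in LHS]integralE [in RHS]integralE muleBr//; last first.
  apply: fin_num_adde_defl; rewrite fin_numN.
  by apply: integrable_neg_fin_num.
rewrite H//; last exact: measurable_funepos.
rewrite [X in (_ - X = _)%E]H//; last exact: measurable_funeneg.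
by congr (k%:E * _ - k%:E * _)%E; apply: eq_integral => x _;
  rewrite ?funeposE ?funenegE.
Qed.

Lemma Rintegral_affine1 (f : R1 -> R) (a h : R) : 0 < a ->
  lam.-integrable setT (EFin \o f) ->
  lam.-integrable setT (EFin \o (fun x => f (h + a * x))) /\
  \int[lam]_x f x = a * \int[lam]_x f (h + a * x).
Proof.
move=> a0; apply: (@Rintegral_transfer _ _ lam (fun x : R1 => (h + a * x : R1))) => //.
  by apply: measurable_funD => //; apply: measurable_funM.
by move=> g mg g0; rewrite (ge0_integral_affine1 h a0).
Qed.

Lemma Rintegral_affv n (f : euclidean R n -> R) a h : 0 < a ->
  (mun n).-integrable setT (EFin \o f) ->
  (mun n).-integrable setT (EFin \o (fun x => f (affv a h x))) /\
  \int[mun n]_x f x = a ^+ n * \int[mun n]_x f (affv a h x).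
Proof.
move=> a0; apply: (@Rintegral_transfer _ _ (mun n) (affv a h)).
- by rewrite exprn_gt0.
- exact: measurable_affv.
- by move=> g mg g0; rewrite (ge0_integral_affv h a0).
Qed.

End affine_change.

(** * Gaussian integrals *)

Section gauss1.
Context {R : realType}.
Local Notation lam := (@lebesgue_measure R).
Local Notation R1 := (measurableTypeR R).

Lemma integrable_gauss_scaled (b m : R) : 0 < b ->
  lam.-integrable setT (EFin \o (fun x => expR (- (b * (x - m) ^+ 2)))) /\
  \int[lam]_x expR (- (b * (x - m) ^+ 2)) = Num.sqrt (pi / b).
Proof.
move=> b0; have sb0 : 0 < Num.sqrt b by rewrite sqrtr_gt0.
have [i e] := Rintegral_affine1 (- (Num.sqrt b * m)) sb0 (@integrableT_gauss R).
have E x : gauss_fun (- (Num.sqrt b * m) + Num.sqrt b * x) = expR (- (b * (x - m) ^+ 2)).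
  rewrite /gauss_fun; congr expR.
  by rewrite -[in RHS](sqr_sqrtr (ltW b0)); ring.
split; first by move: i; congr integrable; apply/funext => x /=; rewrite E.
move: e; rewrite /Rintegral integralT_gauss/=.
under eq_integral do rewrite E.
move=> e; apply: (mulfI (lt0r_neq0 sb0)); rewrite -e.
rewrite -sqrtrM ?ltW//; congr Num.sqrt; field; exact: lt0r_neq0.
Qed.

Let gs (x : R) := expR (- x ^+ 2).

Let gsE : gs = fun x => expR (- (1 * (x - 0) ^+ 2)).
Proof. by apply/funext => x; rewrite mul1r subr0. Qed.

Let igs : lam.-integrable setT (EFin \o gs).
Proof. by rewrite gsE; have [] := @integrable_gauss_scaled 1 0 ltr01. Qed.

Let ixgs : lam.-integrable setT (EFin \o (fun x => 2 * `|x| * gs x)).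
Proof.
have h0 : 0 < 2^-1 :> R by [].
have [i _] := @integrable_gauss_scaled 2^-1 0 h0.
apply: le_integrable (integrableZl measurableT 2 i) => //.
  apply/measurable_EFinP; apply: measurable_funM.
    by apply: measurable_funM => //; apply: measurableT_comp.
  by apply: measurableT_comp => //; apply: measurable_funN; exact: measurable_funX.
move=> x _ /=; rewrite lee_fin !normrM normr_id (ger0_norm (expR_ge0 _)).
rewrite (ger0_norm (expR_ge0 _)) -mulrA ler_wpM2l//.
(* The dominating function is 2 exp (- x^2 / 2), because |x| <= 1 + x^2 / 2 <= exp (x^2 / 2). *)
have -> : - (2^-1 * (x - 0) ^+ 2) = (2^-1 * x ^+ 2) + (- x ^+ 2) by field.
rewrite expRD ler_wpM2r ?expR_ge0//.
apply: le_trans (expR_ge1Dx _).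
have := sqr_ge0 (`|x| - 1); rewrite sqrrB real_normK ?num_real// expr1n mulr1 mulr2n.
lra.
Qed.

Let mtrig (h : R -> R) (t : R) : continuous h -> measurable_fun setT (fun x : R1 => h (t * x)).
Proof.
move=> ch; apply: (measurableT_comp (continuous_measurable_fun ch)).
exact: measurable_funM.
Qed.

Let igcos t : lam.-integrable setT (EFin \o (fun x => gs x * cos (t * x))).
Proof.
apply: le_integrable igs => //.
  apply/measurable_EFinP; apply: measurable_funM.
    by apply: measurableT_comp => //; apply: measurable_funN; exact: measurable_funX.
  by apply: mtrig; exact: continuous_cos.
by move=> x _ /=; rewrite lee_fin normrM ler_piMr// cos_max.
Qed.

Let igsin t : lam.-integrable setT (EFin \o (fun x => gs x * sin (t * x))).
Proof.
apply: le_integrable igs => //.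
  apply/measurable_EFinP; apply: measurable_funM.
    by apply: measurableT_comp => //; apply: measurable_funN; exact: measurable_funX.
  by apply: mtrig; exact: continuous_sin.
by move=> x _ /=; rewrite lee_fin normrM ler_piMr// sin_max.
Qed.

Let ixgsin t : lam.-integrable setT (EFin \o (fun x => 2 * x * gs x * sin (t * x))).
Proof.
apply: le_integrable ixgs => //.
  apply/measurable_EFinP; apply: measurable_funM.
    apply: measurable_funM; first by apply: measurable_funM.
    by apply: measurableT_comp => //; apply: measurable_funN; exact: measurable_funX.
  by apply: mtrig; exact: continuous_sin.
move=> x _ /=; rewrite lee_fin !normrM normr_id.
by rewrite ler_piMr// ?sin_max// ?mulr_ge0.
Qed.

Let dF t (x : R) : is_derive x 1 (fun x => gs x * sin (t * x))
  (t * (gs x * cos (t * x)) - 2 * x * gs x * sin (t * x)).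
Proof.
rewrite /gs; apply: trigger_derive; rewrite /GRing.scale/=; ring.
Qed.

(* The integral over the line of the derivative of [gs x * sin (t * x)] vanishes. *)
Let gauss_parts t :
  t * \int[lam]_x (gs x * cos (t * x)) = \int[lam]_x (2 * x * gs x * sin (t * x)).
Proof.
pose f x : R := t * (gs x * cos (t * x)) - 2 * x * gs x * sin (t * x).
pose F x : R := gs x * sin (t * x).
have iF : lam.-integrable setT (EFin \o f).
  have /= := integrableB measurableT (integrableZl measurableT t (igcos t)) (ixgsin t).
  by [].
have cf : continuous f.
  move=> x; apply/differentiable_continuous/derivable1_diffP.
  rewrite /f /gs; exact: ex_derive.
have lim1 : \int[lam]_(x in `[- n%:R, n%:R]) f x @[n --> \oo] --> \int[lam]_x f x.
  apply: Rintegral_exhaust => //.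
  move=> x; near=> n; rewrite /= in_itv/= -ler_norml.
  by near: n; exact: nbhs_infty_ger.
have lim2 : \int[lam]_(x in `[- n%:R, n%:R]) f x @[n --> \oo] --> 0.
  have ub n : `|\int[lam]_(x in `[- n.+1%:R, n.+1%:R]) f x| <= 2 * gauss_fun n.+1%:R.
    rewrite /Rintegral (@continuous_FTC2 _ f F)//.
    - rewrite /= /F /gs sqrrN; apply: le_trans (ler_normB _ _) _.
      rewrite !normrM !(ger0_norm (expR_ge0 _)) mulr_natl mulr2n.
      by apply: lerD; rewrite ler_piMr ?expR_ge0// sin_max.
    - by rewrite ltrNl -subr_gt0 opprK addr_gt0.
    - by apply: continuous_subspaceT.
    - have cF : continuous F.
        by move=> x; apply/differentiable_continuous/derivable1_diffP; have := dF t x => d; exact: ex_derive.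
      split; [|exact/cvg_at_right_filter/cF|exact/cvg_at_left_filter/cF].
      by move=> x _; have := dF t x => d; exact: ex_derive.
    - by move=> x _; rewrite derive1E; have := dF t x => d; rewrite derive_val.
  rewrite -(cvg_shiftS (fun n => \int[lam]_(x in `[- n%:R, n%:R]) f x)).
  apply: norm_cvg0; apply: (@squeeze_cvgr _ _ _ _ (fun=> 0) (fun n => 2 * gauss_fun n.+1%:R)).
  - by apply: nearW => n; rewrite normr_ge0/= ub.
  - exact: cvg_cst.
  - rewrite -(mulr0 2); apply: cvgMr => //.
    have := @cvg_comp _ _ _ (fun n => n.+1%:R : R) gauss_fun _ _ _ _ (@cvg_gauss_fun R).
    by apply; rewrite (cvg_shiftS (fun n => n%:R : R)); exact: cvgr_idn.
have : \int[lam]_x f x = 0 by exact: (cvg_unique _ lim1 lim2).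
rewrite /f RintegralB//; last exact: integrable_scale (igcos t).
by rewrite RintegralZl// => /eqP; rewrite subr_eq0 => /eqP.
Unshelve. all: end_near. Qed.

(** Differentiation under the integral sign, dominated by 2 |x| exp (- x^2) whatever the parameter;
    [gauss_parts] then turns the differentiated integral into a multiple of the original one. *)
Let gauss_cos_derive (t : R) :
  is_derive t 1 (fun t => \int[lam]_x (gs x * cos (t * x)))
    (- 2^-1 * t * \int[lam]_x (gs x * cos (t * x))).
Proof.
pose f (t : R) (x : R) : R := gs x * cos (t * x).
have df (s x : R) : is_derive s 1 (f ^~ x) (- (x * gs x * sin (s * x))).
  by apply: trigger_derive; rewrite /GRing.scale/=; ring.
have d1E s x : partial1of2 f s x = - (x * gs x * sin (s * x)).
  by rewrite partial1of2E derive_val.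
have tI : `](t - 1), (t + 1)[%classic t by rewrite /= in_itv/=; lra.
have h1 s : `](t - 1), (t + 1)[%classic s -> lam.-integrable setT (EFin \o f s).
  by move=> _; exact: igcos.
have h2 s x : `](t - 1), (t + 1)[%classic s -> setT x -> derivable (f ^~ x) s 1.
  by move=> _ _; exact: ex_derive.
have h3 (x : R1) : 0 <= 2 * `|x| * gs x by rewrite !mulr_ge0// expR_ge0.
have h4 s (x : R1) : `](t - 1), (t + 1)[%classic s -> setT x ->
    `|partial1of2 f s x| <= 2 * `|x| * gs x.
  move=> _ _; rewrite d1E normrN !normrM (ger0_norm (expR_ge0 _)).
  apply: le_trans (_ : `|x| * gs x <= _).
    by rewrite ler_piMr ?sin_max// mulr_ge0// expR_ge0.
  by rewrite -mulrA ler_peMl ?mulr_ge0 ?expR_ge0// ler1n.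
have e : \int[lam]_x partial1of2 f t x = - 2^-1 * t * \int[lam]_x (gs x * cos (t * x)).
  rewrite -mulrA gauss_parts -RintegralZl//.
  by apply: eq_Rintegral => x _; rewrite d1E; field.
apply: DeriveDef.
  exact: (derivable_under_integral measurableT tI h1 h2 h3 ixgs h4).
rewrite -derive1E -e.
exact: (differentiation_under_integral measurableT tI h1 h2 h3 ixgs h4).
Qed.

(** The integral G satisfies G' = - t G / 2, so G(t) exp (t^2 / 4) is constant, and its value at 0
    is the Gauss integral. *)
Let gauss_cos t : \int[lam]_x (gs x * cos (t * x)) = Num.sqrt pi * expR (- (t ^+ 2 / 4)).
Proof.
pose G t := \int[lam]_x (gs x * cos (t * x)).
have G0 : G 0 = Num.sqrt pi.
  rewrite /G; under eq_Rintegral do rewrite mul0r cos0 mulr1.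
  by rewrite gsE (@integrable_gauss_scaled 1 0 ltr01).2 divr1.
have cst : G t * expR (t ^+ 2 / 4) = G 0 * expR (0 ^+ 2 / 4).
  apply: (@is_derive_0_is_cst _ (fun t => G t * expR (t ^+ 2 / 4))) => x.
  have := gauss_cos_derive x => d.
  apply: trigger_derive; by rewrite /GRing.scale/= -/(G x); field.
move: cst; rewrite expr0n/= mul0r expR0 mulr1 G0 => <-.
by rewrite -mulrA -expRD subrr expR0 mulr1.
Qed.

Let gauss_sin t : \int[lam]_x (gs x * sin (t * x)) = 0.
Proof.
have mN : measurable_fun setT (-%R : R1 -> R1) by exact: measurable_funN.
have := @Rintegral_transfer _ _ _ lam (-%R : R1 -> R1) 1 _ ltr01 mN _ (igsin t).
case=> [g mg g0|_].
  rewrite mul1e; transitivity (\int[pushforward lam (-%R : R1 -> R1)]_x g x)%E; last first.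
    by rewrite (ge0_integral_pushforward mN).
  by apply: eq_measure_integral => A mA _; rewrite /= lebesgue_measureN.
rewrite mul1r /gs; under [X in _ = X -> _]eq_Rintegral do rewrite sqrrN mulrN sinN mulrN -mulN1r.
rewrite RintegralZl//; lra.
Qed.

(** The substitution x = m + y / sqrt b reduces the transform of a shifted Gaussian to the cosine
    and sine integrals of exp (- y^2), the sine integral being 0 by oddness. *)
Lemma cint_gauss1 (b m w : R) : 0 < b ->
  cintegrable lam (fun x => expC ((- (b * (x - m) ^+ 2)) +i* (- (w * x)))) /\
  cint lam (fun x => expC ((- (b * (x - m) ^+ 2)) +i* (- (w * x)))) =
  (Num.sqrt (pi / b))%:C * expC ((- (w ^+ 2 / (4 * b))) +i* (- (w * m))).
Proof.
move=> b0; have sb0 : 0 < Num.sqrt b by rewrite sqrtr_gt0.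
have [ib _] := integrable_gauss_scaled m b0.
have ci : cintegrable lam (fun x => expC ((- (b * (x - m) ^+ 2)) +i* (- (w * x)))).
  apply: (cintegrable_le _ ib); last by move=> x; rewrite normc_expC.
  apply: cmeas_expC; split => /=.
    apply: measurable_funN; apply: measurable_funM => //; apply: measurable_funX.
    exact: measurable_funB.
  by apply: measurable_funN; apply: measurable_funM.
split => //; pose a := (Num.sqrt b)^-1.
have a0 : 0 < a by rewrite invr_gt0.
have ab : b * a ^+ 2 = 1.
  by rewrite /a exprVn sqr_sqrtr ?ltW// divff// gt_eqF.
have sq : a * Num.sqrt pi = Num.sqrt (pi / b).
  by rewrite mulrC /a -sqrtrV ?ltW// -sqrtrM// pi_ge0.
have e4 : (w * a) ^+ 2 / 4 = w ^+ 2 / (4 * b).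
  rewrite exprMn /a exprVn sqr_sqrtr ?ltW//; field; exact: lt0r_neq0.
have [iR iI] := ci.
(* A free phase h lets one computation serve twice: h = 0 for the real part and h = pi / 2 for the
   imaginary part, since cos (u + pi / 2) = - sin u. *)
have E (h : R) : \int[lam]_x (gs x * cos (w * (m + a * x) + h)) =
    cos (w * m + h) * (Num.sqrt pi * expR (- (w ^+ 2 / (4 * b)))).
  rewrite -e4 -gauss_cos -RintegralZl//.
  rewrite -[RHS]subr0 -(mulr0 (sin (w * m + h))) -(gauss_sin (w * a)) -RintegralZl//.
  rewrite -RintegralB//.
  - apply: eq_Rintegral => x _.
    rewrite (_ : w * (m + a * x) + h = (w * m + h) + w * a * x); last by ring.
    rewrite cosD; ring.
  - by have := integrableZl measurableT (cos (w * m + h)) (igcos (w * a)).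
  - by have := integrableZl measurableT (sin (w * m + h)) (igsin (w * a)).
apply: complex_ext; rewrite ?ReM ?ImM ?Re_expC ?Im_expC /= mul0r ?addr0 ?subr0.
  rewrite (Rintegral_affine1 m a0 iR).2 -sq cosN -[w * m]addr0.
  rewrite [RHS](_ : _ = a * (cos (w * m + 0) * (Num.sqrt pi * expR (- (w ^+ 2 / (4 * b)))))); last by ring.
  rewrite -E; congr (_ * _); apply: eq_Rintegral => x _.
  rewrite Re_expC /= cosN addr0 /gs; congr (expR _ * _).
  by rewrite -[x ^+ 2]mul1r -ab; ring.
rewrite (Rintegral_affine1 m a0 iI).2 -sq sinN -cosDpihalf.
rewrite [RHS](_ : _ = a * (cos (w * m + pi / 2) * (Num.sqrt pi * expR (- (w ^+ 2 / (4 * b)))))); last by ring.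
rewrite -E; congr (_ * _); apply: eq_Rintegral => x _.
rewrite Im_expC /= sinN -cosDpihalf /gs; congr (expR _ * _).
by rewrite -[x ^+ 2]mul1r -ab; ring.
Qed.

End gauss1.

(** * Euclidean vectors *)

Section vector_algebra.
Context {R : realType}.

Section fixed_dimension.
Context {n : nat}.
Implicit Types x y z : euclidean R n.

Lemma dotvC x y : dotv x y = dotv y x.
Proof. by apply: eq_bigr => j _; rewrite mulrC. Qed.

Lemma dotv_subl x y z : dotv (subv x y) z = dotv x z - dotv y z.
Proof.
by rewrite /dotv -sumrB; apply: eq_bigr => j _; rewrite tnth_mktuple mulrBl.
Qed.

Lemma dotv_scalel a x z : dotv (scalev a x) z = a * dotv x z.
Proof.
by rewrite /dotv mulr_sumr; apply: eq_bigr => j _; rewrite tnth_mktuple mulrA.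
Qed.

Lemma dotv_affl a h x z : dotv (affv a h x) z = dotv h z + a * dotv x z.
Proof.
rewrite /dotv mulr_sumr -big_split; apply: eq_bigr => j _ /=.
by rewrite tnth_mktuple mulrDl mulrA.
Qed.

Lemma dotv_subr x y z : dotv z (subv x y) = dotv z x - dotv z y.
Proof. by rewrite !(dotvC z) dotv_subl. Qed.

Lemma dotv_scaler a x z : dotv z (scalev a x) = a * dotv z x.
Proof. by rewrite !(dotvC z) dotv_scalel. Qed.

Lemma dotvv_ge0 x : 0 <= dotv x x.
Proof. by apply: sumr_ge0 => j _; rewrite -expr2 sqr_ge0. Qed.

Lemma normv_ge0 x : 0 <= normv x. Proof. exact: sqrtr_ge0. Qed.

Lemma normv_sqr x : normv x ^+ 2 = dotv x x.
Proof. by rewrite sqr_sqrtr// dotvv_ge0. Qed.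

Lemma normv_sqrE x : normv x ^+ 2 = \sum_(j < n) tnth x j ^+ 2.
Proof. by rewrite normv_sqr; apply: eq_bigr => j _; rewrite expr2. Qed.

Lemma normv_scale a x : normv (scalev a x) = `|a| * normv x.
Proof.
rewrite /normv dotv_scalel dotv_scaler mulrA -expr2 sqrtrM ?sqr_ge0//.
by rewrite sqrtr_sqr.
Qed.

Lemma normv_subC x y : normv (subv x y) = normv (subv y x).
Proof.
rewrite /normv; congr Num.sqrt; rewrite !(dotv_subl, dotv_subr); ring.
Qed.

Lemma dotv_cauchy x y : dotv x y <= normv x * normv y.
Proof.
have [y0|y0] := eqVneq (normv y) 0.
  have : dotv y y = 0 by rewrite -normv_sqr y0 expr0n.
  move/eqP; rewrite psumr_eq0 => [/allP h|j _]; last by rewrite -expr2 sqr_ge0.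
  rewrite y0 mulr0 /dotv big1// => j _.
  by have := h j (mem_index_enum _) => /=; rewrite mulf_eq0 orbb => /eqP ->; rewrite mulr0.
have yp : 0 < normv y by rewrite lt_def y0 normv_ge0.
have [x0|x0] := leP (dotv x y) 0.
  by rewrite (le_trans x0)// mulr_ge0// normv_ge0.
rewrite -(@ler_pXn2r _ 2)// ?nnegrE ?mulr_ge0 ?normv_ge0 ?(ltW x0)//.
have := dotvv_ge0 (subv (scalev (normv y ^+ 2) x) (scalev (dotv x y) y)).
rewrite !(dotv_subl, dotv_subr, dotv_scalel, dotv_scaler) (dotvC y x) -!normv_sqr.
rewrite exprMn => h.
have : 0 <= normv y ^+ 2 * (normv x ^+ 2 * normv y ^+ 2 - dotv x y ^+ 2).
  apply: le_trans h _; rewrite le_eqVlt; apply/orP; left; apply/eqP; ring.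
by rewrite pmulr_rge0 ?exprn_gt0// subr_ge0.
Qed.

Lemma ler_normv_sub x y : normv x <= normv (subv x y) + normv y.
Proof.
rewrite -(@ler_pXn2r _ 2)// ?nnegrE ?addr_ge0 ?normv_ge0//.
rewrite sqrrD -addrA addrC !normv_sqr.
have := dotv_cauchy (subv x y) y.
rewrite !(dotv_subl, dotv_subr) (dotvC y x) mulr2n; lra.
Qed.

Lemma abs_tnth_le x j : `|tnth x j| <= normv x.
Proof.
rewrite -sqrtr_sqr ler_wsqrtr// /dotv (bigD1 j)//= expr2 lerDl.
by apply: sumr_ge0 => i _; rewrite -expr2 sqr_ge0.
Qed.

Lemma measurable_dotv d (T : measurableType d) (f g : T -> euclidean R n) :
  measurable_fun setT f -> measurable_fun setT g ->
  measurable_fun setT (fun t => dotv (f t) (g t)).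
Proof.
move=> mf mg; apply: measurable_sum => j; apply: measurable_funM.
  exact: (measurableT_comp (measurable_tnth j)).
exact: (measurableT_comp (measurable_tnth j)).
Qed.

Lemma measurable_subv d (T : measurableType d) (f g : T -> euclidean R n) :
  measurable_fun setT f -> measurable_fun setT g ->
  measurable_fun setT (fun t => subv (f t) (g t)).
Proof.
move=> mf mg; apply/measurable_fun_tnthP => j.
rewrite (_ : _ \o _ = (fun t => tnth (f t) j - tnth (g t) j)); last first.
  by apply/funext => t /=; rewrite tnth_mktuple.
apply: measurable_funB; exact: (measurableT_comp (measurable_tnth j)).
Qed.

Lemma measurable_normv2 d (T : measurableType d) (f : T -> euclidean R n) :
  measurable_fun setT f -> measurable_fun setT (fun t => normv (f t) ^+ 2).
Proof.
by move=> mf; under eq_fun do rewrite normv_sqr; exact: measurable_dotv.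
Qed.

Lemma measurable_normv d (T : measurableType d) (f : T -> euclidean R n) :
  measurable_fun setT f -> measurable_fun setT (fun t => normv (f t)).
Proof.
move=> mf; apply: (@measurableT_comp _ _ _ _ _ _ (@Num.sqrt R)).
  by apply: continuous_measurable_fun; exact: sqrt_continuous.
exact: measurable_dotv.
Qed.

End fixed_dimension.

Lemma dotv_tcons n a (s : euclidean R n) b t :
  dotv (tcons (a, s)) (tcons (b, t)) = a * b + dotv s t.
Proof.
rewrite /dotv big_ord_recl !tnth0; congr (_ + _).
by apply: eq_bigr => j _; rewrite !tnthS.
Qed.

Lemma subv_tcons n a (s : euclidean R n) b t :
  subv (tcons (a, s)) (tcons (b, t)) = tcons (a - b, subv s t).
Proof.
apply: eq_from_tnth => j; rewrite tnth_mktuple.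
by have [k ->|->] := unliftP ord0 j; rewrite ?tnth0 ?tnthS ?tnth_mktuple.
Qed.

Lemma tconsP n (x : euclidean R n.+1) : exists a s, x = tcons (a, s).
Proof. by exists (thead x), [tuple of behead x]; rewrite /tcons -tuple_eta. Qed.

End vector_algebra.

Lemma realCM (R : realType) (x y : R) : (x * y)%:C = x%:C * y%:C.
Proof. by apply: complex_ext; rewrite ?ReM ?ImM /=; ring. Qed.

Section gaussn.
Context {R : realType}.
Local Notation lam := (@lebesgue_measure R).
Local Notation mun := (@lebesgue_measure_n R).
Local Notation R1 := (measurableTypeR R).

Lemma cintegrable_cons n (f : euclidean R n.+1 -> R[i]) : cmeas f ->
  cintegrable (lam \x mun n)%E (fun z => f (tcons z)) -> cintegrable (mun n.+1) f.
Proof.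
move=> mf /cintegrableP[_ /integrableP[_ fy]]; apply/cintegrableP; split => //.
have mn : measurable_fun setT (EFin \o (fun x => normc (f x))).
  by apply/measurable_EFinP; exact: cmeas_norm.
apply/integrableP; split => //.
rewrite (_ : (\int[_]_x _)%E = (\int[pushforward (lam \x mun n)%E (@tcons R n)]_x
   `|(EFin \o (fun x => normc (f x))) x|)%E)//.
rewrite ge0_integral_pushforward//; first exact: measurable_tcons.
exact: measurableT_comp.
Qed.

Definition gaussC n (b : R) (m w x : euclidean R n) : R[i] :=
  expC ((- (b * normv (subv x m) ^+ 2)) +i* (- dotv w x)).

Lemma cmeas_gaussC n b (m w : euclidean R n) : cmeas (gaussC b m w).
Proof.
apply: cmeas_expC; split => /=; apply: measurable_funN.
  by apply: measurable_funM => //; apply: measurable_normv2; exact: measurable_subv.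
exact: measurable_dotv.
Qed.

Lemma cint_gaussn n (b : R) (m w : euclidean R n) : 0 < b ->
  cintegrable (mun n) (gaussC b m w) /\
  cint (mun n) (gaussC b m w) =
  (Num.sqrt (pi / b) ^+ n)%:C *
  expC ((- (normv w ^+ 2 / (4 * b))) +i* (- dotv w m)).
Proof.
move=> b0; elim: n => [|n IH] in m w *.
  split.
    apply: (@cintegrable_le _ _ _ _ _ (fun=> 1)).
    - exact: cmeas_gaussC.
    - apply/integrableP; split; first exact: measurable_cst.
      under eq_integral do rewrite /= normr1.
      by rewrite integral_cst// mul1e /= diracT ltry.
    - move=> x; rewrite normc_expC /= -expR0 ler_expR oppr_le0.
      by rewrite mulr_ge0 ?sqr_ge0// ltW.
  rewrite /cint !Rintegral_nil /gaussC expr0 mul1r normv_sqrE normv_sqrE /dotv !big_ord0.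
  by apply: complex_ext; rewrite ?Re_expC ?Im_expC/= mulr0 mul0r.
have [m0 [mt ->]] := tconsP m; have [w0 [wt ->]] := tconsP w.
have [i1 e1] := cint_gauss1 m0 w0 b0.
have [i2 e2] := IH mt wt.
have E (z : R1 * euclidean R n) : gaussC b (tcons (m0, mt)) (tcons (w0, wt)) (tcons z) =
    expC ((- (b * (z.1 - m0) ^+ 2)) +i* (- (w0 * z.1))) * gaussC b mt wt z.2.
  case: z => z0 zt; rewrite /gaussC -expCD !normv_sqr subv_tcons !dotv_tcons /=.
  by congr expC; apply: complex_ext; rewrite ?ReD ?ImD/=; ring.
have [i3 e3] := cint_mul i1 i2.
split.
  apply: cintegrable_cons; first exact: cmeas_gaussC.
  by move: i3; congr cintegrable; apply/funext => z; rewrite E.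
rewrite cint_cons; last exact: cmeas_gaussC.
under eq_cint do rewrite E.
rewrite e3 e1 e2 mulrACA (exprS _ n) realCM; congr (_ * _).
rewrite -expCD !normv_sqr !dotv_tcons; congr expC.
by apply: complex_ext; rewrite ?ReD ?ImD/=; ring.
Qed.

Lemma integrable_gaussn n (b : R) (m : euclidean R n) : 0 < b ->
  (mun n).-integrable setT (EFin \o (fun x => expR (- (b * normv (subv x m) ^+ 2)))) /\
  \int[mun n]_x expR (- (b * normv (subv x m) ^+ 2)) = Num.sqrt (pi / b) ^+ n.
Proof.
move=> b0; have [i e] := cint_gaussn m (subv m m) b0.
have E x : gaussC b m (subv m m) x = (expR (- (b * normv (subv x m) ^+ 2)))%:C.
  by rewrite /gaussC -expC_real dotv_subl subrr oppr0.
have := e; under eq_cint do rewrite E.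
rewrite cint_re [expC _](_ : _ = 1) ?mulr1; last first.
  by rewrite normv_sqr !(dotv_subl, dotv_subr) !subrr mul0r oppr0 -[RHS]expC0.
move=> /complexI ->; split => //.
have [+ _] := i; congr (integrable _ _ (EFin \o _)).
by apply/funext => x; rewrite E.
Qed.

(** On the ball, exp (r^2) exp (- |x|^2) is at least 1, so a multiple of a Gaussian dominates the
    indicator. *)
Lemma integrable_ball n (r : R) :
  (mun n).-integrable setT (EFin \o (fun x : euclidean R n => (nat_of_bool (normv x <= r))%:R)).
Proof.
have [i _] := @integrable_gaussn n 1 [tuple 0 | j < n] ltr01.
apply: le_integrable (integrable_scale (expR (r ^+ 2)) i) => //.
  apply/measurable_EFinP.
  rewrite (_ : (fun _ => _) = (fun b : bool => (nat_of_bool b)%:R : R) \o (fun x => normv x <= r))//.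
  apply: measurableT_comp => //.
  by apply: measurable_fun_ler => //; exact: measurable_normv.
move=> x _ /=; rewrite lee_fin; case: (leP (normv x) r) => h /=; last by rewrite normr0.
rewrite normr1 ger0_norm ?mulr_ge0 ?expR_ge0// -expRD mul1r -expR0 ler_expR.
have -> : normv (subv x [tuple 0 | j < n]) = normv x.
  rewrite /normv; congr Num.sqrt; apply: eq_bigr => j _.
  by rewrite !tnth_mktuple subr0.
by rewrite subr_ge0 ler_pXn2r// nnegrE ?normv_ge0// (le_trans (normv_ge0 _) h).
Qed.

(** The indicator of the origin lies below exp (- b |x|^2) for every b > 0, and the integral (pi /
    b)^(n/2) tends to 0 as b grows. In dimension 0 the measure is a Dirac mass and the conclusion
    fails. *)
Lemma lebesgue_normv0 n : (0 < n)%N ->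
  mun n [set x : euclidean R n | normv x = 0] = 0%E.
Proof.
move=> n0; set Z := [set x | _].
have mZ : measurable Z.
  have := @measurable_normv R n _ _ id (@measurable_id _ _ setT).
  by move=> /(_ measurableT [set 0] (measurable_set1 _)); rewrite setTI.
have ub (b : R) : 0 < b -> (mun n Z <= (Num.sqrt (pi / b) ^+ n)%:E)%E.
  move=> b0; have [i e] := @integrable_gaussn n b [tuple 0 | j < n] b0.
  rewrite -[mun n Z]mul1e -(setIT Z) -integral_indic// -e /Rintegral fineK; last first.
    exact: integrable_fin_num.
  rewrite mul1e; apply: ge0_le_integral => //.
  - exact/measurable_EFinP/measurable_indic.
  - exact: measurable_int i.
  move=> x _; rewrite lee_fin indicE; case: (boolP (x \in Z)) => [|_]; last exact: expR_ge0.
  rewrite inE /Z/= => x0.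
  have -> : normv (subv x [tuple 0 | j < n]) = normv x.
    rewrite /normv; congr Num.sqrt; apply: eq_bigr => j _.
    by rewrite !tnth_mktuple subr0.
  by rewrite x0 expr0n/= mulr0 oppr0 expR0.
apply/eqP; rewrite -measure_le0; apply/lee_addgt0Pr => e e0; rewrite add0e.
(* This b gives the Gaussian integral the value (min e 1)^n; since the base is at most 1 and n is
   positive, the power is at most e. *)
have := ub (pi / (Num.min e 1) ^+ 2).
have m0 : 0 < Num.min e 1 by rewrite lt_min e0 ltr01.
rewrite divr_gt0 ?pi_gt0 ?exprn_gt0// => /(_ isT)/le_trans; apply.
rewrite invf_div mulrCA divff ?gt_eqF ?pi_gt0// mulr1 sqrtr_sqr (gtr0_norm m0) lee_fin.
case: n n0 {Z mZ ub} => // n _; rewrite exprS.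
apply: le_trans (_ : Num.min e 1 <= _); last by rewrite ge_min lexx.
by rewrite ler_piMr ?(ltW m0)// exprn_ile1 ?(ltW m0)// ge_min lexx orbT.
Qed.

End gaussn.

Lemma conjcM (R : realType) (z w : R[i]) : ((z * w)^*)%C = (z^*)%C * (w^*)%C.
Proof. by apply: complex_ext; rewrite !(ReJ, ImJ, ReM, ImM); ring. Qed.

(** * Plancherel's theorem *)

Section kernel_identity.
Context {R : realType} {n : nat}.
Local Notation mun := (@lebesgue_measure_n R n).
Local Notation E := (euclidean R n).
Implicit Types f : E -> R[i].

Definition wave (eta u : E) : R[i] := expC (0 +i* (- dotv eta u)).

Lemma fourierL1E f eta : fourierL1 f eta = cint mun (fun u => wave eta u * f u).
Proof.
rewrite /fourierL1 /integralC /cint/wave; congr (_ +i* _); apply: eq_Rintegral => u _.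
  by congr (complex.Re (expC _ * _)); apply: complex_ext; rewrite ?ReN ?ImN ?ReM ?ImM/=; ring.
by congr (complex.Im (expC _ * _)); apply: complex_ext; rewrite ?ReN ?ImN ?ReM ?ImM/=; ring.
Qed.

Lemma normc_wave eta u : normc (wave eta u) = 1.
Proof. by rewrite normc_expC expR0. Qed.

Lemma normc_waveM eta u z : normc (wave eta u * z) = normc z.
Proof. by rewrite normcM normc_wave mul1r. Qed.

Lemma cmeas_wave d (T : measurableType d) (p q : T -> E) :
  measurable_fun setT p -> measurable_fun setT q ->
  cmeas (fun t => wave (p t) (q t)).
Proof.
move=> mp mq; apply: cmeas_expC; split => /=; first exact: measurable_cst.
by apply: measurable_funN; exact: measurable_dotv.
Qed.

Lemma cintegrable_wave f eta : cintegrable mun f ->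
  cintegrable mun (fun u => wave eta u * f u).
Proof.
move=> /[dup] /cintegrable_meas mf /cintegrableP[_ nf].
apply: (cintegrable_le _ nf).
  by apply: cmeasM => //; apply: cmeas_wave.
by move=> x; rewrite normcM normc_wave mul1r.
Qed.

Lemma cmeas_fourierL1 f : cmeas f -> cmeas (fourierL1 f).
Proof.
move=> mf; rewrite (_ : fourierL1 f = fun eta => cint mun (fun u => wave eta u * f u)).
  apply: (@cmeas_cint_param _ _ _ _ R mun (fun z : E * E => wave z.1 z.2 * f z.2)).
  by apply: cmeasM; [exact: cmeas_wave|exact: (cmeas_comp mf)].
by apply/funext => eta; rewrite fourierL1E.
Qed.

Lemma normc_fourierL1_le f eta : cintegrable mun f ->
  normc (fourierL1 f eta) <= \int[mun]_u normc (f u).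
Proof.
move=> iF; rewrite fourierL1E; apply: le_trans (normc_cint_le (cintegrable_wave eta iF)) _.
by rewrite le_eqVlt; apply/orP; left; apply/eqP; apply: eq_Rintegral => u _;
  rewrite normcM normc_wave mul1r.
Qed.

Lemma fourierL1B f g eta : cintegrable mun f -> cintegrable mun g ->
  fourierL1 (fun u => f u - g u) eta = fourierL1 f eta - fourierL1 g eta.
Proof.
move=> fi gi; rewrite !fourierL1E -cintB; [|exact: cintegrable_wave..].
by apply: eq_cint => u; rewrite mulrBr.
Qed.

Definition gaussW (l : R) (xi eta : E) : R :=
  expR (- ((2 * l)^-1 * normv (subv eta xi) ^+ 2)).

(* Up to a scalar, the integral over [eta] of [gaussW l xi eta] times the wave of
   frequency [eta + p] at [x] times the conjugate wave of frequency [eta + q] at [y]. *)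
Definition kernel (l : R) (xi p q : E) (x y : E) : R[i] :=
  expC ((- (l / 2 * normv (subv x y) ^+ 2)) +i*
        (dotv q y - dotv p x - dotv (subv x y) xi)).

Lemma cmeas_kernel l xi p q : cmeas (fun z : E * E => kernel l xi p q z.1 z.2).
Proof.
apply: cmeas_expC; split => /=.
  apply: measurable_funN; apply: measurable_funM => //; apply: measurable_normv2.
  exact: measurable_subv.
apply: measurable_funB; last by apply: measurable_dotv => //; exact: measurable_subv.
by apply: measurable_funB; exact: measurable_dotv.
Qed.

Lemma normc_kernel_le1 l xi p q x y : 0 < l -> normc (kernel l xi p q x y) <= 1.
Proof.
move=> l0; rewrite normc_expC /= -expR0 ler_expR oppr_le0.
by rewrite mulr_ge0 ?sqr_ge0// divr_ge0// ltW.
Qed.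

Lemma cintegrable_tensor f : cintegrable mun f ->
  cintegrable (mun \x mun)%E (fun z => f z.1 * ((f z.2)^*)%C).
Proof. by move=> iF; have [] := cint_mul iF (cintegrableJ iF). Qed.

Lemma cintegrable_bddM d (T : measurableType d) (mu : {measure set T -> \bar R})
    (h k : T -> R[i]) (c : R) : cmeas k -> (forall x, normc (k x) <= c) ->
  cintegrable mu h -> cintegrable mu (fun x => h x * k x).
Proof.
move=> mk kc /[dup] /cintegrable_meas mh /cintegrableP[_ nh].
apply: (cintegrable_le _ (integrable_scale c nh)); first exact: cmeasM.
by move=> x; rewrite normcM mulrC ler_wpM2r// normc_ge0.
Qed.

(** Fubini in (eta, x, y), dominated by the window times |f(x)| |f(y)|, followed by the Gaussian
    integral in eta; the shifts contribute only waves at x and at y. With p = q = 0 this leads to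
    Plancherel's formula, with opposite shifts to the off-diagonal terms of the Poisson formula. *)
Lemma kernel_identity f l xi p q : 0 < l -> cintegrable mun f ->
  cint mun (fun eta => (gaussW l xi eta)%:C *
    (fourierL1 f (affv 1 p eta) * ((fourierL1 f (affv 1 q eta))^*)%C)) =
  (Num.sqrt (2 * pi * l) ^+ n)%:C *
  cint (mun \x mun)%E (fun z => f z.1 * ((f z.2)^*)%C * kernel l xi p q z.1 z.2).
Proof.
move=> l0 iF; have b0 : 0 < (2 * l)^-1 by rewrite invr_gt0 mulr_gt0.
have mf := cintegrable_meas iF.
pose F (w : E * (E * E)) : R[i] := (gaussW l xi w.1)%:C *
  (wave (affv 1 p w.1) w.2.1 * f w.2.1 * ((wave (affv 1 q w.1) w.2.2 * f w.2.2)^*)%C).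
have [ig _] := integrable_gaussn xi b0.
have gi : cintegrable mun (fun eta => (gaussW l xi eta)%:C).
  by split => //=; exact: integrable0.
pose mun2 : {sigma_finite_measure set _ -> \bar R} := prodm mun mun.
have iFF : cintegrable (mun \x mun2)%E F.
  have [i0 _] := @cint_mul _ _ _ _ R mun mun2 _ _ gi (cintegrable_tensor iF).
  apply: (@cintegrable_le _ _ _ _ _ _ _ ((cintegrableP _ _).1 i0).2).
    have ma p' : measurable_fun setT (fun w : E * (E * E) => affv 1 p' w.1).
      by apply: (measurableT_comp (measurable_affv 1 p')).
    have m21 : measurable_fun setT (fun w : E * (E * E) => w.2.1).
      exact: (measurableT_comp measurable_fst).
    have m22 : measurable_fun setT (fun w : E * (E * E) => w.2.2).
      exact: (measurableT_comp measurable_snd).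
    apply: cmeasM.
      exact: (cmeas_comp (cintegrable_meas gi)).
    apply: cmeasM; first by apply: cmeasM; [exact: cmeas_wave|exact: (cmeas_comp mf)].
    by apply: cmeasJ; apply: cmeasM; [exact: cmeas_wave|exact: (cmeas_comp mf)].
  move=> w; rewrite /F !(normcM (gaussW _ _ _)%:C) (normcM (wave _ _ * _)) normcJ.
  by rewrite !normc_waveM (normcM (f _)) normcJ.
have [_ e1] := cint_prod1 iFF; have [_ e2] := cint_prod2 iFF.
transitivity (cint mun (fun eta => cint (mun \x mun)%E (fun z => F (eta, z)))).
  apply: eq_cint => eta.
  have ci p' := cintegrable_wave (affv 1 p' eta) iF.
  have [i12 e12] := cint_mul (ci p) (cintegrableJ (ci q)).
  transitivity ((gaussW l xi eta)%:C * cint (mun \x mun)%E (fun z =>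
    wave (affv 1 p eta) z.1 * f z.1 * ((wave (affv 1 q eta) z.2 * f z.2)^*)%C)); last first.
    by rewrite -cintZ.
  rewrite e12; congr (_ * _); rewrite (fourierL1E f (affv 1 p eta)); congr (_ * _).
  by rewrite (fourierL1E f (affv 1 q eta)); apply/esym; exact: cintJ.
rewrite e1 -e2 -cintZ; last first.
  apply: (cintegrable_bddM (cmeas_kernel l xi p q)) (cintegrable_tensor iF).
  by move=> z; exact: normc_kernel_le1.
apply: eq_cint => -[x y]; rewrite /F /=.
have [i3 e3] := cint_gaussn xi (subv x y) b0.
transitivity (f x * ((f y)^*)%C * (wave p x * ((wave q y)^*)%C) *
    cint mun (gaussC (2 * l)^-1 xi (subv x y))).
  rewrite -cintZ//; apply: eq_cint => eta.
  rewrite conjcM /wave !expCJ /gaussC /gaussW -expC_real.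
  rewrite [RHS](_ : _ = f x * ((f y)^*)%C * (expC (0 -i* dotv p x) *
    expC ((0 -i* dotv q y)^*)%C * expC ((- ((2 * l)^-1 * normv (subv eta xi) ^+ 2)) -i*
     dotv (subv x y) eta))); last by ring.
  rewrite [LHS](_ : _ = f x * ((f y)^*)%C * (expC (- ((2 * l)^-1 * normv (subv eta xi) ^+ 2))%:C *
    (expC (0 -i* dotv (affv 1 p eta) x) * expC ((0 -i* dotv (affv 1 q eta) y)^*)%C))); last by ring.
  rewrite -!expCD; congr (_ * expC _); rewrite !dotv_affl dotv_subl (dotvC x) (dotvC y).
  by apply: complex_ext; rewrite !(ReD, ImD) /=; ring.
rewrite e3 /wave expCJ.
rewrite [LHS](_ : _ = (Num.sqrt (pi / (2 * l)^-1) ^+ n)%:C * (f x * ((f y)^*)%C *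
  (expC (0 -i* dotv p x) * expC ((0 -i* dotv q y)^*)%C *
  expC (- (normv (subv x y) ^+ 2 / (4 * (2 * l)^-1)) -i* dotv (subv x y) xi)))); last by ring.
rewrite invrK; congr ((Num.sqrt _ ^+ n)%:C * (_ * _)); first by ring.
rewrite -!expCD /kernel; congr expC; apply: complex_ext; rewrite !(ReD, ImD) /=; last by ring.
by field; exact: lt0r_neq0.
Qed.

End kernel_identity.

(** * Null sequences of extended reals and squared L^2 norms *)

Section tends_to_zero.
Context {R : realType}.
Implicit Types u v : nat -> \bar R.

(** An explicit form of convergence to 0 for nonnegative extended reals: early terms may be
    infinite, and comparison and approximation carry no finiteness conditions. *)
Definition tends0 u := forall e : R, 0 < e ->
  exists N, forall k, (N <= k)%N -> (u k <= e%:E)%E.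

Lemma tends0_cvg u : (forall k, (0 <= u k)%E) -> tends0 u <-> u @ \oo --> 0%E.
Proof.
move=> u0; split=> [tu|/fine_cvgP[[N1 _ fu] cu] e e0].
  apply/fine_cvgP; split.
    have [N uN] := tu 1 ltr01; exists N => // k /= Nk.
    by rewrite ge0_fin_numE// (le_lt_trans (uN k Nk))// ltry.
  apply/cvgrPdist_le => e e0; have [N uN] := tu e e0; exists N => // k /= Nk.
  rewrite sub0r normrN ger0_norm ?fine_ge0// -lee_fin fineK ?uN//.
  by rewrite ge0_fin_numE// (le_lt_trans (uN k Nk))// ltry.
move/cvgrPdist_le : cu => /(_ e e0)[N2 _ h].
exists (maxn N1 N2) => k; rewrite geq_max => /andP[k1 k2].
have := h k k2; rewrite /= sub0r normrN ger0_norm ?fine_ge0// -lee_fin fineK//.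
exact: fu.
Qed.

Lemma tends0_le u v : (forall k, (u k <= v k)%E) -> tends0 v -> tends0 u.
Proof.
move=> uv tv e /tv[N h]; exists N => k Nk; exact: le_trans (uv k) (h k Nk).
Qed.

Lemma tends0D u v : tends0 u -> tends0 v -> tends0 (fun k => u k + v k)%E.
Proof.
move=> tu tv e e0; have e20 : 0 < e / 2 by rewrite divr_gt0.
have [N1 h1] := tu _ e20; have [N2 h2] := tv _ e20.
exists (maxn N1 N2) => k; rewrite geq_max => /andP[k1 k2].
by rewrite [e]splitr EFinD leeD ?h1 ?h2.
Qed.

Lemma tends0Z u (c : R) : 0 <= c -> tends0 u -> tends0 (fun k => c%:E * u k)%E.
Proof.
move=> c0 tu e e0; have c1 : 0 < c + 1 by rewrite ltr_wpDl.
have [N h] := tu (e / (c + 1)) (divr_gt0 e0 c1).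
exists N => k Nk; apply: le_trans (_ : c%:E * (e / (c + 1))%:E <= _)%E.
  by rewrite lee_wpmul2l ?lee_fin// h.
rewrite -EFinM lee_fin mulrCA ler_piMr ?(ltW e0)//.
by rewrite ler_pdivrMr// mul1r lerDl.
Qed.

Lemma tends0_approx u : (forall e : R, 0 < e -> exists v, tends0 v /\
  forall k, (u k <= v k + e%:E)%E) -> tends0 u.
Proof.
move=> h e e0; have e20 : 0 < e / 2 by rewrite divr_gt0.
have [v [tv uv]] := h _ e20; have [N hN] := tv _ e20.
exists N => k Nk; apply: le_trans (uv k) _.
by rewrite [in leRHS](splitr e) EFinD leeD2r// hN.
Qed.

End tends_to_zero.

Section square_integrable.
Context d (T : measurableType d) {R : realType}.
Variable mu : {measure set T -> \bar R}.
Implicit Types f g : T -> R[i].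

(** The squared L^2 norm, as an integral in the extended reals. With squares the triangle inequality
    takes the form |f + g|^2 <= 2 |f|^2 + 2 |g|^2, which integrates directly; the factors 2 found in
    later constants come from it. *)
Definition sqn f : \bar R := (\int[mu]_x (normc (f x) ^+ 2)%:E)%E.

Lemma sqn_ge0 f : (0 <= sqn f)%E.
Proof. by apply: integral_ge0 => x _; rewrite lee_fin sqr_ge0. Qed.

Lemma emeas_norm2 f : cmeas f -> measurable_fun setT (fun x => (normc (f x) ^+ 2)%:E).
Proof. by move=> mf; apply/measurable_EFinP; exact: cmeas_norm2. Qed.

Lemma norm2_ge0 f x : (0 <= (normc (f x) ^+ 2)%:E)%E.
Proof. by rewrite lee_fin sqr_ge0. Qed.

Lemma sqn_le (f g : T -> R[i]) : cmeas f -> cmeas g ->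
  (forall x, normc (f x) <= normc (g x)) -> (sqn f <= sqn g)%E.
Proof.
move=> mf mg fg; apply: ge0_le_integral => //.
- by move=> x _; exact: norm2_ge0.
- exact: emeas_norm2.
- exact: emeas_norm2.
- by move=> x _; rewrite lee_fin ler_pXn2r// nnegrE normc_ge0.
Qed.

Lemma sqnD f g : cmeas f -> cmeas g ->
  (sqn (fun x => f x + g x)%R <= 2%:E * sqn f + 2%:E * sqn g)%E.
Proof.
move=> mf mg; rewrite /sqn -!ge0_integralZl//; try exact: emeas_norm2;
  try by move=> x _; exact: norm2_ge0.
have n2 h x : (0 <= 2%:E * (normc (h x : R[i]) ^+ 2)%:E)%E.
  by rewrite mule_ge0// lee_fin sqr_ge0.
rewrite -ge0_integralD//; try by apply: measurable_funeM; exact: emeas_norm2.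
apply: ge0_le_integral => //.
- by move=> x _; rewrite lee_fin sqr_ge0.
- by apply: emeas_norm2; exact: cmeasD.
- by apply: emeasurable_funD; apply: measurable_funeM; exact: emeas_norm2.
- by move=> x _; rewrite -!EFinM -EFinD lee_fin normc_sqrD.
Qed.

Lemma sqnZ c f : cmeas f -> sqn (fun x => c * f x) = ((normc c ^+ 2)%:E * sqn f)%E.
Proof.
move=> mf; rewrite /sqn -ge0_integralZl//; try exact: emeas_norm2;
  rewrite ?lee_fin ?sqr_ge0//; try by move=> x _; exact: norm2_ge0.
by apply: eq_integral => x _; rewrite normcM exprMn EFinM.
Qed.

Lemma sqnB_sym f g : sqn (fun x => f x - g x) = sqn (fun x => g x - f x).
Proof. by apply: eq_integral => x _; rewrite normcB. Qed.

Lemma sqnB f g : cmeas f -> cmeas g ->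
  (sqn (fun x => f x - g x)%R <= 2%:E * sqn f + 2%:E * sqn g)%E.
Proof.
move=> mf mg; apply: le_trans (sqnD mf (cmeasN mg)) _.
by rewrite (_ : sqn (fun x => - g x) = sqn g)//; apply: eq_integral => x _; rewrite normcN.
Qed.

Lemma sqn_tri f g h : cmeas f -> cmeas g -> cmeas h ->
  (sqn (fun x => f x - h x)%R <=
   2%:E * sqn (fun x => f x - g x)%R + 2%:E * sqn (fun x => g x - h x)%R)%E.
Proof.
move=> mf mg mh.
rewrite (_ : (fun x => f x - h x) = fun x => (f x - g x) + (g x - h x)).
  by apply: sqnD; exact: cmeasB.
by apply/funext => x; rewrite addrA subrK.
Qed.

Lemma sqn_integrable f : cmeas f -> (sqn f < +oo)%E ->
  mu.-integrable setT (EFin \o (fun x => normc (f x) ^+ 2)).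
Proof.
move=> mf fy; apply/integrableP; split; first exact: emeas_norm2.
by under eq_integral do rewrite /= ger0_norm ?sqr_ge0//.
Qed.

Lemma cintegrable_sqnM f g : cmeas f -> cmeas g -> (sqn f < +oo)%E ->
  (sqn g < +oo)%E -> cintegrable mu (fun x => f x * g x).
Proof.
move=> mf mg fy gy.
have := integrableD measurableT (integrable_scale 2^-1 (sqn_integrable mf fy))
  (integrable_scale 2^-1 (sqn_integrable mg gy)).
move=> /(@cintegrable_le _ _ _ _ _ (fun x => 2^-1 * normc (f x) ^+ 2 + 2^-1 * normc (g x) ^+ 2)).
apply; first exact: cmeasM.
by move=> x; apply: le_trans (normc_AM_GM _ _) _; rewrite mulrC mulrDr.
Qed.

Lemma sqn_eq0 f : cmeas f -> sqn f = 0%E -> {ae mu, forall x, f x = 0}.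
Proof.
move=> mf f0.
have : (\int[mu]_x `|(normc (f x) ^+ 2)%:E| = 0)%E.
  by rewrite -[RHS]f0; apply: eq_integral => x _; rewrite gee0_abs// lee_fin sqr_ge0.
move/(ae_eq_integral_abs _ measurableT (emeas_norm2 mf)).1.
apply: filterS => x /(_ I)/= [] /eqP; rewrite sqrf_eq0 => /eqP.
exact: eq0_normc.
Qed.

End square_integrable.

Section L2_norm.
Context {R : realType} {n : nat}.
Local Notation mun := (@lebesgue_measure_n R n).
Local Notation E := (euclidean R n).
Implicit Types f : E -> R[i].

Lemma poweR2 (x : \bar R) : (0 <= x)%E -> (x `^ 2 = x ^+ 2)%E.
Proof.
case: x => [r| |]//; last by rewrite poweRyr// expe2 mulyy.
by rewrite lee_fin => r0; rewrite poweR_EFin powR_mulrn// EFin_expe.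
Qed.

Lemma L2norm_sqr f : (L2norm f ^+ 2 = sqn mun f)%E.
Proof.
rewrite /L2norm -poweR2 ?Lnorm_ge0// poweR_Lnorm//.
by apply: eq_integral => x _; rewrite poweR2//= ger0_norm ?normc_ge0.
Qed.

Lemma L2norm_ltyE f : (L2norm f < +oo)%E <-> (sqn mun f < +oo)%E.
Proof.
rewrite -L2norm_sqr; have := @Lnorm_ge0 _ _ _ mun 2%:E (fun x => (normc (f x))%:E).
rewrite -/(L2norm f); case: (L2norm f) => [r _||]//.
by rewrite -EFin_expe !ltry.
Qed.

Lemma L2P f : L2 f <-> cmeas f /\ (sqn mun f < +oo)%E.
Proof. by split => -[mf /L2norm_ltyE]. Qed.

Lemma tends0_L2norm (u : nat -> E -> R[i]) :
  (L2norm (u k) @[k --> \oo] --> 0)%E <-> tends0 (fun k => sqn mun (u k)).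
Proof.
have N0 k : (0 <= L2norm (u k))%E by exact: Lnorm_ge0.
rewrite -(tends0_cvg (u := fun k => L2norm (u k)))//; split=> h e e0.
  have [N hN] := h (Num.min e 1) ltac:(by rewrite lt_min e0 ltr01).
  exists N => k Nk; rewrite -L2norm_sqr.
  have := hN k Nk; have := N0 k; case: (L2norm (u k)) => [r| |]//.
  rewrite !lee_fin le_min => r0 /andP[re r1].
  by rewrite (le_trans _ re)// ler_piMr.
have [N hN] := h (e ^+ 2) ltac:(by rewrite exprn_gt0).
exists N => k Nk; have := hN k Nk; rewrite -L2norm_sqr.
have := N0 k; case: (L2norm (u k)) => [r| |]//.
by rewrite -EFin_expe !lee_fin => r0; rewrite ler_pXn2r// nnegrE// ltW.
Qed.

End L2_norm.

(** * Continuity of translations in L^2 *)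

Section translation_continuity.
Context {R : realType} {n : nat}.
Local Notation mun := (@lebesgue_measure_n R n).
Local Notation E := (euclidean R n).
Local Notation R1 := (measurableTypeR R).
Implicit Types f g : E -> R[i].

Definition gaussS (v : E) : R := expR (- (2^-1 * normv v ^+ 2)).

Lemma measurable_gaussS : measurable_fun setT gaussS.
Proof.
apply: measurableT_comp => //; apply: measurable_funN; apply: measurable_funM => //.
exact: measurable_normv2.
Qed.

Lemma normv_sub0 (x : E) : normv (subv x [tuple 0 | j < n]) = normv x.
Proof.
rewrite /normv; congr Num.sqrt; apply: eq_bigr => j _.
by rewrite !tnth_mktuple subr0.
Qed.

Lemma gaussS_int : (\int[mun]_v (gaussS v)%:E = (Num.sqrt (2 * pi) ^+ n)%:E)%E.
Proof.
have h2 : 0 < 2^-1 :> R by [].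
have [i e] := integrable_gaussn [tuple 0 | j < n] h2.
have E1 : (fun x : E => expR (- (2^-1 * normv (subv x [tuple 0 | j < n]) ^+ 2))) = gaussS.
  by apply/funext => x; rewrite normv_sub0.
rewrite E1 invrK (mulrC pi) in i e; rewrite -e.
by rewrite /Rintegral fineK//; exact: integrable_fin_num.
Qed.

Lemma affvC a (v x : E) : affv a x v = affv 1 (scalev a v) x.
Proof. by apply: eq_from_tnth => j; rewrite !tnth_mktuple mul1r addrC. Qed.

(* Plancherel's formula for [f] integrable and square integrable amounts to
   [osc a f] tending to 0 with [a]. *)
Definition osc (a : R) f : \bar R :=
  (\int[(mun \x mun)]_z (gaussS z.2 * normc (f (affv a z.1 z.2) - f z.1) ^+ 2)%:E)%E.

Lemma measurable_affz a : measurable_fun setT (fun z : E * E => affv a z.1 z.2).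
Proof.
apply/measurable_fun_tnthP => j.
rewrite (_ : _ \o _ = fun z : E * E => tnth z.1 j + a * tnth z.2 j); last first.
  by apply/funext => z /=; rewrite tnth_mktuple.
apply: measurable_funD; first exact: (measurableT_comp (measurable_tnth j)).
by apply: measurable_funM => //; exact: (measurableT_comp (measurable_tnth j)).
Qed.

Lemma measurable_osc a f : cmeas f -> measurable_fun setT
  (fun z : E * E => (gaussS z.2 * normc (f (affv a z.1 z.2) - f z.1) ^+ 2)%:E).
Proof.
move=> mf; apply/measurable_EFinP; apply: measurable_funM.
  exact: (measurableT_comp measurable_gaussS).
apply: cmeas_norm2; apply: cmeasB; first exact: (cmeas_comp mf (measurable_affz a)).
exact: (cmeas_comp mf).
Qed.

Lemma osc_ge0 a f : (0 <= osc a f)%E.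
Proof. by apply: integral_ge0 => z _; rewrite lee_fin mulr_ge0 ?sqr_ge0 ?expR_ge0. Qed.

(* Tonelli together with translation invariance *)
Lemma osc_shift a f : cmeas f ->
  (\int[(mun \x mun)]_z (gaussS z.2 * normc (f (affv a z.1 z.2)) ^+ 2)%:E =
   (Num.sqrt (2 * pi) ^+ n)%:E * sqn mun f)%E.
Proof.
move=> mf; have mfn := @emeas_norm2 _ _ _ f mf.
rewrite fubini_tonelli2//; last 2 first.
- apply/measurable_EFinP; apply: measurable_funM.
    exact: (measurableT_comp measurable_gaussS).
  by apply: cmeas_norm2; exact: (cmeas_comp mf (measurable_affz a)).
- by move=> z; rewrite lee_fin mulr_ge0 ?sqr_ge0 ?expR_ge0.
rewrite -gaussS_int -ge0_integralZr//; last 3 first.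
- by apply/measurable_EFinP; exact: measurable_gaussS.
- by move=> v _; rewrite lee_fin expR_ge0.
- exact: sqn_ge0.
apply: eq_integral => v _; rewrite /fubini_G /=.
under eq_integral do rewrite EFinM.
rewrite ge0_integralZl//; last 3 first.
- apply/measurable_EFinP; apply: cmeas_norm2; apply: (cmeas_comp mf).
  by under eq_fun do rewrite affvC; exact: measurable_affv.
- by move=> x _; rewrite lee_fin sqr_ge0.
- by rewrite lee_fin expR_ge0.
congr (_ * _)%E; under eq_integral do rewrite affvC.
rewrite /sqn [RHS](ge0_integral_affv (scalev a v) ltr01)//.
  by rewrite expr1n mul1e.
by move=> x; rewrite lee_fin sqr_ge0.
Qed.

Lemma osc_cst f : cmeas f ->
  (\int[(mun \x mun)]_z (gaussS z.2 * normc (f z.1) ^+ 2)%:E =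
   (Num.sqrt (2 * pi) ^+ n)%:E * sqn mun f)%E.
Proof.
move=> mf; rewrite -(osc_shift 0 mf); apply: eq_integral => z _.
congr (_ * normc (f _) ^+ 2)%:E.
by apply: eq_from_tnth => j; rewrite !tnth_mktuple mul0r addr0.
Qed.

Lemma osc_le a f : cmeas f ->
  (osc a f <= (4 * Num.sqrt (2 * pi) ^+ n)%:E * sqn mun f)%E.
Proof.
move=> mf; rewrite (_ : 4 * _ = 2 * Num.sqrt (2 * pi) ^+ n + 2 * Num.sqrt (2 * pi) ^+ n); last by ring.
rewrite EFinD ge0_muleDl ?lee_fin ?mulr_ge0 ?exprn_ge0 ?sqrtr_ge0//.
rewrite EFinM -muleA -{1}(osc_shift a mf) -(osc_cst mf) -!ge0_integralZl//; first last.
all: try by move=> z _; rewrite lee_fin mulr_ge0 ?sqr_ge0 ?expR_ge0.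
all: try (apply/measurable_EFinP; apply: measurable_funM;
  [exact: (measurableT_comp measurable_gaussS)|by apply: cmeas_norm2; first [exact: (cmeas_comp mf (measurable_affz a))|exact: (cmeas_comp mf)]]).
have p h (z : E * E) : (0 <= 2%:E * (gaussS z.2 * normc (f (h z) : R[i]) ^+ 2)%:E)%E.
  by rewrite mule_ge0// lee_fin mulr_ge0 ?sqr_ge0 ?expR_ge0.
rewrite -ge0_integralD//; first last.
all: try by move=> z _; first [apply: (p (fun z => affv a z.1 z.2))|apply: (p fst)].
all: try (apply: measurable_funeM; apply/measurable_EFinP; apply: measurable_funM;
  [exact: (measurableT_comp measurable_gaussS)|by apply: cmeas_norm2; first [exact: (cmeas_comp mf (measurable_affz a))|exact: (cmeas_comp mf)]]).
apply: ge0_le_integral => //.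
- by move=> z _; rewrite lee_fin mulr_ge0 ?sqr_ge0 ?expR_ge0.
- exact: measurable_osc.
- apply: emeasurable_funD; apply: measurable_funeM; apply/measurable_EFinP; apply: measurable_funM;
  solve [exact: (measurableT_comp measurable_gaussS)|by apply: cmeas_norm2; first [exact: (cmeas_comp mf (measurable_affz a))|exact: (cmeas_comp mf)]].
- move=> z _; rewrite -!EFinM -EFinD lee_fin.
  rewrite [leRHS](_ : _ = gaussS z.2 * (2 * normc (f (affv a z.1 z.2)) ^+ 2 + 2 * normc (f z.1) ^+ 2)); last by ring.
  rewrite ler_wpM2l ?expR_ge0//; apply: le_trans (normc_sqrD _ _) _.
  by rewrite normcN.
Qed.

Lemma oscD a f g : cmeas f -> cmeas g ->
  (osc a (fun x => f x + g x)%R <= 2%:E * osc a f + 2%:E * osc a g)%E.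
Proof.
move=> mf mg; rewrite /osc -!ge0_integralZl//; first last.
all: try by move=> z _; rewrite lee_fin mulr_ge0 ?sqr_ge0 ?expR_ge0.
all: try exact: measurable_osc.
have p h (z : E * E) : (0 <= 2%:E * (gaussS z.2 * normc (h (affv a z.1 z.2) - h z.1 : R[i]) ^+ 2)%:E)%E.
  by rewrite mule_ge0// lee_fin mulr_ge0 ?sqr_ge0 ?expR_ge0.
rewrite -ge0_integralD//; first last.
all: try by move=> z _; apply: p.
all: try by apply: measurable_funeM; exact: measurable_osc.
apply: ge0_le_integral => //.
- by move=> z _; rewrite lee_fin mulr_ge0 ?sqr_ge0 ?expR_ge0.
- exact: (measurable_osc a (cmeasD mf mg)).
- by apply: emeasurable_funD; apply: measurable_funeM; exact: measurable_osc.
- move=> z _; rewrite -!EFinM -EFinD lee_fin.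
  rewrite [leRHS](_ : _ = gaussS z.2 * (2 * normc (f (affv a z.1 z.2) - f z.1) ^+ 2 + 2 * normc (g (affv a z.1 z.2) - g z.1) ^+ 2)); last by ring.
  rewrite ler_wpM2l ?expR_ge0//; apply: le_trans (normc_sqrD _ _).
  by rewrite opprD addrACA.
Qed.

Lemma oscZ a c f : cmeas f ->
  osc a (fun x => c * f x) = ((normc c ^+ 2)%:E * osc a f)%E.
Proof.
move=> mf; rewrite /osc -ge0_integralZl//; first last.
- by rewrite lee_fin sqr_ge0.
- by move=> z _; rewrite lee_fin mulr_ge0 ?sqr_ge0 ?expR_ge0.
- exact: measurable_osc.
by apply: eq_integral => z _; rewrite -mulrBr normcM exprMn -EFinM; congr EFin; ring.
Qed.

(** Continuity in the mean under translations, tested along a = 1 / (k + 1) with Gaussian weights.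
    This class is a closed linear subspace of L^2, and it will be shown to be all of it. *)
Definition osc_vanish f := [/\ cmeas f, (sqn mun f < +oo)%E &
  tends0 (fun k => osc k.+1%:R^-1 f)].

Lemma osc_vanishD f g : osc_vanish f -> osc_vanish g ->
  osc_vanish (fun x => f x + g x).
Proof.
move=> [mf fy tf] [mg gy tg]; split; first exact: cmeasD.
  apply: le_lt_trans (sqnD _ mf mg) _.
  by rewrite lte_add_pinfty// lte_mul_pinfty.
apply: tends0_le (tends0D (tends0Z (ler0n R 2) tf) (tends0Z (ler0n R 2) tg)) => k.
exact: oscD.
Qed.

Lemma osc_vanishZ c f : osc_vanish f -> osc_vanish (fun x => c * f x).
Proof.
move=> [mf fy tf]; split; first by apply: cmeasM => //; exact: cmeas_cst.
  by rewrite sqnZ// lte_mul_pinfty// lee_fin sqr_ge0.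
apply: tends0_le (tends0Z (sqr_ge0 (normc c)) tf) => k.
by rewrite oscZ.
Qed.

Lemma osc_vanish0 : osc_vanish (fun=> 0).
Proof.
split; first exact: cmeas_cst.
  rewrite /sqn normc0 expr0n/= integral0//.
move=> e e0; exists 0%N => k _; rewrite /osc.
by under eq_integral do rewrite subr0 normc0 expr0n mulr0; rewrite integral0 lee_fin ltW.
Qed.

Lemma osc_vanishB f g : osc_vanish f -> osc_vanish g ->
  osc_vanish (fun x => f x - g x).
Proof.
move=> vf /(osc_vanishZ (-1)) vg.
rewrite (_ : (fun _ => _) = fun x => f x + -1 * g x); first exact: osc_vanishD.
by apply/funext => x; rewrite mulN1r.
Qed.

Lemma osc_vanish_sum (I : Type) (r : seq I) (F : I -> E -> R[i]) :
  (forall i, osc_vanish (F i)) -> osc_vanish (fun x => \sum_(i <- r) F i x).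
Proof.
move=> vF; elim: r => [|i r IH].
  by under eq_fun do rewrite big_nil; exact: osc_vanish0.
by under eq_fun do rewrite big_cons; exact: osc_vanishD.
Qed.

(** The oscillation of the error f - g is at most a multiple of its squared norm, and that multiple
    does not depend on the step a. *)
Lemma osc_vanish_approx f : cmeas f -> (sqn mun f < +oo)%E ->
  (forall e : R, 0 < e -> exists g, osc_vanish g /\
    (sqn mun (fun x => f x - g x)%R <= e%:E)%E) ->
  osc_vanish f.
Proof.
move=> mf fy H; split => //; apply: tends0_approx => e e0.
(* The factor 8 is 2 from [oscD] times 4 from [osc_le]. *)
pose c : R := 8 * Num.sqrt (2 * pi) ^+ n.
have c0 : 0 < c by rewrite mulr_gt0// exprn_gt0// sqrtr_gt0 mulr_gt0// pi_gt0.
have [g [vg fg]] := H (e / c) (divr_gt0 e0 c0).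
have [mg gy tg] := vg.
exists (fun k => 2%:E * osc k.+1%:R^-1 g)%E; split; first exact: tends0Z.
move=> k; rewrite (_ : f = fun x => g x + (f x - g x)); last first.
  by apply/funext => x; rewrite addrC subrK.
apply: le_trans (oscD _ mg (cmeasB mf mg)) _; rewrite leeD2l//.
apply: le_trans (lee_wpmul2l _ (osc_le _ (cmeasB mf mg))) _ => //.
rewrite muleA -EFinM (_ : 2 * (4 * Num.sqrt (2 * pi) ^+ n) = c); last by rewrite /c; ring.
apply: le_trans (lee_wpmul2l _ fg) _; first by rewrite lee_fin ltW.
by rewrite -EFinM lee_fin mulrCA divff ?gt_eqF// mulr1.
Qed.

End translation_continuity.

Section dominated_square.
Context d (T : measurableType d) {R : realType}.
Variable mu : {measure set T -> \bar R}.

Lemma tends0_sqn_dct (h : nat -> T -> R[i]) (g : T -> R) :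
  (forall k, cmeas (h k)) -> (forall x, normc (h k x) @[k --> \oo] --> 0) ->
  mu.-integrable setT (EFin \o g) -> (forall k x, normc (h k x) ^+ 2 <= g x) ->
  tends0 (fun k => sqn mu (h k)).
Proof.
move=> mh h0 ig hg; apply/tends0_cvg => [k|]; first exact: sqn_ge0.
have [||_] := @Rintegral_dct _ _ _ mu (fun k x => normc (h k x) ^+ 2) (fun=> 0) g
  (fun k => cmeas_norm2 (mh k)) _ ig.
- move=> x; rewrite [X in _ --> X](_ : _ = 0 ^+ 2); last by rewrite expr0n.
  by apply: (cvg_comp _ (fun y : R => y ^+ 2)); [exact: h0|exact: exprn_continuous].
- by move=> k x; rewrite ger0_norm ?sqr_ge0.
rewrite Rintegral_cst// mul0r => cv.
have e k : sqn mu (h k) = (\int[mu]_x (normc (h k x) ^+ 2))%:E.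
  rewrite /Rintegral fineK//; apply: integrable_fin_num => //.
  apply: le_integrable ig => //; first exact: emeas_norm2.
  move=> x _ /=; rewrite lee_fin ger0_norm ?sqr_ge0//.
  by rewrite (le_trans (hg k x))// ler_norm.
by apply/fine_cvgP; split; [apply: nearW => k; rewrite e|under eq_cvg do rewrite /= e].
Qed.

Lemma tends0_ex (u : nat -> \bar R) (e : R) : tends0 u -> 0 < e ->
  exists k, (u k <= e%:E)%E.
Proof. by move=> tu /tu[N h]; exists N; exact: h. Qed.

Definition indC (A : set T) (x : T) : R[i] := (\1_A x)%:C.

Lemma cmeas_indC A : measurable A -> cmeas (indC A).
Proof. by move=> mA; apply: cmeas_re; exact: measurable_indic. Qed.

Lemma normc_indC A x : normc (indC A x) ^+ 2 = \1_A x.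
Proof.
by rewrite normc_re indicE; case: (_ \in _); rewrite ?normr0 ?normr1 ?expr0n ?expr1n.
Qed.

Lemma sqn_indC A : measurable A -> sqn mu (indC A) = mu A.
Proof.
move=> mA; rewrite /sqn; under eq_integral do rewrite normc_indC.
by rewrite integral_indic// setIT.
Qed.

Lemma integrable_indic A : measurable A -> (mu A < +oo)%E ->
  mu.-integrable setT (EFin \o \1_A).
Proof.
move=> mA Afin; apply/integrableP; split.
  by apply/measurable_EFinP; exact: measurable_indic.
under eq_integral do rewrite /= ger0_norm//.
by rewrite integral_indic// setIT.
Qed.

End dominated_square.

Section translation_L2.
Context {R : realType} {n : nat}.
Local Notation mun := (@lebesgue_measure_n R n).
Local Notation E := (euclidean R n).
Local Notation R1 := (measurableTypeR R).
Implicit Types f g : E -> R[i].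

(* For such a set [U] of finite measure, dominated convergence shows that the
   indicator of [U] is continuous under translation in L^2; since these sets are
   stable under intersection and generate the Borel sets, a Dynkin class argument
   extends this to all of L^2 without any density theorem for continuous functions. *)
Definition radially_open (U : set E) := forall x v, U x ->
  \forall k \near \oo, U (affv (k.+1%:R^-1) x v).

Lemma radially_openI U V : radially_open U -> radially_open V ->
  radially_open (U `&` V).
Proof.
by move=> oU oV x v [Ux Vx]; have := oV x v Vx; apply: filterS2 (oU x v Ux) => k.
Qed.

Lemma cvg_radial (a c : R) : a + k.+1%:R^-1 * c @[k --> \oo] --> a.
Proof.
rewrite -[X in _ --> X]addr0; apply: cvgD; first exact: cvg_cst.
rewrite -(mul0r c); apply: cvgMl; exact: cvg_harmonic.
Qed.

Lemma radially_open_ray (j : 'I_n) (r : R) :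
  radially_open [set x : E | r < tnth x j].
Proof.
move=> x v /= rx; have := @cvg_radial (tnth x j) (tnth v j).
move=> /cvgr_gt/(_ _ rx); apply: filterS => k /=.
by rewrite tnth_mktuple.
Qed.

Lemma radially_open_ball (r : R) : radially_open [set x : E | normv x < r].
Proof.
move=> x v /= xr; have := @cvg_radial (normv x) (normv v).
move=> /cvgr_lt/(_ _ xr); apply: filterS => k /=; apply: le_lt_trans.
apply: le_trans (ler_normv_sub _ x) _; rewrite addrC lerD2l.
rewrite (_ : subv _ _ = scalev k.+1%:R^-1 v).
  by rewrite normv_scale ger0_norm ?invr_ge0.
by apply: eq_from_tnth => j; rewrite !tnth_mktuple addrC addKr.
Qed.

Definition centered_ball (M : nat) : set E := [set x | normv x < M%:R].

Lemma measurable_centered_ball M : measurable (centered_ball M).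
Proof.
have := @measurable_normv R n _ _ id (@measurable_id _ _ setT).
by move=> /(_ measurableT `]-oo, M%:R[%classic (measurable_itv _));
  rewrite setTI; congr measurable; apply/seteqP; split => x /=; rewrite in_itv.
Qed.

Lemma centered_ball_fin M : (mun (centered_ball M) < +oo)%E.
Proof.
have /integrableP[_] := integrable_ball n (M%:R : R); apply: le_lt_trans.
rewrite -[mun _]mul1e -(setIT (centered_ball M)) -integral_indic//; last exact: measurable_centered_ball.
rewrite mul1e; apply: ge0_le_integral => //.
- by apply/measurable_EFinP; exact: measurable_indic (measurable_centered_ball M).
- apply: measurableT_comp => //.
  exact: measurable_int (integrable_ball n (M%:R : R)).
- move=> x _ /=; rewrite lee_fin indicE.
  case: (boolP (x \in centered_ball M)) => [/set_mem/ltW ->|_]; first by rewrite normr1.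
  exact: normr_ge0.
Qed.

(** The square of the difference of two indicators expands into [s + t - 2 w]. The integrals of [s]
    and [t k] agree by translation invariance, and [w k] tends to [s] under the bound [s]. Only
    points of U have to be followed, since the product [w] vanishes elsewhere; hence openness along
    rays is enough. *)
Lemma osc_vanish_open U : measurable U -> (mun U < +oo)%E -> radially_open U ->
  osc_vanish (indC U).
Proof.
move=> mU Ufin oU; have mi := cmeas_indC (R := R) mU; split => //; first by rewrite sqn_indC.
pose y (k : nat) (z : E * E) := affv k.+1%:R^-1 z.1 z.2.
have my k : measurable_fun setT (y k) by exact: measurable_affz.
pose s (z : E * E) : R := gaussS z.2 * \1_U z.1.
pose t k (z : E * E) : R := gaussS z.2 * \1_U (y k z).
pose w k (z : E * E) : R := gaussS z.2 * (\1_U z.1 * \1_U (y k z)).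
have m1U h : measurable_fun setT h -> measurable_fun setT (fun z : E * E => \1_U (h z) : R).
  by move=> mh; apply: (measurableT_comp (measurable_indic mU)).
have mS : measurable_fun setT (fun z : E * E => gaussS z.2 : R).
  exact: (measurableT_comp measurable_gaussS).
have G0 z : 0 <= gaussS z :> R by exact: expR_ge0.
have fin (h : E * E -> R) (c : \bar R) : (c < +oo)%E -> measurable_fun setT h -> (forall z, 0 <= h z) ->
    (\int[(mun \x mun)]_z (h z)%:E = c)%E ->
    (mun \x mun)%E.-integrable setT (EFin \o h) /\ \int[(mun \x mun)%E]_z h z = fine c.
  move=> cf mh h0 hc; split; last by rewrite /Rintegral hc.
  apply/integrableP; split; first exact/measurable_EFinP.
  by under eq_integral do rewrite /= ger0_norm//; rewrite hc.
pose c := ((Num.sqrt (2 * pi) ^+ n)%:E * sqn mun (indC U))%E.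
have cfin : (c < +oo)%E.
  by rewrite /c sqn_indC// lte_mul_pinfty// lee_fin exprn_ge0// sqrtr_ge0.
have [is_ es] : (mun \x mun)%E.-integrable setT (EFin \o s) /\ \int[(mun \x mun)%E]_z s z = fine c.
  apply: fin => //.
  - by apply: measurable_funM => //; apply: m1U.
  - by move=> z; rewrite mulr_ge0.
  - by rewrite /c -(osc_cst mi); apply: eq_integral => z _; rewrite normc_indC.
have /all_and2[it et] : forall k, (mun \x mun)%E.-integrable setT (EFin \o t k) /\ \int[(mun \x mun)%E]_z t k z = fine c.
  move=> k; apply: fin => //.
  - by apply: measurable_funM => //; exact: m1U.
  - by move=> z; rewrite mulr_ge0.
  - by rewrite /c -(osc_shift k.+1%:R^-1 mi); apply: eq_integral => z _; rewrite normc_indC.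
have mw k : measurable_fun setT (w k).
  by apply: measurable_funM => //; apply: measurable_funM; apply: m1U.
have ws k z : `|w k z| <= s z.
  have i1 x : \1_U x <= 1 :> R by rewrite indicE; case: (x \in U).
  by rewrite /w ger0_norm ?mulr_ge0// /s ler_wpM2l// ler_piMr.
have [z|_ cw] := @Rintegral_dct _ _ _ (mun \x mun)%E w s s mw _ is_ ws.
  rewrite /w /s; apply: cvgMr; rewrite !indicE.
  have [|_] := boolP (z.1 \in U); last first.
    by under eq_cvg do rewrite mul0r; exact: cvg_cst.
  rewrite inE => Uz; apply: cvg_near_cst; near=> k.
  by rewrite mul1r indicE mem_set//; near: k; exact: oU.
have iw k : (mun \x mun)%E.-integrable setT (EFin \o w k).
  apply: le_integrable is_ => //; first exact/measurable_EFinP.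
  by move=> z _ /=; rewrite lee_fin (le_trans (ws k z))// ler_norm.
have oE k : osc k.+1%:R^-1 (indC U) = (fine c + fine c - 2 * \int[(mun \x mun)%E]_z w k z)%:E.
  rewrite -{1}es -{1}(et k) -RintegralZl// -RintegralD// -RintegralB//; last 2 first.
  - by have := integrableD measurableT is_ (it k).
  - exact: integrable_scale.
  rewrite /Rintegral fineK; last first.
    apply: integrable_fin_num => //.
    exact: (integrableB measurableT (integrableD measurableT is_ (it k)) (integrable_scale 2 (iw k))).
  apply: eq_integral => z _; congr EFin; rewrite /s /t /w -/(y k z) normc_sqr /indC /=.
  rewrite subrr expr0n/= addr0.
  rewrite !indicE; case: (_ \in _) => /=; case: (_ \in _) => /=; ring.
apply/tends0_cvg => [k|]; first exact: osc_ge0.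
apply/fine_cvgP; split; first by apply: nearW => k; rewrite oE.
rewrite (_ : fine \o _ = fun k => fine c + fine c - 2 * \int[(mun \x mun)%E]_z w k z);
  last by apply/funext => k; rewrite /= oE.
rewrite [X in _ --> X](_ : _ = fine c + fine c - (fine c + fine c)); last by rewrite subrr.
apply: cvgB; first exact: cvg_cst.
have -> : fine c + fine c = 2 * \int[(mun \x mun)%E]_z s z by rewrite es; ring.
apply: cvgM; first exact: cvg_cst.
exact: cw.
Unshelve. all: end_near. Qed.

Definition radially_open_sets : set (set E) := [set U | measurable U /\ radially_open U].

(** Half-spaces r < x_j are radially open, and they already generate the Borel sets. *)
Lemma measurable_radially_open_sets : @measurable _ E = <<s radially_open_sets >>.
Proof.
apply/seteqP; split => A.
  pose T := g_sigma_algebraType radially_open_sets.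
  have mid : measurable_fun setT (fun x : T => x : E).
    apply/measurable_fun_tnthP => j.
    apply: (measurability _ (RGenOInfty.measurableE R)).
    move=> _ [_ [r ->] <-]; apply: sub_sigma_algebra.
    rewrite setTI; split.
      have := @measurable_tnth _ R1 n j measurableT `]r, +oo[%classic (measurable_itv _).
      by rewrite setTI.
    by move=> x v /=; rewrite in_itv/= andbT => rx; have := radially_open_ray v rx;
      apply: filterS => k /=; rewrite in_itv/= andbT.
  by move=> mA; have := mid measurableT A mA; rewrite setTI.
apply: smallest_sub; first exact: sigma_algebra_measurable.
by move=> B [].
Qed.

Lemma osc_vanish_indC A : measurable A -> (mun A < +oo)%E -> osc_vanish (indC A).
Proof.
move=> mA Afin.
(* Cutting by balls keeps complements of finite measure, which makes the class stable under
   complement as Dynkin's argument demands. *)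
suff H : forall B, <<s radially_open_sets >> B -> forall M, osc_vanish (indC (B `&` centered_ball M)).
  apply: osc_vanish_approx; [exact: cmeas_indC|by rewrite sqn_indC|move=> e e0].
  have [||||k hk] := tends0_ex (@tends0_sqn_dct _ _ _ mun
    (fun k x => indC A x - indC (A `&` centered_ball k) x) \1_A _ _ _ _) e0.
  - move=> k; apply: cmeasB; first exact: cmeas_indC.
    by apply: cmeas_indC; apply: measurableI => //; exact: measurable_centered_ball.
  - move=> x; apply: cvg_near_cst; near=> k.
    rewrite /indC !indicE in_setI (mem_set (_ : centered_ball k x)) ?andbT ?subrr ?normc0//.
    by rewrite /centered_ball/=; near: k; exact: nbhs_infty_gtr.
  - exact: integrable_indic.
  - move=> k x; rewrite /indC !indicE in_setI -rmorphB normc_re.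
    by case: (x \in A) => /=; case: (x \in centered_ball k) => /=;
      rewrite ?subrr ?subr0 ?normr0 ?normr1 ?expr0n ?expr1n.
  exists (indC (A `&` centered_ball k)); split => //; apply: H.
  by rewrite -measurable_radially_open_sets.
apply: dynkin_induction.
- exact: measurable_radially_open_sets.
- move=> U V [mU oU] [mV oV]; split; first exact: measurableI.
  exact: radially_openI.
- move=> M; rewrite setTI; apply: osc_vanish_open.
  + exact: measurable_centered_ball.
  + exact: centered_ball_fin.
  + exact: radially_open_ball.
- move=> U [mU oU] M; apply: osc_vanish_open.
  + by apply: measurableI => //; exact: measurable_centered_ball.
  + apply: le_lt_trans (centered_ball_fin M); apply: le_measure; rewrite ?inE//.
    * by apply: measurableI => //; exact: measurable_centered_ball.
    * exact: measurable_centered_ball.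
  + by apply: radially_openI => //; exact: radially_open_ball.
- move=> S mS vS M.
  rewrite (_ : indC _ = fun x => indC (setT `&` centered_ball M) x - indC (S `&` centered_ball M) x).
    apply: osc_vanishB => //; rewrite setTI; apply: osc_vanish_open.
    + exact: measurable_centered_ball.
    + exact: centered_ball_fin.
    + exact: radially_open_ball.
  apply/funext => x; rewrite /indC !indicE !in_setI in_setC in_setT.
  by case: (x \in S) => /=; rewrite ?subrr ?subr0.
- move=> F mF tF vF M.
  have mFM K : measurable (F K `&` centered_ball M) by apply: measurableI => //; exact: measurable_centered_ball.
  have mU : measurable (\bigcup_k F k `&` centered_ball M).
    by apply: measurableI; [exact: bigcup_measurable|exact: measurable_centered_ball].
  have Ufin : (mun (\bigcup_k F k `&` centered_ball M) < +oo)%E.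
    apply: le_lt_trans (centered_ball_fin M); apply: le_measure; rewrite ?inE//.
    exact: measurable_centered_ball.
  have sumE K x : \sum_(k < K) indC (F k `&` centered_ball M) x =
      indC (\big[setU/set0]_(k < K) F k `&` centered_ball M) x :> R[i].
    elim: K => [|K IH]; first by rewrite !big_ord0 set0I /indC indic0.
    rewrite !big_ord_recr/= IH /indC !indicE !in_setI in_setU.
    have [xK|xK] := boolP (x \in F K) => /=; last by rewrite orbF addr0.
    rewrite (_ : x \in _ = false) ?add0r//.
    apply/negbTE/negP; rewrite inE -bigcup_mkord => -[i /= iK Fix].
    have /trivIsetP/(_ i K I I) := tF; rewrite ltn_eqF// => /(_ isT).
    move=> FiK; have : (F i `&` F K) x by split => //; exact: set_mem.
    by rewrite FiK.
  apply: osc_vanish_approx; [exact: cmeas_indC|by rewrite sqn_indC|move=> e e0].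
  have [||||k hk] := tends0_ex (@tends0_sqn_dct _ _ _ mun
    (fun K x => indC (\bigcup_k F k `&` centered_ball M) x - \sum_(k < K) indC (F k `&` centered_ball M) x)
     \1_(\bigcup_k F k `&` centered_ball M) _ _ _ _) e0.
  - move=> K; apply: cmeasB; first exact: cmeas_indC.
    by apply: cmeas_sum => i _; exact: cmeas_indC.
  - move=> x; apply: cvg_near_cst.
    have [[i _ Fix]|nF] := pselect ((\bigcup_k F k) x).
      near=> K; rewrite sumE /indC !indicE !in_setI.
      have -> : x \in \bigcup_k F k by rewrite inE; exists i.
      have -> : x \in \big[setU/set0]_(k < K) F k.
        rewrite inE -bigcup_mkord; exists i => //=.
        by near: K; exact: nbhs_infty_gt.
      by rewrite subrr normc0.
    near=> K; rewrite sumE /indC !indicE !in_setI (memNset nF).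
    have -> : x \in \big[setU/set0]_(k < K) F k = false; last by rewrite subrr normc0.
    apply: memNset; by rewrite -bigcup_mkord => -[i _ Fix]; apply: nF; exists i.
  - exact: integrable_indic.
  - move=> K x; rewrite sumE /indC !indicE !in_setI -rmorphB normc_re.
    have : x \in \big[setU/set0]_(k < K) F k -> x \in \bigcup_k F k.
      by rewrite !inE -bigcup_mkord => -[i _ Fix]; exists i.
    case: (x \in \big[setU/set0]_(k < K) F k) => [->//|_]; rewrite ?andTb.
      by case: (x \in centered_ball M); rewrite subrr normr0 expr0n.
    by case: (_ && _) => /=; rewrite subr0 ?normr0 ?normr1 ?expr0n ?expr1n.
  exists (fun x => \sum_(k < k) indC (F k `&` centered_ball M) x); split => //.
  exact: osc_vanish_sum.
Unshelve. all: end_near. Qed.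

Import HBSimple HBNNSimple.

Lemma osc_vanish_nonneg (h : E -> R) : measurable_fun setT h ->
  (forall x, 0 <= h x) -> (sqn mun (fun x => (h x)%:C) < +oo)%E ->
  osc_vanish (fun x => (h x)%:C).
Proof.
move=> mh h0 hfin.
have mH : measurable_fun setT (EFin \o h) by exact/measurable_EFinP.
pose s := nnsfun_approx measurableT mH.
have ss k x : s k x <= h x.
  by rewrite -lee_fin /s nnsfun_approxE; apply: le_approx => //= y _; rewrite lee_fin.
have cs x : s k x @[k --> \oo] --> h x.
  have h0' y : setT y -> (0 <= (EFin \o h) y)%E by move=> _; rewrite lee_fin.
  by have /fine_cvgP[] := cvg_nnsfun_approx measurableT mH h0' (I : setT x).
have ih := sqn_integrable (cmeas_re mh) hfin.
have mpre k (y : R) : measurable (s k @^-1` [set y]) by exact: measurable_sfunP.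
have vs k : osc_vanish (fun x => (s k x)%:C).
  pose rs := fset_set (s k @` setT).
  rewrite (_ : (fun x => (s k x)%:C) = fun x => \sum_(i < #|`rs|)
      ((rs`_i)%:C * indC (s k @^-1` [set rs`_i]) x)); last first.
    apply/funext => x; rewrite [in LHS]fimfunEord (big_morph (fun r : R => r%:C)
      (id1 := 0) (op1 := +%R)) //.
      by apply: eq_bigr => i _; rewrite realCM.
    by move=> a b; apply: complex_ext; rewrite ?ReD ?ImD/= ?addr0.
  apply: osc_vanish_sum => i.
  have [->|r0] := eqVneq rs`_i 0.
    by under eq_fun do rewrite mul0r; exact: osc_vanish0.
  apply: osc_vanishZ; apply: osc_vanish_indC => //.
  have r2 : 0 < rs`_i ^+ 2 by rewrite exprn_even_gt0.
  (* Chebyshev's inequality: a nonzero value of a simple function below h is taken on a set of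
     finite measure. *)
  suff : ((rs`_i ^+ 2)%:E * mun (s k @^-1` [set rs`_i]) < +oo)%E.
    have := measure_ge0 mun (s k @^-1` [set rs`_i]).
    case: (mun _) => [r _ _||]//; first exact: ltry.
    by rewrite gt0_muley ?lte_fin.
  apply: le_lt_trans hfin.
  rewrite -sqn_indC// -(_ : normc (rs`_i)%:C ^+ 2 = rs`_i ^+ 2); last first.
    by rewrite normc_re real_normK// num_real.
  rewrite -sqnZ; last exact: cmeas_indC.
  apply: sqn_le => [||x].
  - by apply: cmeasM; [exact: cmeas_cst|exact: cmeas_indC].
  - exact: cmeas_re.
  rewrite normcM !normc_re (ger0_norm (h0 x)) indicE.
  case: (boolP (x \in _)) => [|_]; last by rewrite normr0 mulr0.
  by rewrite inE/= => <-; rewrite normr1 mulr1 ger0_norm.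
apply: osc_vanish_approx => // e e0.
have [|||k hk] := tends0_ex (@tends0_sqn_dct _ _ _ mun
    (fun k x => (h x)%:C - (s k x)%:C) (fun x => normc (h x)%:C ^+ 2) _ _ ih _) e0.
- by move=> k; apply: cmeasB; apply: cmeas_re.
- move=> x; rewrite -(normr0 R) -(subrr (h x)).
  under eq_cvg do rewrite -rmorphB normc_re.
  by apply: cvg_norm; apply: cvgB => //; exact: cvg_cst.
- move=> k x; rewrite -rmorphB !normc_re ler_pXn2r// ?nnegrE//.
  have sk0 : 0 <= s k x by have := @fun_ge0 _ _ (s k).
  by rewrite (ger0_norm (h0 x)) ger0_norm ?subr_ge0 ?ss// gerBl.
by exists (fun x => (s k x)%:C).
Qed.

Lemma osc_vanish_L2 f : cmeas f -> (sqn mun f < +oo)%E -> osc_vanish f.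
Proof.
move=> mf ffin; have [m1 m2] := mf.
have H (h : E -> R) : measurable_fun setT h -> (forall x, `|h x| <= normc (f x)) ->
    osc_vanish (fun x => (h x)%:C).
  move=> mh hf.
  have P (p : E -> R) : measurable_fun setT p -> (forall x, 0 <= p x) ->
      (forall x, p x <= `|h x|) -> osc_vanish (fun x => (p x)%:C).
    move=> mp p0 ph; apply: osc_vanish_nonneg => //.
    apply: le_lt_trans ffin; apply: sqn_le => [||x]; [exact: cmeas_re|exact: mf|].
    by rewrite normc_re ger0_norm// (le_trans (ph x)).
  rewrite (_ : (fun x => (h x)%:C) = fun x => (Num.max (h x) 0)%:C - (Num.max (- h x) 0)%:C).
    apply: osc_vanishB; apply: P.
    + exact: measurable_maxr.
    + by move=> x; rewrite le_max lexx orbT.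
    + by move=> x; rewrite ge_max ler_norm normr_ge0.
    + by apply: measurable_maxr => //; exact: measurable_funN.
    + by move=> x; rewrite le_max lexx orbT.
    + by move=> x; rewrite ge_max -normrN ler_norm normr_ge0.
  apply/funext => x; rewrite -rmorphB; congr (_%:C).
  have [hx|/ltW hx] := leP 0 (h x).
    by rewrite (max_idPr _) ?oppr_le0// subr0.
  by rewrite (max_idPl _) ?oppr_ge0// sub0r opprK.
rewrite (_ : f = fun x => (complex.Re (f x))%:C + 'i%C * (complex.Im (f x))%:C).
  apply: osc_vanishD; first by apply: H => // x; exact: normr_Re.
  by apply: osc_vanishZ; apply: H => // x; exact: normr_Im.
by apply/funext => x; exact: complexE.
Qed.

End translation_L2.

(** * Plancherel's formula for integrable functions *)

Section plancherel_L1.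
Context {R : realType} {n : nat}.
Local Notation mun := (@lebesgue_measure_n R n).
Local Notation E := (euclidean R n).
Implicit Types f : E -> R[i].

Lemma ge0_integral_prod_affv (a : R) (H : E * E -> \bar R) : 0 < a ->
  measurable_fun setT H -> (forall z, (0 <= H z)%E) ->
  (\int[(mun \x mun)]_z H z =
   (a ^+ n)%:E * \int[(mun \x mun)]_z H (z.1, affv a z.1 z.2))%E.
Proof.
move=> a0 mH H0.
have mH' : measurable_fun setT (fun z : E * E => H (z.1, affv a z.1 z.2)).
  by apply: (measurableT_comp mH); apply: measurable_fun_pair => //; exact: measurable_affz.
rewrite !fubini_tonelli1//; try by move=> z; exact: H0.
rewrite -ge0_integralZl//; last 3 first.
- by apply: measurable_fun_fubini_tonelli_F => // z; exact: H0.
- by move=> x _; apply: integral_ge0 => y _; exact: H0.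
- by rewrite lee_fin exprn_ge0// ltW.
apply: eq_integral => x _; rewrite /fubini_F (ge0_integral_affv x a0)//.
by apply: (measurableT_comp mH); exact: measurable_pair1.
Qed.

Let z0 : E := [tuple 0 | j < n].

Lemma affv1_0 (x : E) : affv 1 z0 x = x.
Proof. by apply: eq_from_tnth => j; rewrite !tnth_mktuple add0r mul1r. Qed.

Lemma dotv0 (x : E) : dotv z0 x = 0.
Proof. by apply: big1 => j _; rewrite tnth_mktuple mul0r. Qed.

Lemma fin_num_Rintegral d (T : measurableType d) (mu : {measure set T -> \bar R})
    (h : T -> R) (c : \bar R) : measurable_fun setT h -> (forall x, 0 <= h x) ->
  (\int[mu]_x (h x)%:E = c)%E -> (c < +oo)%E ->
  mu.-integrable setT (EFin \o h) /\ (\int[mu]_x h x)%:E = c.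
Proof.
move=> mh h0 hc cfin; split; last first.
  rewrite /Rintegral hc fineK// ge0_fin_numE// -hc.
  by apply: integral_ge0 => x _; rewrite lee_fin.
apply/integrableP; split; first exact/measurable_EFinP.
by under eq_integral do rewrite /= ger0_norm//; rewrite hc.
Qed.

(** Polarisation in the kernel identity: 2 Re (f(x) conj f(y)) = |f(x)|^2 + |f(y)|^2 - |f(x) -
    f(y)|^2. The substitution y = x + a v turns the kernel into the fixed weight [gaussS v], so the
    first two terms give the norm of f and the last one its oscillation. *)
Lemma gaussW_energy f (a : R) : 0 < a -> cintegrable mun f -> (sqn mun f < +oo)%E ->
  (\int[mun]_eta (gaussW (a ^- 2) z0 eta * normc (fourierL1 f eta) ^+ 2)%:E +
   (2^-1 * Num.sqrt (2 * pi) ^+ n)%:E * osc a f =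
  ((2 * pi) ^+ n)%:E * sqn mun f)%E.
Proof.
move=> a0 iF fy; have mf := cintegrable_meas iF.
have l0 : 0 < a ^- 2 by rewrite invr_gt0 exprn_gt0.
have K := kernel_identity z0 z0 z0 l0 iF.
set s2 := Num.sqrt (2 * pi) in K *.
have s20 : 0 < s2 by rewrite sqrtr_gt0 mulr_gt0// pi_gt0.
pose ka (z : E * E) : R := expR (- (a ^- 2 / 2 * normv (subv z.1 z.2) ^+ 2)).
have kaE z : kernel (a ^- 2) z0 z0 z0 z.1 z.2 = (ka z)%:C.
  by rewrite /kernel /ka -expC_real !dotv0 dotvC dotv0 !subrr.
have mka : measurable_fun setT ka.
  apply: measurableT_comp => //; apply: measurable_funN; apply: measurable_funM => //.
  by apply: measurable_normv2; exact: measurable_subv.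
have ka0 z : 0 <= ka z by exact: expR_ge0.
have kaA z : ka (z.1, affv a z.1 z.2) = gaussS z.2.
  rewrite /ka /gaussS; congr (expR (- _)).
  rewrite (_ : subv _ _ = scalev (- a) z.2); last first.
    by apply: eq_from_tnth => j; rewrite !tnth_mktuple; ring.
  by rewrite normv_scale normrN exprMn real_normK ?num_real//; field; rewrite gt_eqF.
have sn := sqn_ge0 mun f.
have on := osc_ge0 a f.
have oy : (osc a f < +oo)%E.
  by apply: le_lt_trans (osc_le a mf) _; rewrite lte_mul_pinfty// lee_fin mulr_ge0// exprn_ge0// ltW.
pose c := (a ^+ n * s2 ^+ n)%:E.
have c0 : (0 <= c)%E by rewrite lee_fin mulr_ge0// exprn_ge0// ltW.
have cy : (c * sqn mun f < +oo)%E by rewrite lte_mul_pinfty.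
have [i1 e1] : (mun \x mun)%E.-integrable setT (EFin \o (fun z => ka z * normc (f z.1) ^+ 2)) /\
    (\int[(mun \x mun)%E]_z (ka z * normc (f z.1) ^+ 2))%:E = (c * sqn mun f)%E.
  apply: fin_num_Rintegral => //.
  - apply: measurable_funM => //; apply: cmeas_norm2; exact: (cmeas_comp mf).
  - by move=> z; rewrite mulr_ge0// sqr_ge0.
  rewrite (ge0_integral_prod_affv a0); last 2 first.
  - apply/measurable_EFinP; apply: measurable_funM => //; apply: cmeas_norm2; exact: (cmeas_comp mf).
  - by move=> z; rewrite lee_fin mulr_ge0// sqr_ge0.
  under eq_integral do rewrite kaA.
  by rewrite /c EFinM -muleA -(osc_cst mf).
have [i2 e2] : (mun \x mun)%E.-integrable setT (EFin \o (fun z => ka z * normc (f z.2) ^+ 2)) /\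
    (\int[(mun \x mun)%E]_z (ka z * normc (f z.2) ^+ 2))%:E = (c * sqn mun f)%E.
  apply: fin_num_Rintegral => //.
  - apply: measurable_funM => //; apply: cmeas_norm2; exact: (cmeas_comp mf).
  - by move=> z; rewrite mulr_ge0// sqr_ge0.
  rewrite (ge0_integral_prod_affv a0); last 2 first.
  - apply/measurable_EFinP; apply: measurable_funM => //; apply: cmeas_norm2; exact: (cmeas_comp mf).
  - by move=> z; rewrite lee_fin mulr_ge0// sqr_ge0.
  under eq_integral do rewrite kaA.
  by rewrite /c EFinM -muleA -(osc_shift a mf).
have [i3 e3] : (mun \x mun)%E.-integrable setT (EFin \o (fun z => ka z * normc (f z.2 - f z.1) ^+ 2)) /\
    (\int[(mun \x mun)%E]_z (ka z * normc (f z.2 - f z.1) ^+ 2))%:E = ((a ^+ n)%:E * osc a f)%E.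
  apply: fin_num_Rintegral.
  - apply: measurable_funM => //; apply: cmeas_norm2; apply: cmeasB; exact: (cmeas_comp mf).
  - by move=> z; rewrite mulr_ge0// sqr_ge0.
  rewrite (ge0_integral_prod_affv a0); last 2 first.
  - apply/measurable_EFinP; apply: measurable_funM => //; apply: cmeas_norm2; apply: cmeasB; exact: (cmeas_comp mf).
  - by move=> z; rewrite lee_fin mulr_ge0// sqr_ge0.
  by under eq_integral do rewrite kaA.
  by rewrite lte_mul_pinfty// lee_fin exprn_ge0// ltW.
have mF := cmeas_fourierL1 mf.
pose M := \int[mun]_u normc (f u).
have b0 : 0 < (2 * a ^- 2)^-1 by rewrite invr_gt0 mulr_gt0.
have [ig _] := integrable_gaussn z0 b0.
have iL : mun.-integrable setT (EFin \o (fun eta => gaussW (a ^- 2) z0 eta * normc (fourierL1 f eta) ^+ 2)).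
  apply: le_integrable (integrable_scale (M ^+ 2) ig) => //.
    apply/measurable_EFinP; apply: measurable_funM; last exact: cmeas_norm2.
    by apply/measurable_EFinP; exact: measurable_int ig.
  have M0 : 0 <= M by apply: Rintegral_ge0 => u _; exact: normc_ge0.
  move=> x _; have FM := normc_fourierL1_le x iF.
  have /ger0_norm e0 : 0 <= gaussW (a ^- 2) z0 x * normc (fourierL1 f x) ^+ 2.
    by rewrite mulr_ge0 ?sqr_ge0 ?expR_ge0.
  have /ger0_norm e0' : 0 <= M ^+ 2 * gaussW (a ^- 2) z0 x.
    by rewrite mulr_ge0 ?sqr_ge0 ?expR_ge0.
  change (`|gaussW (a ^- 2) z0 x * normc (fourierL1 f x) ^+ 2|%:E <=
    `|M ^+ 2 * gaussW (a ^- 2) z0 x|%:E)%E.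
  rewrite lee_fin e0 e0' mulrC ler_wpM2r ?expR_ge0// ler_pXn2r// nnegrE//.
  exact: normc_ge0.
have LE : \int[mun]_eta (gaussW (a ^- 2) z0 eta * normc (fourierL1 f eta) ^+ 2) =
    (s2 ^+ n / a ^+ n) * \int[(mun \x mun)%E]_z
      complex.Re (f z.1 * ((f z.2)^*)%C * kernel (a ^- 2) z0 z0 z0 z.1 z.2).
  have : complex.Re (cint mun (fun eta => (gaussW (a ^- 2) z0 eta * normc (fourierL1 f eta) ^+ 2)%:C)) =
     complex.Re ((Num.sqrt (2 * pi * a ^- 2) ^+ n)%:C * cint (mun \x mun)%E
       (fun z => f z.1 * ((f z.2)^*)%C * kernel (a ^- 2) z0 z0 z0 z.1 z.2)).
    rewrite -K; congr complex.Re; apply: eq_cint => eta.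
    by rewrite affv1_0 realCM normc_sqrJ.
  rewrite cint_re ReM /= mul0r subr0 => ->; congr (_ * _).
  rewrite sqrtrM; last by rewrite mulr_ge0// pi_ge0.
  by rewrite -exprVn sqrtr_sqr ger0_norm ?invr_ge0 ?ltW// exprMn exprVn.
have RE : \int[(mun \x mun)%E]_z complex.Re (f z.1 * ((f z.2)^*)%C * kernel (a ^- 2) z0 z0 z0 z.1 z.2) =
   2^-1 * (\int[(mun \x mun)%E]_z (ka z * normc (f z.1) ^+ 2) +
     \int[(mun \x mun)%E]_z (ka z * normc (f z.2) ^+ 2) -
     \int[(mun \x mun)%E]_z (ka z * normc (f z.2 - f z.1) ^+ 2)).
  have i12 := integrableD measurableT i1 i2.
  have i123 := integrableB measurableT i12 i3.
  rewrite -RintegralD// -RintegralB// -RintegralZl//.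
  apply: eq_Rintegral => z _; rewrite kaE !(ReM, ImM, ReJ, ImJ) /= !normc_sqr ReB ImB.
  by field.
move: LE; rewrite RE => LE.
have -> : (\int[mun]_eta (gaussW (a ^- 2) z0 eta * normc (fourierL1 f eta) ^+ 2)%:E)%E =
   (\int[mun]_eta (gaussW (a ^- 2) z0 eta * normc (fourierL1 f eta) ^+ 2))%:E.
  by rewrite /Rintegral fineK//; exact: integrable_fin_num.
rewrite LE.
have sfin : sqn mun f \is a fin_num by rewrite ge0_fin_numE.
have ofin : osc a f \is a fin_num by rewrite ge0_fin_numE.
move: e1 e2 e3; rewrite -(fineK sfin) -(fineK ofin) /c -!EFinM.
move=> [->] [->] [->]; rewrite -EFinD; congr EFin.
have -> : (2 * pi) ^+ n = s2 ^+ n * s2 ^+ n :> R.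
  by rewrite -exprMn -expr2 sqr_sqrtr// mulr_ge0// pi_ge0.
by field; rewrite expf_neq0// gt_eqF.
Qed.

(** For a = 1 / (k + 1) the windows increase to 1, so the window energies converge to the norm of
    the transform by monotone convergence, while the oscillation tends to 0. *)
Lemma plancherel_L1 f : cintegrable mun f -> (sqn mun f < +oo)%E ->
  sqn mun (fourierL1 f) = (((2 * pi) ^+ n)%:E * sqn mun f)%E.
Proof.
move=> iF fy; have mf := cintegrable_meas iF; have mF := cmeas_fourierL1 mf.
pose g k (eta : E) := (gaussW (k.+1%:R^-1 ^- 2) z0 eta * normc (fourierL1 f eta) ^+ 2)%:E.
have mg k : measurable_fun setT (g k).
  apply/measurable_EFinP; apply: measurable_funM; last exact: cmeas_norm2.
  apply: measurableT_comp => //; apply: measurable_funN; apply: measurable_funM => //.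
  by apply: measurable_normv2; exact: measurable_subv.
have g0 k x : (0 <= g k x)%E by rewrite lee_fin mulr_ge0 ?sqr_ge0 ?expR_ge0.
have gx x : g k x @[k --> \oo] --> (normc (fourierL1 f x) ^+ 2)%:E.
  apply/fine_cvgP; split; first exact: nearW.
  rewrite -[X in _ --> X]mul1r; apply: cvgM; last exact: cvg_cst.
  rewrite [X in _ --> X](_ : _ = expR (- (0 * normv (subv x z0) ^+ 2))); last first.
    by rewrite mul0r oppr0 expR0.
  rewrite /gaussW; apply: (cvg_comp _ expR); last exact: continuous_expR.
  apply: cvgN.
  apply: cvgM; last exact: cvg_cst.
  have -> : (fun k : nat => (2 * k.+1%:R^-1 ^- 2)^-1 : R) = (fun k => 2^-1 * (k.+1%:R^-1 * k.+1%:R^-1)).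
    by apply/funext => k; rewrite invfM invrK expr2.
  rewrite [X in _ --> X](_ : _ = 2^-1 * (0 * 0)); last by rewrite !mulr0.
  apply: cvgM; first exact: cvg_cst.
  by apply: cvgM; exact: cvg_harmonic.
have nd x : {homo g^~ x : k m / (k <= m)%N >-> (k <= m)%E}.
  move=> k m km; rewrite lee_fin ler_wpM2r ?sqr_ge0// ler_expR lerN2.
  rewrite ler_wpM2r ?sqr_ge0// lef_pV2 ?posrE ?mulr_gt0 ?invr_gt0 ?exprn_gt0//.
  by rewrite ler_pM2l// lef_pV2 ?posrE ?exprn_gt0// ?invr_gt0// ler_pXn2r ?nnegrE ?invr_ge0// lef_pV2 ?posrE// ler_nat.
have cv := @cvg_monotone_convergence _ _ _ mun setT measurableT g mg (fun k x _ => g0 k x) (fun x _ => nd x).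
have e1 : (\int[mun]_x limn (g^~ x) = sqn mun (fourierL1 f))%E.
  by apply: eq_integral => x _; apply/cvg_lim => //; exact: gx.
have [_ _ tf] := osc_vanish_L2 mf fy.
pose c : R := 2^-1 * Num.sqrt (2 * pi) ^+ n.
have c0 : 0 <= c by rewrite mulr_ge0// exprn_ge0// sqrtr_ge0.
have /tends0_cvg to := tends0Z c0 tf.
have /to {}to : forall k, (0 <= c%:E * osc k.+1%:R^-1 f)%E.
  by move=> k; rewrite mule_ge0// osc_ge0.
have Ek k : (\int[mun]_x g k x + c%:E * osc k.+1%:R^-1 f = ((2 * pi) ^+ n)%:E * sqn mun f)%E.
  by apply: gaussW_energy => //; rewrite invr_gt0.
have : (\int[mun]_x g k x + c%:E * osc k.+1%:R^-1 f @[k --> \oo] --> sqn mun (fourierL1 f) + 0)%E.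
  apply: cvgeD; first by rewrite adde_defC; apply: fin_num_adde_defr.
    by rewrite -e1; exact: cv.
  exact: to.
rewrite adde0 (_ : (fun _ => _) = fun=> (((2 * pi) ^+ n)%:E * sqn mun f)%E); last exact/funext.
by move=> h; apply: (cvg_unique _ h (cvg_cst _)).
Qed.

End plancherel_L1.

(** * Completeness of L^2 *)

Section riesz_fischer.
Context d (T : measurableType d) {R : realType}.
Variable mu : {measure set T -> \bar R}.

Lemma cvg_geometric_increments (u : nat -> R) (C : R) :
  (forall k, `|u k.+1 - u k| <= C * 2^-1 ^+ k) -> cvgn u.
Proof.
move=> uC.
have : cvgn (series (fun k => `|u k.+1 - u k|)).
  apply: (@series_le_cvg _ _ (fun k => C * 2^-1 ^+ k)) => //.
    by move=> k; apply: le_trans (uC k).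
  by apply: is_cvg_geometric_series; rewrite ger0_norm ?invr_ge0// invf_lt1// ltr1n.
move=> /normed_cvg/= h.
have e : u = (fun k => u 0%N + series (fun k => u k.+1 - u k) k).
  by apply/funext => k; rewrite /series/= telescope_sumr// addrC subrK.
by rewrite e; apply: is_cvgD => //; exact: is_cvg_cst.
Qed.

Lemma sqn_fatou (h : nat -> T -> R[i]) (g : T -> R[i]) (c : \bar R) :
  (forall k, cmeas (h k)) ->
  (forall x, normc (h k x) ^+ 2 @[k --> \oo] --> normc (g x) ^+ 2) ->
  (\forall k \near \oo, (sqn mu (h k) <= c)%E) -> (sqn mu g <= c)%E.
Proof.
move=> mh hg hc.
have F := fatou mu measurableT (fun k => emeas_norm2 (mh k))
  (fun k x _ => norm2_ge0 (h k) x).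
have e : (sqn mu g = \int[mu]_x limn_einf (fun k => (normc (h k x) ^+ 2)%:E))%E.
  apply: eq_integral => x _.
  have cv : (normc (h k x) ^+ 2)%:E @[k --> \oo] --> (normc (g x) ^+ 2)%:E.
    by apply/fine_cvgP; split; [exact: nearW|exact: hg].
  by rewrite is_cvg_limn_einfE; [apply/esym/cvg_lim|apply/cvg_ex; eexists; exact: cv].
rewrite e; apply: le_trans F _.
case: hc => N _ hc; rewrite limn_einf_lim; apply: lime_le.
  exact: is_cvg_einfs.
apply: nearW => k; apply: le_trans (hc (maxn k N) (leq_maxr _ _)).
by apply: ereal_inf_lbound; exists (maxn k N) => //=; exact: leq_maxl.
Qed.

(** A subsequence whose increments are fast in norm converges geometrically at almost every point;
    Fatou's lemma turns the Cauchy condition into convergence in norm to that limit. *)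
Lemma riesz_fischer (h : nat -> T -> R[i]) :
  (forall k, cmeas (h k)) ->
  (forall e : R, 0 < e -> exists N, forall i j, (N <= i)%N -> (N <= j)%N ->
    (sqn mu (fun x => h i x - h j x)%R <= e%:E)%E) ->
  exists g, cmeas g /\ tends0 (fun k => sqn mu (fun x => g x - h k x)%R).
Proof.
move=> mh cau.
have [p pP] : exists p : nat -> nat, forall k i j, (p k <= i)%N -> (p k <= j)%N ->
    (sqn mu (fun x => h i x - h j x)%R <= ((8^-1 : R) ^+ k)%:E)%E.
  have H k : exists N, forall i j, (N <= i)%N -> (N <= j)%N ->
    (sqn mu (fun x => h i x - h j x)%R <= ((8^-1 : R) ^+ k)%:E)%E.
    by apply: cau; rewrite exprn_gt0// invr_gt0.
  by exists (fun k => sval (cid (H k))) => k; case: cid.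
(* The index [q k] exceeds every [p j] with j <= k, and also k itself. *)
pose q k := (\sum_(j < k.+1) p j + k)%N.
have pq j k : (j <= k)%N -> (p j <= q k)%N.
  by move=> jk; rewrite /q (bigD1 (Ordinal (jk : j < k.+1)%N))//= -addnA leq_addr.
pose dd k x : R[i] := h (q k.+1) x - h (q k) x.
have mdd k : cmeas (dd k) by exact: cmeasB.
have ddle k : (sqn mu (dd k) <= ((8^-1 : R) ^+ k)%:E)%E.
  by apply: pP; apply: pq.
(* The squared increments have norm at most 8^-k, so with weights 4^k the series still has integral
   at most the sum of 2^-k. Where it is finite, the k-th increment is at most a constant times
   2^-k. *)
pose F x : \bar R := (\sum_(0 <= k <oo) ((4 ^+ k : R)%:E * (normc (dd k x) ^+ 2)%:E))%E.
have term0 k x : (0 <= (4 ^+ k : R)%:E * (normc (dd k x) ^+ 2)%:E)%E.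
  by rewrite mule_ge0// lee_fin ?sqr_ge0// exprn_ge0.
have mterm k : measurable_fun setT (fun x => (4 ^+ k : R)%:E * (normc (dd k x) ^+ 2)%:E)%E.
  by apply: measurable_funeM; exact: emeas_norm2.
have mF : measurable_fun setT F by apply: ge0_emeasurable_sum.
have F0 x : (0 <= F x)%E by apply: nneseries_ge0.
have intF : (\int[mu]_x F x < +oo)%E.
  rewrite integral_nneseries//.
  apply: (@le_lt_trans _ _ (\sum_(0 <= k <oo) ((2^-1 : R) ^+ k)%:E)%E).
    apply: lee_nneseries => [k _ _|k _]; first by apply: integral_ge0 => x _; exact: term0.
    have -> : (\int[mu]_x ((4 ^+ k)%:E * (normc (dd k x) ^+ 2)%:E) = (4 ^+ k)%:E * sqn mu (dd k))%E.
      by apply: ge0_integralZl => //;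
        [exact: emeas_norm2|move=> x _; exact: norm2_ge0].
    apply: le_trans (lee_wpmul2l _ (ddle k)) _; first by rewrite lee_fin exprn_ge0.
    rewrite -EFinM lee_fin -exprMn.
    by rewrite (_ : 4 * 8^-1 = 2^-1 :> R)//; field.
  have gs : cvgn (series (fun k => (1 : R) * 2^-1 ^+ k)).
    by apply: is_cvg_geometric_series; rewrite ger0_norm ?invr_ge0// invf_lt1// ltr1n.
  have -> : (\sum_(0 <= k <oo) ((2^-1 : R) ^+ k)%:E)%E = (limn (series (fun k => (1 : R) * 2^-1 ^+ k)))%:E.
    rewrite -EFin_lim//; congr (limn _); apply/funext => k /=.
    by rewrite /series/= -sumEFin; apply: eq_bigr => i _; rewrite mul1r.
  exact: ltry.
pose G := [set x | (F x < +oo)%E].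
have mG : measurable G.
  by have := emeasurable_fun_infty_o measurableT mF (+oo%E); rewrite setTI.
have aeG : {ae mu, forall x, G x}.
  have iF : mu.-integrable setT F.
    by apply/integrableP; split => //; under eq_integral do rewrite gee0_abs//.
  have := integrable_ae measurableT iF; apply: filterS => x /(_ I).
  by rewrite /G/= ge0_fin_numE.
(* Putting 0 off the set of convergence makes the limit exist at every point, which is how its
   measurability is obtained. *)
pose h' k x : R[i] := h (q k) x * indC G x.
have mh' k : cmeas (h' k) by apply: cmeasM => //; exact: cmeas_indC.
have incr x : G x -> exists C : R, forall k, normc (dd k x) <= C * 2^-1 ^+ k.
  move=> Gx; pose M := fine (F x).
  have FM : F x = M%:E by rewrite fineK// ge0_fin_numE.
  have M0 : 0 <= M by rewrite fine_ge0.
  exists (Num.sqrt M) => k.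
  have : (4 ^+ k) * normc (dd k x) ^+ 2 <= M.
    rewrite -lee_fin -FM EFinM; apply: le_trans (nneseries_lim_ge k.+1 _) => //.
    by rewrite big_nat_recr//= leeDr// sume_ge0.
  move=> le; have r0 : 0 <= Num.sqrt M * 2^-1 ^+ k.
    by rewrite mulr_ge0 ?sqrtr_ge0// exprn_ge0// invr_ge0.
  rewrite -(@ler_pXn2r _ 2) ?nnegrE ?normc_ge0//.
  rewrite exprMn sqr_sqrtr// -exprM mulnC exprM.
  have -> : 2^-1 ^+ 2 = 4^-1 :> R by rewrite exprVn; congr (_^-1); ring.
  rewrite -(@ler_pM2l _ (4 ^+ k)) ?exprn_gt0//; apply: le_trans le _.
  by rewrite mulrCA -exprMn divff ?pnatr_eq0// expr1n mulr1.
have h'0 x k : ~ G x -> h' k x = 0.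
  move=> nG; rewrite /h' (_ : indC G x = 0 :> R[i]) ?mulr0//.
  by rewrite /indC indicE memNset.
have cvR x : cvgn (fun k => complex.Re (h' k x)).
  have [/incr[C hC]|nG] := pselect (G x); last first.
    rewrite (_ : (fun k => _) = fun=> 0); first exact: is_cvg_cst.
    by apply/funext => k; rewrite h'0.
  apply: (@cvg_geometric_increments _ C) => k.
  rewrite -ReB; apply: le_trans (normr_Re _) _; apply: le_trans (hC k).
  by rewrite -mulrBl normcM /indC normc_re indicE; case: (_ \in _); rewrite ?normr0 ?normr1 ?mulr0 ?mulr1 ?normc_ge0.
have cvI x : cvgn (fun k => complex.Im (h' k x)).
  have [/incr[C hC]|nG] := pselect (G x); last first.
    rewrite (_ : (fun k => _) = fun=> 0); first exact: is_cvg_cst.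
    by apply/funext => k; rewrite h'0.
  apply: (@cvg_geometric_increments _ C) => k.
  rewrite -ImB; apply: le_trans (normr_Im _) _; apply: le_trans (hC k).
  by rewrite -mulrBl normcM /indC normc_re indicE; case: (_ \in _); rewrite ?normr0 ?normr1 ?mulr0 ?mulr1 ?normc_ge0.
pose g x : R[i] := limn (fun k => complex.Re (h' k x)) +i* limn (fun k => complex.Im (h' k x)).
have mg : cmeas g.
  split => /=.
    apply: (@measurable_fun_cvg _ _ _ _ (fun k x => complex.Re (h' k x))).
      by move=> k; have [] := mh' k.
    by move=> x _; exact: cvR.
  apply: (@measurable_fun_cvg _ _ _ _ (fun k x => complex.Im (h' k x))).
    by move=> k; have [] := mh' k.
  by move=> x _; exact: cvI.
exists g; split => // e e0.
have [N hN] := cau e e0; exists N => k Nk.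
apply: (@sqn_fatou (fun j x => h' j x - h k x)).
- by move=> j; exact: cmeasB.
- move=> x; rewrite normc_sqr; under eq_cvg do rewrite normc_sqr ReB ImB.
  by rewrite ReB ImB; apply: cvgD; apply: (cvg_comp _ (fun y : R => y ^+ 2));
    try exact: exprn_continuous; apply: cvgB; try exact: cvg_cst;
    [exact: cvR|exact: cvI].
exists N => // j /= Nj.
have -> : sqn mu (fun x => h' j x - h k x) = sqn mu (fun x => h (q j) x - h k x).
  apply: ae_eq_integral => //.
  - by apply: emeas_norm2; exact: cmeasB.
  - by apply: emeas_norm2; exact: cmeasB.
  apply: filterS aeG => x Gx _; rewrite /h' /indC indicE mem_set// mulr1//.
by apply: hN => //; rewrite (leq_trans Nj)// leq_addl.
Qed.

End riesz_fischer.

(** * The Fourier transform on L^2 *)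

Section fourier_L2.
Context {R : realType} {n : nat}.
Local Notation mun := (@lebesgue_measure_n R n).
Local Notation E := (euclidean R n).
Implicit Types f : E -> R[i].

Lemma cmeas_truncation N f : cmeas f -> cmeas (ball_truncation N f).
Proof.
move=> mf; have mb : measurable_fun setT (fun x : E => normv x <= N%:R).
  by apply: measurable_fun_ler => //; exact: measurable_normv.
rewrite (_ : ball_truncation N f = fun x => f x * ((nat_of_bool (normv x <= N%:R))%:R)%:C).
  apply: cmeasM => //; apply: cmeas_re.
  exact: (measurableT_comp (f := fun b : bool => (nat_of_bool b)%:R : R)).
by apply/funext => x; rewrite /ball_truncation; case: ifP; rewrite ?mulr1 ?mulr0.
Qed.

Lemma normc_truncation N f x : normc (ball_truncation N f x) <= normc (f x).
Proof. by rewrite /ball_truncation; case: ifP => // _; rewrite normc0 normc_ge0. Qed.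

Lemma sqn_truncation N f : cmeas f -> (sqn mun (ball_truncation N f) <= sqn mun f)%E.
Proof.
by move=> mf; apply: sqn_le => // [|x]; [exact: cmeas_truncation|exact: normc_truncation].
Qed.

(** On a ball |f| <= |f|^2 + 1, and balls have finite measure. *)
Lemma cintegrable_truncation N f : cmeas f -> (sqn mun f < +oo)%E ->
  cintegrable mun (ball_truncation N f).
Proof.
move=> mf fy; have := integrableD measurableT (sqn_integrable mf fy) (integrable_ball n (N%:R : R)).
move=> /(@cintegrable_le _ _ _ _ _
  (fun x => normc (f x) ^+ 2 + (nat_of_bool (normv x <= N%:R))%:R)); apply.
  exact: cmeas_truncation.
move=> x; rewrite /ball_truncation; case: ifP => _; last first.
  by rewrite normc0 addr0 sqr_ge0.
  have := sqr_ge0 (normc (f x) - 1); have := normc_ge0 (f x).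
rewrite mulr1n; set y := normc _; nra.
Qed.

Lemma tends0_truncation f : cmeas f -> (sqn mun f < +oo)%E ->
  tends0 (fun N => sqn mun (fun x => f x - ball_truncation N f x)).
Proof.
move=> mf fy; apply: (tends0_sqn_dct (g := fun x => normc (f x) ^+ 2)).
- by move=> k; apply: cmeasB => //; exact: cmeas_truncation.
- move=> x; apply: cvg_near_cst; near=> k.
  rewrite /ball_truncation (_ : normv x <= k%:R) ?subrr ?normc0//.
  by near: k; exact: nbhs_infty_ger.
- exact: sqn_integrable.
- move=> k x; rewrite ler_pXn2r ?nnegrE ?normc_ge0//.
  by rewrite /ball_truncation; case: ifP => _; rewrite ?subrr ?subr0 ?normc0 ?normc_ge0.
Unshelve. all: end_near. Qed.

Lemma pi2n_gt0 : 0 < (2 * pi) ^+ n :> R.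
Proof. by rewrite exprn_gt0// mulr_gt0// pi_gt0. Qed.

(** Truncations form a Cauchy sequence in L^2; Plancherel's formula, applied to their integrable
    differences, carries this over to their transforms. *)
Lemma fourierL2_exists f : cmeas f -> (sqn mun f < +oo)%E -> exists g,
  cmeas g /\ tends0 (fun N => sqn mun (fun x => g x - fourierL1 (ball_truncation N f) x)).
Proof.
move=> mf fy; have iF N := cintegrable_truncation N mf fy.
apply: riesz_fischer => [k|e e0].
  by apply: cmeas_fourierL1; exact: cmeas_truncation.
pose c : R := (2 * pi) ^+ n; have c0 : 0 < c by exact: pi2n_gt0.
(* With error e / (4 c) for each truncation, the inequality with factors 2 bounds their difference
   by e / c, which Plancherel's factor c turns into e. *)
have [N hN] := tends0_truncation mf fy (divr_gt0 e0 (mulr_gt0 (ltr0n R 4) c0)).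
exists N => i j Ni Nj.
have -> : sqn mun (fun x => fourierL1 (ball_truncation i f) x - fourierL1 (ball_truncation j f) x) =
    sqn mun (fourierL1 (fun x => ball_truncation i f x - ball_truncation j f x)).
  by apply: eq_integral => x _; rewrite fourierL1B.
have mi := cmeas_truncation i mf; have mj := cmeas_truncation j mf.
have le : (sqn mun (fun x => ball_truncation i f x - ball_truncation j f x)%R <= (e / c)%:E)%E.
  apply: le_trans (sqn_tri _ mi mf mj) _.
  rewrite sqnB_sym; apply: le_trans (leeD (lee_wpmul2l _ (hN i Ni)) (lee_wpmul2l _ (hN j Nj))) _ => //.
  by rewrite -!EFinM -EFinD lee_fin le_eqVlt; apply/orP; left; apply/eqP; field; rewrite gt_eqF.
rewrite plancherel_L1.
- apply: le_trans (lee_wpmul2l _ le) _; first by rewrite lee_fin ltW.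
  by rewrite -EFinM lee_fin -/c mulrCA divff ?gt_eqF// mulr1.
- rewrite (_ : (fun _ => _) = fun x => ball_truncation i f x + -1 * ball_truncation j f x).
    by apply: cintegrableD => //; exact: cintegrableZ.
  by apply/funext => x; rewrite mulN1r.
- by apply: le_lt_trans le _; rewrite ltry.
Qed.

(** The representative chosen by [xget] is determined up to a null set; these three properties
    describe it fully for norm estimates. *)
Lemma fourierL2P f : cmeas f -> (sqn mun f < +oo)%E ->
  [/\ cmeas (fourierL2 f), (sqn mun (fourierL2 f) < +oo)%E &
  tends0 (fun N => sqn mun (fun x => fourierL2 f x - fourierL1 (ball_truncation N f) x))].
Proof.
move=> mf fy.
suff : is_fourierL2 f (fourierL2 f).
  by move=> [/L2P[m fin] /tends0_L2norm].
apply: (@xgetPex _ (fun=> 0) [set g | is_fourierL2 f g]).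
have [g [mg tg]] := fourierL2_exists mf fy; exists g; split; last exact/tends0_L2norm.
apply/L2P; split => //.
have [N hN] := tg 1 ltr01.
have mF : cmeas (fourierL1 (ball_truncation N f)).
  by apply: cmeas_fourierL1; exact: cmeas_truncation.
rewrite (_ : g = fun x => (g x - fourierL1 (ball_truncation N f) x) + fourierL1 (ball_truncation N f) x).
  apply: le_lt_trans (sqnD _ (cmeasB mg mF) mF) _.
  rewrite lte_add_pinfty// lte_mul_pinfty//.
    by apply: le_lt_trans (hN N (leqnn _)) _; rewrite ltry.
  have fN : (sqn mun (ball_truncation N f) < +oo)%E by exact: le_lt_trans (sqn_truncation N mf) fy.
  rewrite plancherel_L1//; last exact: cintegrable_truncation.
  by rewrite lte_mul_pinfty// lee_fin ltW// pi2n_gt0.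
by apply/funext => x; rewrite subrK.
Qed.

(** Plancherel's formula holds for each truncation, and both f and its transform are limits of the
    truncated objects, so the vanishing of one norm passes to the other. *)
Lemma sqn_fourierL2_eq0 f : cmeas f -> (sqn mun f < +oo)%E ->
  sqn mun (fourierL2 f) = 0%E <-> sqn mun f = 0%E.
Proof.
move=> mf fy; have [mg gy tg] := fourierL2P mf fy.
have tf := tends0_truncation mf fy.
have c0 := pi2n_gt0.
have P N : sqn mun (fourierL1 (ball_truncation N f)) =
    (((2 * pi) ^+ n)%:E * sqn mun (ball_truncation N f))%E.
  apply: plancherel_L1; first exact: cintegrable_truncation.
  exact: le_lt_trans (sqn_truncation N mf) fy.
have mN N := cmeas_truncation N mf; have mFN N := cmeas_fourierL1 (mN N).
have dec (g h : E -> R[i]) : cmeas g -> cmeas h -> (sqn mun g <= 2%:E * sqn mun (fun x => g x - h x)%R + 2%:E * sqn mun h)%E.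
  move=> gm hm; rewrite {1}(_ : g = fun x => (g x - h x) + h x); first exact: sqnD (cmeasB gm hm) hm.
  by apply/funext => x; rewrite subrK.
have fin0 (a : \bar R) : (0 <= a)%E -> (forall e : R, 0 < e -> (a <= e%:E)%E) -> a = 0%E.
  move=> a0 H; apply/eqP; rewrite eq_le a0 andbT; apply/lee_addgt0Pr => e e0.
  by rewrite add0e H.
split=> z.
- apply: fin0 => [|e e0]; first exact: sqn_ge0.
  (* The truncated transform has squared norm at most (2 pi)^n e / 4, so the truncation has at most
     e / 4, and 2 e / 4 + 2 e / 4 = e. *)
  have e1 : 0 < e / 4 by rewrite divr_gt0.
  have e2 : 0 < (2 * pi) ^+ n * e / 8 by rewrite divr_gt0// mulr_gt0.
  have [N1 h1] := tf _ e1; have [N2 h2] := tg _ e2.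
  pose N := maxn N1 N2.
  have hF : (sqn mun (fourierL1 (ball_truncation N f)) <= 2%:E * ((2 * pi) ^+ n * e / 8)%:E)%E.
    apply: le_trans (dec _ _ (mFN N) mg) _; rewrite z mule0 adde0 sqnB_sym.
    by rewrite lee_wpmul2l// h2// leq_maxr.
  have hf : (sqn mun (ball_truncation N f) <= (e / 4)%:E)%E.
    have fN : sqn mun (ball_truncation N f) \is a fin_num.
      by rewrite ge0_fin_numE ?sqn_ge0//; exact: le_lt_trans (sqn_truncation N mf) fy.
    move: hF; rewrite P -(fineK fN) -!EFinM !lee_fin => hF.
    rewrite -(@ler_pM2l _ ((2 * pi) ^+ n))//; apply: le_trans hF _; lra.
  apply: le_trans (dec _ _ mf (mN N)) _.
  apply: le_trans (leeD (lee_wpmul2l _ (h1 N (leq_maxl _ _))) (lee_wpmul2l _ hf)) _ => //.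
  by rewrite -!EFinM -EFinD lee_fin; lra.
- apply: fin0 => [|e e0]; first exact: sqn_ge0.
  have e1 : 0 < e / 2 by rewrite divr_gt0.
  have [N h] := tg _ e1.
  apply: le_trans (dec _ _ mg (mFN N)) _.
  have -> : sqn mun (fourierL1 (ball_truncation N f)) = 0%E.
    rewrite P (_ : sqn mun _ = 0%E) ?mule0//; apply/eqP; rewrite eq_le sqn_ge0 andbT -z.
    exact: sqn_truncation.
  rewrite mule0 adde0; apply: le_trans (lee_wpmul2l _ (h N (leqnn _))) _ => //.
  by rewrite -EFinM lee_fin; lra.
Qed.

End fourier_L2.

(** * Theta functions and Fejer means *)

Section geometric_sums.
Context {R : realType}.
Implicit Types (r b z : R) (K c : nat).

(** Truncated subtraction makes the formula cover K <= c: the sum is empty and the right-hand side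
    is 1 - r^0 = 0. *)
Lemma geometric_sum_right r K c :
  (1 - r) * \sum_(k < K | (c <= k)%N) r ^+ (k - c) = 1 - r ^+ (K - c).
Proof.
elim: K => [|K IH]; first by rewrite big_ord0 mulr0 sub0n expr0 subrr.
rewrite big_mkcond big_ord_recr/= -big_mkcond/= mulrDr IH.
case: leqP => cK; first by rewrite subSn// exprS; ring.
have e1 : (K - c = 0)%N by apply/eqP; rewrite subn_eq0 ltnW.
have e2 : (K.+1 - c = 0)%N by apply/eqP; rewrite subn_eq0.
by rewrite mulr0 addr0 e1 e2.
Qed.

Lemma geometric_sum_left r K c :
  (1 - r) * \sum_(k < K | (k < c)%N) r ^+ (c - k) = r ^+ (c - K).+1 - r ^+ c.+1.
Proof.
elim: K => [|K IH]; first by rewrite big_ord0 mulr0 subn0 subrr.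
rewrite big_mkcond big_ord_recr/= -big_mkcond/= mulrDr IH.
case: ltnP => cK; first by rewrite subnSK// exprS; ring.
have e1 : (c - K = 0)%N by apply/eqP; rewrite subn_eq0.
have e2 : (c - K.+1 = 0)%N by apply/eqP; rewrite subn_eq0 leqW.
by rewrite mulr0 addr0 e1 e2.
Qed.

(** In truncated subtraction [(k - c) + (c - k)] is the distance |k - c|, and the right-hand side is
    the sum of the full two-sided geometric series. *)
Lemma geometric_sum_dist r K c : 0 <= r < 1 ->
  \sum_(k < K) r ^+ ((k - c) + (c - k)) <= (1 + r) / (1 - r).
Proof.
move=> /andP[r0 r1]; have r10 : 0 < 1 - r by rewrite subr_gt0.
rewrite ler_pdivlMr// mulrC (bigID (fun k : 'I_K => (c <= k)%N))/= mulrDr.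
have -> : \sum_(k < K | (c <= k)%N) r ^+ ((k - c) + (c - k)) =
    \sum_(k < K | (c <= k)%N) r ^+ (k - c).
  by apply: eq_bigr => k; rewrite -subn_eq0 => /eqP ->; rewrite addn0.
have -> : \sum_(k < K | ~~ (c <= k)%N) r ^+ ((k - c) + (c - k)) =
    \sum_(k < K | (k < c)%N) r ^+ (c - k).
  apply: eq_big => k; rewrite -ltnNge// => kc.
  by rewrite (eqP (_ : k - c == 0)%N)// subn_eq0 ltnW.
rewrite geometric_sum_right geometric_sum_left.
have h1 : 0 <= r ^+ (K - c) by exact: exprn_ge0.
have h2 : 0 <= r ^+ c.+1 by exact: exprn_ge0.
have h3 : r ^+ (c - K).+1 <= r.
  by rewrite exprS ler_piMr// exprn_ile1// ltW.
lra.
Qed.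

(** The factor [expR (2 * b)] pays for replacing z by a natural number c with (k - z)^2 >= |k - c| -
    2 for all natural k; a two-sided geometric series of ratio exp (- b) remains. The bound depends
    neither on z nor on the number of terms. *)
Definition gauss_sum_bound b : R := expR (2 * b) * ((1 + expR (- b)) / (1 - expR (- b))).

Lemma expRN_itv b : 0 < b -> 0 <= expR (- b) < 1.
Proof. by move=> b0; rewrite expR_ge0/= expR_lt1 oppr_lt0. Qed.

Lemma gauss_sum_bound_ge0 b : 0 < b -> 0 <= gauss_sum_bound b.
Proof.
move=> /expRN_itv/andP[h0 h1]; apply: mulr_ge0; first exact: expR_ge0.
by apply: divr_ge0; [exact: addr_ge0|rewrite subr_ge0 ltW].
Qed.

Lemma gauss_sum_le b z K : 0 < b ->
  \sum_(k < K) expR (- (b * (k%:R - z) ^+ 2)) <= gauss_sum_bound b.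
Proof.
move=> b0; have rr := expRN_itv b0.
have [c hc] : exists c : nat, forall k : nat,
    (((k - c) + (c - k))%N)%:R - 1 <= `|k%:R - z|.
  have [z0|z0] := leP z 0.
    exists 0%N => k; rewrite subn0 sub0n addn0 ger0_norm; last by rewrite subr_ge0 (le_trans z0).
    by rewrite lerB// (le_trans z0).
  have /andP[h1 h2] := truncn_itv (ltW z0).
  exists (Num.truncn z) => k; set c := Num.truncn z in h1 h2 *.
  have [ck|kc] := leqP c k.
    rewrite (eqP (_ : c - k == 0)%N) ?subn_eq0// addn0 natrB//.
    apply: le_trans _ (ler_norm _); rewrite -natr1 in h2; lra.
  rewrite (eqP (_ : k - c == 0)%N) ?subn_eq0 1?ltnW// add0n natrB 1?ltnW//.
  rewrite distrC; apply: le_trans _ (ler_norm _); lra.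
apply: (@le_trans _ _ (\sum_(k < K) (expR (2 * b) * expR (- b) ^+ ((k - c) + (c - k))))).
  apply: ler_sum => k _; rewrite -expRM_natl -expRD ler_expR.
  have := hc k; set i := ((k - c) + (c - k))%N => hi.
  have : i%:R - 2 <= (k%:R - z) ^+ 2.
    rewrite -(real_normK (num_real (k%:R - z))).
    have := normr_ge0 (k%:R - z); set t := `|_|; have : 0 <= i%:R :> R by [].
    move: hi; rewrite -/t; move: (i%:R : R) => y; nra.
  rewrite mulrN; nra.
rewrite -mulr_sumr ler_pM2l ?expR_gt0//; exact: geometric_sum_dist.
Qed.

End geometric_sums.

(** * The Fejer kernel of period 1 *)

Section fejer_kernel.
Context {R : realType}.
Implicit Types (N j k : nat) (x t : R).

(** The double sum is not collected by differences j - k: in this form positivity is a sum of two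
    squares, and the Fejer mean of a Gaussian is a finite sum of explicit terms. *)
Definition fejer N x : R :=
  N.+1%:R^-1 * \sum_(j < N.+1) \sum_(k < N.+1) cos (2 * pi * (j%:R - k%:R) * x).

Lemma fejerE N x : fejer N x = N.+1%:R^-1 *
  ((\sum_(j < N.+1) cos (j%:R * (2 * pi * x))) ^+ 2 +
   (\sum_(j < N.+1) sin (j%:R * (2 * pi * x))) ^+ 2).
Proof.
congr (_ * _); rewrite !expr2 !mulr_suml -big_split/=.
apply: eq_bigr => j _; rewrite !mulr_sumr -big_split/=; apply: eq_bigr => k _.
by rewrite -cosB; congr cos; ring.
Qed.

Lemma fejer_ge0 N x : 0 <= fejer N x.
Proof. by rewrite fejerE mulr_ge0 ?invr_ge0// addr_ge0// sqr_ge0. Qed.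

Lemma fejer_periodic N x : fejer N (x + 1) = fejer N x.
Proof.
have e (j : nat) : j%:R * (2 * pi * (x + 1)) = j%:R * (2 * pi * x) + (pi *+ 2) *+ j :> R.
  by rewrite -[(pi *+ 2) *+ j]mulr_natl -[pi *+ 2]mulr_natl; ring.
rewrite !fejerE; congr (_ * (_ ^+ 2 + _ ^+ 2)); apply: eq_bigr => j _.
  by rewrite e (periodicn (@cosD2pi R)).
by rewrite e (periodicn (@sinD2pi R)).
Qed.

Lemma fejerD N x k m : fejer N (k%:R - m%:R + x) = fejer N x.
Proof.
have nat i y : fejer N (i%:R + y) = fejer N y.
  elim: i => [|i IH]; first by rewrite add0r.
  by rewrite -natr1 addrAC fejer_periodic.
by rewrite -(nat m) -[RHS](nat k); congr fejer; ring.
Qed.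

(** Real and imaginary parts of the telescoping identity (e^(it) - 1) sum_(j < M) e^(ijt) = e^(iMt)
    - 1. *)
Lemma dirichlet_sums M t :
  (cos t - 1) * (\sum_(j < M) cos (j%:R * t)) - sin t * (\sum_(j < M) sin (j%:R * t)) =
    cos (M%:R * t) - 1 /\
  (cos t - 1) * (\sum_(j < M) sin (j%:R * t)) + sin t * (\sum_(j < M) cos (j%:R * t)) =
    sin (M%:R * t).
Proof.
elim: M => [|M [IH1 IH2]]; first by rewrite !big_ord0 mul0r cos0 sin0; split; ring.
have e : M.+1%:R * t = M%:R * t + t by rewrite -natr1; ring.
rewrite !big_ord_recr/= e cosD sinD; split.
  rewrite (_ : cos (M%:R * t) * cos t - _ - 1 =
    (cos (M%:R * t) - 1) + (cos t - 1) * cos (M%:R * t) - sin t * sin (M%:R * t)); last by ring.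
  by rewrite -IH1; ring.
rewrite (_ : sin (M%:R * t) * cos t + _ =
    sin (M%:R * t) + (cos t - 1) * sin (M%:R * t) + sin t * cos (M%:R * t)); last by ring.
by rewrite -{2}IH2; ring.
Qed.

(** The factor 2 - 2 cos t is |e^(it) - 1|^2, and |e^(iMt) - 1|^2 <= 4. Keeping it on the left
    avoids dividing by 0 at integers. *)
Lemma fejer_le N x : (2 - 2 * cos (2 * pi * x)) * fejer N x <= 4 / N.+1%:R.
Proof.
rewrite fejerE; set t := 2 * pi * x.
have [] := dirichlet_sums N.+1 t; set C := \sum_(j < N.+1) _; set S := \sum_(j < N.+1) _.
move=> e1 e2; rewrite mulrCA mulrC ler_pM2r ?invr_gt0//.
have h := cos2Dsin2 t; have h' := cos2Dsin2 (N.+1%:R * t).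
have -> : (2 - 2 * cos t) * (C ^+ 2 + S ^+ 2) =
    ((cos t - 1) * C - sin t * S) ^+ 2 + ((cos t - 1) * S + sin t * C) ^+ 2.
  rewrite (_ : 2 - 2 * cos t = (cos t ^+ 2 + sin t ^+ 2) + 1 - 2 * cos t); last by rewrite h; ring.
  ring.
rewrite e1 e2 (_ : _ + _ = (cos (N.+1%:R * t) ^+ 2 + sin (N.+1%:R * t) ^+ 2) + 1 - 2 * cos (N.+1%:R * t)); last by ring.
by rewrite h'; have := cos_geN1 (N.+1%:R * t); lra.
Qed.

(** The right-hand side is 4 sin^2 (pi x). The chord bound sin y >= (cos 1 / 2) y on [0, pi / 2]
    comes from the mean value theorem up to 1 and, beyond, from monotonicity and pi / 2 < 2. *)
Lemma cos_quadratic : exists2 q : R, 0 < q &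
  forall x, `|x| <= 2^-1 -> q * x ^+ 2 <= 2 - 2 * cos (2 * pi * x).
Proof.
have c1 := @cos1_gt0 R.
have p2 := @pi_ge2 R; have ph2 := @pihalf_lt2 R.
have sinlin (y : R) : 0 <= y <= pi / 2 -> cos 1 / 2 * y <= sin y.
  move=> /andP[]; rewrite le_eqVlt => /predU1P[<- _|y0 yp]; first by rewrite sin0 mulr0.
  have mv (w : R) : 0 < w -> w <= 1 -> cos 1 * w <= sin w.
    move=> w0 w1.
    have [d dw] := @MVT R sin cos 0 w w0 (fun x _ => is_derive_sin x)
      (continuous_subspaceT (@continuous_sin R)).
    rewrite sin0 !subr0 => ->; rewrite ler_pM2r//.
    move: dw; rewrite in_itv/= => /andP[d0 dw].
    rewrite leNgt ltr_cos ?in_itv/= ?(ltW d0)/=; last 2 first.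
    - lra.
    - lra.
    by rewrite -leNgt; lra.
  have [y1|y1] := leP y 1.
    by apply: le_trans (mv _ y0 y1); nra.
  have s1 : sin 1 <= sin y.
    by rewrite leNgt ltr_sin -?leNgt ?in_itv/= ?(ltW y1)//; apply/andP; split; lra.
  have := mv 1 ltr01 (lexx _); nra.
exists (2 * cos 1 ^+ 2); first by rewrite mulr_gt0 ?exprn_gt0.
move=> x hx.
have -> : 2 - 2 * cos (2 * pi * x) = 4 * sin (pi * `|x|) ^+ 2.
  rewrite sin2cos2 (_ : 2 * pi * x = (pi * x) *+ 2); last by rewrite mulr2n; ring.
  rewrite cos_mulr2n (_ : cos (pi * `|x|) = cos (pi * x)); first by rewrite -mulr_natr; ring.
  by case: (ger0P x) => // _; rewrite mulrN cosN.
have gen (y : R) : 0 <= y -> cos 1 / 2 * (pi * y) <= sin (pi * y) ->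
    2 * cos 1 ^+ 2 * y ^+ 2 <= 4 * sin (pi * y) ^+ 2.
  move=> y0 h; have h0 : 0 <= cos 1 * y by rewrite mulr_ge0// ltW.
  have h1 : 0 <= (cos 1 * y) * (pi - 2) by rewrite mulr_ge0// subr_ge0.
  have h2 : cos 1 * y <= sin (pi * y) by nra.
  nra.
have px : 0 <= pi * `|x| <= pi / 2.
  by rewrite mulr_ge0 ?pi_ge0//= ler_pM2l ?pi_gt0.
have := sinlin _ px; rewrite -(real_normK (num_real x)).
exact: gen.
Qed.

End fejer_kernel.

Section finite_sum_integral.
Context d (T : measurableType d) {R : realType}.
Variable mu : {measure set T -> \bar R}.

Lemma Rintegral_fin_sum (I : Type) (r : seq I) (P : pred I) (F : I -> T -> R) :
  (forall i, P i -> mu.-integrable setT (EFin \o F i)) ->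
  mu.-integrable setT (EFin \o (fun x => \sum_(i <- r | P i) F i x)) /\
  \int[mu]_x (\sum_(i <- r | P i) F i x) = \sum_(i <- r | P i) \int[mu]_x F i x.
Proof.
move=> iF; elim: r => [|i r [IH1 IH2]].
  rewrite (_ : (fun x => _) = fun=> 0); last by apply/funext => x; rewrite big_nil.
  by split; [exact: integrable0|rewrite big_nil Rintegral_cst// mul0r].
rewrite big_cons; case: ifPn => Pi.
  rewrite (_ : (fun x => _) = (fun x => F i x + \sum_(j <- r | P j) F j x)); last first.
    by apply/funext => x; rewrite big_cons Pi.
  split; first exact: (integrableD measurableT (iF i Pi) IH1).
  by rewrite RintegralD// ?IH2//; exact: iF.
rewrite (_ : (fun x => _) = (fun x => \sum_(j <- r | P j) F j x)); last first.
  by apply/funext => x; rewrite big_cons (negbTE Pi).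
by [].
Qed.

End finite_sum_integral.

(** * Unit tiles of the line *)

Section tiling.
Context {R : realType}.
Local Notation lam := (@lebesgue_measure R).

(** Half-open, so that the integer translates partition the line exactly; centred at 0, where the
    Fejer kernel concentrates. *)
Definition tile (x : R) : R := \1_(`[- 2^-1, 2^-1[%classic) x.

Lemma tile_ge0 x : 0 <= tile x. Proof. by rewrite /tile indicE. Qed.

Lemma tileE x : tile x = ((- 2^-1 <= x < 2^-1)%R)%:R.
Proof. by rewrite /tile indicE mem_setE in_itv. Qed.

Lemma measurable_tile : measurable_fun setT tile.
Proof. exact: measurable_indic. Qed.

Lemma integrable_tile : lam.-integrable setT (EFin \o tile).
Proof.
apply: integrable_indic => //.
have : (lebesgue_measure (`[(- 2^-1)%R, 2^-1%R[%classic : set R) < +oo)%E.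
  by rewrite lebesgue_measure_itv/=; case: ifP; rewrite ltry.
exact.
Qed.

Lemma integrable_tileM (g : R -> R) (C : R) : measurable_fun setT g ->
  (forall x, `|g x| <= C) ->
  lam.-integrable setT (EFin \o (fun x => tile x * g x)).
Proof.
move=> mg gC; apply: (le_integrable measurableT _ _ (integrable_scale C integrable_tile)).
  by apply/measurable_EFinP; apply: measurable_funM => //; exact: measurable_tile.
move=> x _ /=; rewrite lee_fin normrM (ger0_norm (tile_ge0 x)) mulrC.
have C0 : 0 <= C by exact: le_trans (gC x).
by rewrite normrM (ger0_norm (tile_ge0 x)) (ger0_norm C0) ler_wpM2r ?tile_ge0.
Qed.

Lemma Rintegral_tile (g : R -> R) : 
  \int[lam]_x (tile x * g x) = \int[lam]_(x in `[- 2^-1, 2^-1[) g x.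
Proof.
rewrite [RHS]Rintegral_mkcond; apply: eq_Rintegral => x _.
by rewrite /tile patchE indicE; case: ifPn => _; rewrite ?mul1r ?mul0r.
Qed.

Lemma sin_pi_nat (j : nat) : sin (pi * j%:R) = 0 :> R.
Proof.
elim: j => [|j IH]; first by rewrite mulr0 sin0.
by rewrite -natr1 mulrDr mulr1 sinD IH sinpi mul0r mulr0 addr0.
Qed.

Lemma Rintegral_tile_cos (j k : nat) :
  \int[lam]_x (tile x * cos (2 * pi * (j%:R - k%:R) * x)) = (j == k)%:R.
Proof.
rewrite Rintegral_tile; set w := 2 * pi * (j%:R - k%:R).
have half : - 2^-1 < 2^-1 :> R by rewrite gtrN// invr_gt0.
have cf : continuous (fun x : R => cos (w * x)).
  move=> x; apply: continuous_comp; first exact: mulrl_continuous.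
  exact: continuous_cos.
rewrite Rintegral_itv_bndo_bndc; last first.
  apply: (@integrableS _ _ _ lam `[- 2^-1, 2^-1]%classic) => //.
    by apply: subset_itvl; rewrite bnd_simp.
  apply: continuous_compact_integrable; first exact: segment_compact.
  exact: continuous_subspaceT.
have [jk|jk] := eqVneq j k.
  rewrite /w jk subrr mulr0; under eq_Rintegral do rewrite mul0r cos0.
  have L : lebesgue_measure (`[- 2^-1, 2^-1]%classic : set R) = 1%:E.
    by rewrite lebesgue_measure_itv/= lte_fin half -EFinB; congr EFin; field.
  by rewrite Rintegral_cst//= [X in fine X]L mul1r.
have w0 : w != 0.
  by rewrite mulf_neq0 ?subr_eq0 ?eqr_nat// mulf_neq0// gt_eqF// pi_gt0.
have dF (x : R) : is_derive x 1 (fun x : R => sin (w * x) / w) (cos (w * x)).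
  have h : is_derive x 1 (fun x : R => w * x) w.
    apply: trigger_derive; rewrite /GRing.scale/=; ring.
  have := @is_derive1_comp R sin (fun x => w * x) x _ _ (is_derive_sin (w * x)) h.
  move=> h2; have := is_deriveM h2 (is_derive_cst w^-1 x 1).
  move=> h3; apply: is_derive_eq h3 _.
  by rewrite /GRing.scale/= mulr0 add0r; field.
rewrite /Rintegral (@continuous_FTC2 _ (fun x => cos (w * x)) (fun x => sin (w * x) / w)) //.
- rewrite -EFinB/= mulrN sinN (_ : w * 2^-1 = pi * (j%:R - k%:R)).
    rewrite mulrBr sinB !sin_pi_nat !mul0r mulr0 subrr oppr0 !mul0r subrr.
    by [].
  by rewrite /w; field.
- exact: continuous_subspaceT.
- have cF : continuous (fun x : R => sin (w * x) / w).
    move=> x; apply: differentiable_continuous; apply/derivable1_diffP.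
    by have [] := dF x.
  split => [x _||].
  + by have [] := dF x.
  + by apply: cvg_at_right_filter; exact: cF.
  + by apply: cvg_at_left_filter; exact: cF.
- by move=> x _; rewrite derive1E; have [_ ->] := dF x.
Qed.

Lemma measurable_fejer N : measurable_fun setT (fejer N : R -> R).
Proof.
apply: measurable_funM => //; apply: measurable_sum => j; apply: measurable_sum => k.
apply: measurableT_comp; first exact: continuous_measurable_fun (@continuous_cos R).
exact: measurable_funM.
Qed.

Lemma fejer_bounded N (x : R) : `|fejer N x| <= N.+1%:R.
Proof.
rewrite /fejer normrM ger0_norm ?invr_ge0// mulrC ler_pdivrMr//.
apply: le_trans (ler_norm_sum _ _ _) _.
apply: (@le_trans _ _ (\sum_(j < N.+1) N.+1%:R)); last first.
  by rewrite sumr_const card_ord mulr_natr.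
apply: ler_sum => j _; apply: le_trans (ler_norm_sum _ _ _) _.
apply: (@le_trans _ _ (\sum_(k < N.+1) 1)); last by rewrite sumr_const card_ord.
by apply: ler_sum => k _; exact: cos_max.
Qed.

Lemma integrable_tile_fejer N : lam.-integrable setT (EFin \o (fun x => tile x * fejer N x)).
Proof. exact: (integrable_tileM (measurable_fejer N) (fejer_bounded N)). Qed.

(** Orthogonality leaves the N + 1 diagonal terms of the double sum, each of integral 1. *)
Lemma Rintegral_tile_fejer N : \int[lam]_x (tile x * fejer N x) = 1.
Proof.
have ic (j k : nat) : lam.-integrable setT
    (EFin \o (fun x => tile x * cos (2 * pi * (j%:R - k%:R) * x))).
  apply: (@integrable_tileM _ 1) => [|x]; last exact: cos_max.
  apply: measurableT_comp; first exact: continuous_measurable_fun (@continuous_cos R).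
  exact: measurable_funM.
transitivity (\int[lam]_x (N.+1%:R^-1 * \sum_(j < N.+1) \sum_(k < N.+1)
    (tile x * cos (2 * pi * (j%:R - k%:R) * x)))).
  apply: eq_Rintegral => x _; rewrite /fejer mulrCA; congr (_ * _).
  by rewrite mulr_sumr; apply: eq_bigr => j _; rewrite mulr_sumr.
have h j := @Rintegral_fin_sum _ _ _ lam _ (index_enum 'I_N.+1) xpredT _ (fun k : 'I_N.+1 => fun _ => ic j k).
have [i1 e1] := @Rintegral_fin_sum _ _ _ lam _ (index_enum 'I_N.+1) xpredT _ (fun j : 'I_N.+1 => fun _ => (h j).1).
rewrite RintegralZl// e1 (eq_bigr (fun=> 1)); last first.
  move=> j _; rewrite (h j).2; under eq_bigr do rewrite Rintegral_tile_cos.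
  by rewrite (bigD1 j)//= eqxx big1 ?addr0// => k; rewrite eq_sym -val_eqE => /negbTE ->.
by rewrite sumr_const card_ord mulVf.
Qed.

Lemma tile_sum (a x : R) (K : nat) :
  \sum_(k < K) tile (x - (a + k%:R)) = ((a - 2^-1 <= x < a + K%:R - 2^-1)%R)%:R.
Proof.
elim: K => [|K IH].
  by rewrite big_ord0 addr0; case: ltP => //; case: leP.
rewrite big_ord_recr/= IH tileE -[K.+1%:R]natr1.
have -> : (- 2^-1 <= x - (a + K%:R)) = (a + K%:R - 2^-1 <= x) by lra.
have -> : (x - (a + K%:R) < 2^-1) = (x < a + (K%:R + 1) - 2^-1) by lra.
have K0 : 0 <= K%:R :> R by [].
by case: (leP (a - 2^-1) x); case: (leP (a + K%:R - 2^-1) x);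
  case: (ltP x (a + (K%:R + 1) - 2^-1)) => //=; rewrite ?addr0 ?add0r// => *; lra.
Qed.

Lemma Rintegral_tiles (g : R -> R) : lam.-integrable setT (EFin \o g) ->
  (\sum_(k < M.*2.+1) \int[lam]_x (tile x * g (k%:R - M%:R + x))) @[M --> \oo] -->
  \int[lam]_x g x.
Proof.
move=> ig; have mg : measurable_fun setT g.
  by apply/measurable_EFinP; exact: measurable_int ig.
pose c (M : nat) (x : R) : R := ((- M%:R - 2^-1 <= x < M%:R + 2^-1)%R)%:R * g x.
have gt (a : R) : lam.-integrable setT (EFin \o (fun x => tile (x - a) * g x)).
  apply: (le_integrable measurableT _ _ ig).
    apply/measurable_EFinP; apply: measurable_funM => //.
    by apply: (measurableT_comp measurable_tile); exact: measurable_funB.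
  move=> x _; rewrite lee_fin normrM ler_piMl// ger0_norm ?tile_ge0// tileE.
  by case: (_ && _).
have cE M x : c M x = \sum_(k < M.*2.+1) (tile (x - (- M%:R + k%:R)) * g x).
  rewrite -mulr_suml tile_sum /c; congr ((_ && (_ < _))%:R * _).
  by rewrite -[M.*2.+1%:R]natr1 -muln2 natrM; field.
have e M : \sum_(k < M.*2.+1) \int[lam]_x (tile x * g (k%:R - M%:R + x)) = \int[lam]_x c M x.
  transitivity (\int[lam]_x \sum_(k < M.*2.+1) (tile (x - (- M%:R + k%:R)) * g x)); last first.
    by apply: eq_Rintegral => x _; rewrite cE.
  rewrite (Rintegral_fin_sum _ (fun k _ => gt _)).2; apply: eq_bigr => k _.
  rewrite (Rintegral_affine1 (- M%:R + k%:R) ltr01 (gt _)).2 mul1r.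
  by apply: eq_Rintegral => x _; rewrite mul1r; congr (tile _ * g _); ring.
rewrite (_ : (fun M => _) = fun M => \int[lam]_x c M x); last by apply/funext => M; exact: e.
suff [] : lam.-integrable setT (EFin \o g) /\ (\int[lam]_x c M x @[M --> \oo] --> \int[lam]_x g x) by [].
apply: (@Rintegral_dct _ _ _ lam c g (fun x => `|g x|)).
- by move=> M; rewrite (_ : c M = fun x => \sum_(k < M.*2.+1) (tile (x - (- M%:R + k%:R)) * g x));
    [have [] := Rintegral_fin_sum (index_enum 'I_M.*2.+1) (fun (k : 'I_M.*2.+1) (_ : xpredT k) => gt (- M%:R + k%:R));
     move=> /measurable_int/measurable_EFinP|apply/funext => x; exact: cE].
- move=> x; apply: cvg_near_cst; near=> M.
  rewrite /c (_ : (_ && _) = true) ?mul1r//.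
  have : `|x| <= M%:R by near: M; exact: nbhs_infty_ger.
  by rewrite ler_norml => /andP[h1 h2]; apply/andP; split; lra.
- have := integrable_norm ig; exact.
- move=> M x; rewrite /c normrM ler_piMl//.
  by case: (_ && _); rewrite ?normr1 ?normr0.
Unshelve. all: end_near. Qed.

End tiling.

(** * Poisson summation for Gaussians through Fejer means *)

Section poisson.
Context {R : realType}.
Local Notation lam := (@lebesgue_measure R).
Variable s : R.
Hypothesis s0 : 0 < s.

(** Up to the factor sqrt (pi / s), the l-th Fourier coefficient of the periodic sum of exp (- s (k
    - z)^2) over the integers k. *)
Definition gauss_coef (l : R) : R := expR (- (pi ^+ 2 * l ^+ 2 / s)).

(** The Fejer mean of order N of [theta], divided by sqrt (pi / s). *)
Definition theta_fejer (N : nat) (z : R) : R :=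
  N.+1%:R^-1 * \sum_(j < N.+1) \sum_(k < N.+1)
    gauss_coef (j%:R - k%:R) * cos (2 * pi * (j%:R - k%:R) * z).

Definition theta_box (M : nat) (z : R) : R :=
  \sum_(k < M.*2.+1) expR (- (s * (k%:R - M%:R - z) ^+ 2)).

Definition theta (z : R) : R := limn (theta_box ^~ z).

Lemma theta_box_le M z : theta_box M z <= gauss_sum_bound s.
Proof.
apply: le_trans (gauss_sum_le (M%:R + z) M.*2.+1 s0); apply: ler_sum => k _.
by rewrite opprD addrA.
Qed.

Lemma theta_box_ge0 M z : 0 <= theta_box M z.
Proof. by apply: sumr_ge0 => k _; exact: expR_ge0. Qed.

Lemma theta_box_cvg z : cvgn (theta_box ^~ z).
Proof.
apply: nondecreasing_is_cvgn.
  apply/nondecreasing_seqP => M; rewrite /theta_box doubleS [leRHS]big_ord_recl [X in _ <= _ + X]big_ord_recr/=.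
  apply: ler_wpDl; first exact: expR_ge0.
  apply: ler_wpDr; first exact: expR_ge0.
  by apply: ler_sum => k _; rewrite /bump leq0n add1n -!natr1 opprD addrACA subrr addr0.
by exists (gauss_sum_bound s) => _ [M _ <-]; exact: theta_box_le.
Qed.

Lemma Rintegral_gauss_cos (z w : R) :
  lam.-integrable setT (EFin \o (fun x => expR (- (s * (x - z) ^+ 2)) * cos (w * x))) /\
  \int[lam]_x (expR (- (s * (x - z) ^+ 2)) * cos (w * x)) =
    Num.sqrt (pi / s) * (expR (- (w ^+ 2 / (4 * s))) * cos (w * z)).
Proof.
have [[iR _] e] := cint_gauss1 z w s0.
have E x : complex.Re (expC ((- (s * (x - z) ^+ 2)) +i* (- (w * x)))) =
   expR (- (s * (x - z) ^+ 2)) * cos (w * x) by rewrite Re_expC/= cosN.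
split.
  by rewrite (_ : (fun x => _) = fun x => complex.Re (expC ((- (s * (x - z) ^+ 2)) +i* (- (w * x)))))//;
    apply/funext => x; rewrite E.
have := congr1 (@complex.Re R) e; rewrite ReM Re_expC /= mul0r subr0 cosN => <-.
by apply: eq_Rintegral => x _; rewrite -E.
Qed.

Lemma theta_fejerE N z :
  lam.-integrable setT (EFin \o (fun x => expR (- (s * (x - z) ^+ 2)) * fejer N x)) /\
  \int[lam]_x (expR (- (s * (x - z) ^+ 2)) * fejer N x) =
    Num.sqrt (pi / s) * theta_fejer N z.
Proof.
pose F (j k : 'I_N.+1) x := expR (- (s * (x - z) ^+ 2)) * cos (2 * pi * (j%:R - k%:R) * x).
have h (j : 'I_N.+1) := Rintegral_fin_sum (index_enum 'I_N.+1)
  (fun (k : 'I_N.+1) (_ : xpredT k) => (Rintegral_gauss_cos z (2 * pi * (j%:R - k%:R))).1).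
have [i e] := Rintegral_fin_sum (index_enum 'I_N.+1)
  (fun (j : 'I_N.+1) (_ : xpredT j) => (h j).1).
have E x : expR (- (s * (x - z) ^+ 2)) * fejer N x =
    N.+1%:R^-1 * \sum_(j < N.+1) \sum_(k < N.+1) (expR (- (s * (x - z) ^+ 2)) * cos (2 * pi * (j%:R - k%:R) * x)).
  rewrite /fejer mulrCA; congr (_ * _).
  by rewrite mulr_sumr; apply: eq_bigr => j _; rewrite mulr_sumr.
rewrite (_ : (fun x => _) = fun x => N.+1%:R^-1 * \sum_(j < N.+1) \sum_(k < N.+1)
  (expR (- (s * (x - z) ^+ 2)) * cos (2 * pi * (j%:R - k%:R) * x))); last first.
  by apply/funext => x; rewrite E.
split; first exact: integrable_scale.
rewrite RintegralZl// e /theta_fejer mulrCA; congr (_ * _).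
rewrite mulr_sumr; apply: eq_bigr => j _; rewrite (h j).2 mulr_sumr; apply: eq_bigr => k _.
rewrite (Rintegral_gauss_cos _ _).2 /gauss_coef; congr (_ * (expR (- _) * _)).
by field; exact: lt0r_neq0.
Qed.

(** From |exp (- A) - exp (- B)| <= |A - B| exp (- min A B), with both exponents at least s u^2 / 2
    - s / 4. Half of the decay absorbs the factor |2 u + x| coming from A - B; the other half, exp
    (- s u^2 / 4), stays summable over a lattice in u. *)
Lemma gauss_lipschitz : exists2 L : R, 0 < L & forall u x : R, `|x| <= 2^-1 ->
  `|expR (- (s * (u + x) ^+ 2)) - expR (- (s * u ^+ 2))| <= L * `|x| * expR (- (s / 4 * u ^+ 2)).
Proof.
have expB (a b m : R) : m <= a -> m <= b -> `|expR (- a) - expR (- b)| <= `|a - b| * expR (- m).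
  have oneside (a' b' : R) : m <= a' -> expR (- a') - expR (- b') <= `|a' - b'| * expR (- m).
    move=> ma; apply: (@le_trans _ _ (`|a' - b'| * expR (- a'))); last first.
      by rewrite ler_wpM2l// ler_expR lerN2.
    have -> : expR (- b') = expR (- a') * expR (a' - b') by rewrite -expRD; congr expR; ring.
    have := expR_ge1Dx (a' - b'); have := expR_gt0 (- a').
    have : - `|a' - b'| <= a' - b' by rewrite lerNl -normrN ler_norm.
    move: (expR (- a')) (expR (a' - b')) (a' - b') `|a' - b'| => e f d nd; nra.
  move=> ma mb; rewrite ler_norml; apply/andP; split.
    by rewrite lerNl opprB distrC; exact: oneside.
  exact: oneside.
exists (s * (2 + 4 / s) * expR (s / 4)) => [|u x hx].
  by rewrite !mulr_gt0 ?expR_gt0// addr_gt0// divr_gt0.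
have /andP[x1 x2] : - 2^-1 <= x <= 2^-1 by rewrite -ler_norml.
have m1 : s * (u ^+ 2 / 2) - s / 4 <= s * (u + x) ^+ 2.
  have h1 : 0 <= s * (4^-1 - x ^+ 2) by rewrite mulr_ge0 ?(ltW s0)//; nra.
  have h2 : 0 <= s * (u / 2 + x) ^+ 2 by rewrite mulr_ge0 ?sqr_ge0// ltW.
  nra.
have m2 : s * (u ^+ 2 / 2) - s / 4 <= s * u ^+ 2.
  have h : 0 <= s * u ^+ 2 by rewrite mulr_ge0 ?sqr_ge0// ltW.
  by rewrite mulrA; move: h s0; set y := s * u ^+ 2; lra.
apply: le_trans (expB _ _ _ m1 m2) _.
have -> : s * (u + x) ^+ 2 - s * u ^+ 2 = s * (x * (2 * u + x)) by ring.
rewrite !normrM (gtr0_norm s0).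
set y := s / 4 * u ^+ 2; have y0 : 0 <= y by rewrite mulr_ge0 ?sqr_ge0// divr_ge0// ltW.
have ey : u ^+ 2 = 4 / s * y by rewrite /y; field; exact: lt0r_neq0.
have h1 : `|2 * u + x| <= 2 + u ^+ 2.
  by rewrite ler_norml; have := sqr_ge0 (u - 1); have := sqr_ge0 (u + 1); nra.
have h2 : expR (- y) <= 1 by rewrite -[leRHS]expR0 ler_expR oppr_le0.
have h3 : y * expR (- y) <= 1.
  have := expR_ge1Dx y; have := expR_gt0 (- y); have : expR y * expR (- y) = 1 by rewrite -expRD subrr expR0.
  move: (expR y) (expR (- y)) => e f; nra.
have -> : - (s * (u ^+ 2 / 2) - s / 4) = s / 4 + (- y + - y) by rewrite /y; field.
rewrite !expRD.
have h4 : `|2 * u + x| * expR (- y) <= 2 + 4 / s.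
  apply: (@le_trans _ _ ((2 + u ^+ 2) * expR (- y))); first by rewrite ler_pM2r ?expR_gt0.
  rewrite ey; have : 0 < 4 / s by rewrite divr_gt0.
  move: h2 h3; move: (4 / s) (expR (- y)) => c e; nra.
rewrite [leLHS](_ : _ = (s * `|x| * expR (s / 4) * expR (- y)) * (`|2 * u + x| * expR (- y))); last by ring.
rewrite [leRHS](_ : _ = (s * `|x| * expR (s / 4) * expR (- y)) * (2 + 4 / s)); last by ring.
by rewrite ler_wpM2l// !mulr_ge0 ?expR_ge0// ltW.
Qed.

(** The integral of the Gaussian against the Fejer kernel is cut into unit tiles. Periodicity and
    mass 1 of the kernel on a tile identify the lattice sum, and the error is at most B times the
    integral of |x| against the kernel on the central tile. *)
Lemma theta_fejer_cvg z : Num.sqrt (pi / s) * theta_fejer N z @[N --> \oo] --> theta z.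
Proof.
have [L L0 hL] := gauss_lipschitz.
have [q q0 hq] := @cos_quadratic R.
have s40 : 0 < s / 4 by rewrite divr_gt0.
pose B := L * gauss_sum_bound (s / 4).
have B0 : 0 <= B by rewrite mulr_ge0 ?gauss_sum_bound_ge0// ltW.
pose G (u : R) := expR (- (s * (u - z) ^+ 2)).
have mG : measurable_fun setT G.
  apply: measurableT_comp => //; apply: measurable_funN; apply: measurable_funM => //.
  by apply: measurable_funX; exact: measurable_funB.
have G1 u : `|G u| <= 1.
  rewrite ger0_norm ?expR_ge0// /G -[leRHS]expR0 ler_expR oppr_le0.
  by rewrite mulr_ge0 ?sqr_ge0// ltW.
have bound (N M : nat) (e : R) : 0 < e ->
  `|\sum_(k < M.*2.+1) \int[lam]_x (tile x * (G (k%:R - M%:R + x) * fejer N (k%:R - M%:R + x)))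
     - theta_box M z| <= B * (e / 2 + 2 / (e * q * N.+1%:R)).
  move=> e0.
  pose H (k : 'I_M.*2.+1) x := tile x * ((G (k%:R - M%:R + x) - G (k%:R - M%:R)) * fejer N x).
  have iH k : lam.-integrable setT (EFin \o H k).
    apply: (@integrable_tileM _ _ (2 * N.+1%:R)).
      apply: measurable_funM; last exact: measurable_fejer.
      apply: measurable_funB => //; apply: (measurableT_comp mG).
      exact: measurable_funD.
    move=> x; rewrite normrM ler_pM//; last exact: fejer_bounded.
    apply: le_trans (ler_normB _ _) _; have := G1 (k%:R - M%:R + x); have := G1 (k%:R - M%:R); lra.
  have [iS eS] := Rintegral_fin_sum (index_enum 'I_M.*2.+1) (fun k (_ : xpredT k) => iH k).
  have -> : \sum_(k < M.*2.+1) \int[lam]_x (tile x * (G (k%:R - M%:R + x) * fejer N (k%:R - M%:R + x)))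
     - theta_box M z = \int[lam]_x (\sum_(k < M.*2.+1) H k x).
    rewrite eS /theta_box -sumrB; apply: eq_bigr => k _.
    set a := expR _; have -> : a = \int[lam]_x (a * (tile x * fejer N x)).
      by rewrite RintegralZl ?integrable_tile_fejer// Rintegral_tile_fejer mulr1.
    rewrite -RintegralB//.
    - apply: eq_Rintegral => x _; rewrite /H fejerD /G /a; ring.
    - apply: (@integrable_tileM _ _ (1 * N.+1%:R)).
        apply: measurable_funM.
          by apply: (measurableT_comp mG); exact: measurable_funD.
        by apply: (measurableT_comp (measurable_fejer N)); exact: measurable_funD.
      by move=> x; rewrite normrM ler_pM// fejer_bounded.
    - by apply: integrable_scale; exact: integrable_tile_fejer.
  have Hle x : `|\sum_(k < M.*2.+1) H k x| <=
     B * (e / 2) * (tile x * fejer N x) + B * (2 / (e * q * N.+1%:R)) * tile x.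
    rewrite /H -mulr_sumr -mulr_suml normrM (ger0_norm (tile_ge0 x)).
    have [t0|xT] := eqVneq (tile x) 0; first by rewrite t0 !(mul0r, mulr0) addr0.
    have x2 : `|x| <= 2^-1.
      move: xT; rewrite tileE; case: (boolP (_ && _)) => [/andP[h1 h2] _|_]; last by rewrite eqxx.
      by rewrite ler_norml h1 ltW.
    have tp : 0 < tile x by rewrite lt_neqAle eq_sym xT tile_ge0.
    rewrite [leRHS](_ : _ = tile x * (B * (e / 2 * fejer N x + 2 / (e * q * N.+1%:R)))); last by ring.
    rewrite ler_pM2l// normrM (ger0_norm (fejer_ge0 N x)).
    have S : `|\sum_(k < M.*2.+1) (G (k%:R - M%:R + x) - G (k%:R - M%:R))| <= B * `|x|.
      apply: le_trans (ler_norm_sum _ _ _) _.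
      rewrite (_ : B * `|x| = L * `|x| * gauss_sum_bound (s / 4)); last by rewrite /B; ring.
      apply: (@le_trans _ _ (L * `|x| * \sum_(k < M.*2.+1) expR (- (s / 4 * (k%:R - (M%:R + z)) ^+ 2)))).
        rewrite mulr_sumr; apply: ler_sum => k _; rewrite /G.
        have := hL (k%:R - (M%:R + z)) x x2.
        rewrite (_ : k%:R - M%:R + x - z = k%:R - (M%:R + z) + x); last by ring.
        by rewrite (_ : k%:R - M%:R - z = k%:R - (M%:R + z)); last by ring.
      by rewrite ler_wpM2l ?gauss_sum_le// mulr_ge0// ltW.
    apply: le_trans (ler_wpM2r (fejer_ge0 N x) S) _.
    rewrite -[leLHS]mulrA ler_wpM2l//.
    have f0 := fejer_ge0 N x; have n0 : 0 < N.+1%:R :> R by [].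
    have h1 : q * x ^+ 2 * fejer N x <= 4 / N.+1%:R.
      by apply: le_trans (ler_wpM2r f0 (hq _ x2)) _; exact: fejer_le.
    have h2 : x ^+ 2 * fejer N x <= 4 / (q * N.+1%:R).
      rewrite -(ler_pM2l q0) mulrA (le_trans h1)// le_eqVlt; apply/orP; left; apply/eqP.
      move: n0; set nn : R := N.+1%:R => n0; clearbody nn.
      by field; rewrite (lt0r_neq0 n0) (lt0r_neq0 q0).
    (* Young's inequality trades the first moment of the kernel for the second, which h2 bounds by a
       multiple of 1 / (N + 1). *)
    have h3 : `|x| <= e / 2 + x ^+ 2 / (2 * e).
      rewrite -(real_normK (num_real x)) -(ler_pM2l (mulr_gt0 (ltr0n R 2) e0)).
      rewrite (_ : 2 * e * (e / 2 + _) = e ^+ 2 + `|x| ^+ 2).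
        by have := sqr_ge0 (e - `|x|); nra.
      by field; exact: lt0r_neq0.
    apply: le_trans (ler_wpM2r f0 h3) _; rewrite mulrDl lerD2l.
    rewrite mulrAC.
    apply: (@le_trans _ _ ((4 / (q * N.+1%:R)) / (2 * e))).
      by rewrite ler_pM2r ?invr_gt0 ?mulr_gt0.
    rewrite le_eqVlt; apply/orP; left; apply/eqP.
    move: n0; set nn : R := N.+1%:R => n0; clearbody nn.
    by field; rewrite (lt0r_neq0 n0) (lt0r_neq0 q0) (lt0r_neq0 e0).
  apply: le_trans (le_normr_Rintegral measurableT iS) _.
  have i1 : lam.-integrable setT (EFin \o (fun x => B * (e / 2) * (tile x * fejer N x))).
    by apply: integrable_scale; exact: integrable_tile_fejer.
  have i2 : lam.-integrable setT (EFin \o (fun x => B * (2 / (e * q * N.+1%:R)) * tile x)).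
    by apply: integrable_scale; exact: integrable_tile.
  have := le_Rintegral measurableT (integrable_norm iS) (integrableD measurableT i1 i2) (fun x _ => Hle x).
  move=> /le_trans; apply; rewrite RintegralD// !RintegralZl ?integrable_tile_fejer ?integrable_tile//.
  rewrite Rintegral_tile_fejer.
  rewrite (_ : \int[lam]_x tile x = 1); last first.
    apply: etrans (Rintegral_tile_cos 0 0); apply: eq_Rintegral => x _.
    by rewrite subrr mulr0 mul0r cos0 mulr1.
  by rewrite !mulr1 mulrDr.
have bound2 (N : nat) (e : R) : 0 < e ->
  `|Num.sqrt (pi / s) * theta_fejer N z - theta z| <= B * (e / 2 + 2 / (e * q * N.+1%:R)).
  move=> e0; have [iT eT] := theta_fejerE N z.
  have c1 := Rintegral_tiles iT; rewrite eT in c1.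
  have c3 : theta_box ^~ z @ \oo --> theta z by exact: theta_box_cvg.
  have c2 := @cvg_norm _ _ _ _ eventually_filter _ _ (@cvgB _ _ _ _ eventually_filter _ _ _ _ c1 c3).
  rewrite -(cvg_lim _ c2)//; apply: limr_le; first by apply/cvg_ex; eexists; exact: c2.
  by apply: nearW => M; exact: bound.
apply/cvgrPdist_le => /= e e0.
pose e' : R := e / (B + 1).
have B1 : 0 < B + 1 by rewrite ltr_wpDl.
have e'0 : 0 < e' by rewrite divr_gt0.
have e'E : B * e' <= e.
  rewrite /e' mulrCA ler_piMr ?(ltW e0)// ler_pdivrMr// mul1r; lra.
clearbody e'.
near=> N; rewrite distrC; apply: le_trans (bound2 N _ e'0) _.
have n0 : 0 < N.+1%:R :> R by [].
have hN : 4 / (e' * (e' * q)) <= N.+1%:R.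
  apply: (@le_trans _ _ N%:R); last by rewrite ler_nat.
  by near: N; exact: nbhs_infty_ger.
have h : 2 / (e' * q * N.+1%:R) <= e' / 2.
  rewrite ler_pdivrMr ?mulr_gt0//; move: hN; rewrite ler_pdivrMr ?mulr_gt0//.
  rewrite (_ : e' / 2 * (e' * q * N.+1%:R) = (N.+1%:R * (e' * (e' * q))) / 2); last by ring.
  by move: (N.+1%:R * _) => v; lra.
apply: (@le_trans _ _ (B * e')); first by rewrite ler_wpM2l// [leRHS]splitr lerD2l.
exact: e'E.
Unshelve. all: end_near. Qed.

(** The coefficient of index 1. Since d^2 >= d for natural d, its powers dominate the other
    coefficients geometrically. *)
Definition theta_ratio : R := expR (- (pi ^+ 2 / s)).

Lemma theta_ratio_itv : 0 <= theta_ratio < 1.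
Proof. by apply: expRN_itv; rewrite divr_gt0// exprn_gt0// pi_gt0. Qed.

Lemma gauss_coef_le (j k : nat) : gauss_coef (j%:R - k%:R) <= theta_ratio ^+ ((k - j) + (j - k)).
Proof.
rewrite -expRM_natl ler_expR mulrN lerN2.
have pp : 0 < pi ^+ 2 / s :> R by rewrite divr_gt0// exprn_gt0// pi_gt0.
rewrite (_ : pi ^+ 2 * (j%:R - k%:R) ^+ 2 / s = pi ^+ 2 / s * (j%:R - k%:R) ^+ 2); last by rewrite mulrAC.
rewrite [leLHS]mulrC ler_pM2l//.
have sq (i : nat) : i%:R <= i%:R ^+ 2 :> R.
  by rewrite -natrX ler_nat; case: i => // i; rewrite leq_pmulr.
have [jk|kj] := leqP j k.
  by rewrite (eqP (_ : j - k == 0)%N) ?subn_eq0// addn0 -sqrrN opprB -natrB.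
by rewrite (eqP (_ : k - j == 0)%N) ?subn_eq0 1?ltnW// add0n -natrB// ltnW.
Qed.

Lemma gauss_coef_sum N : N.+1%:R^-1 * \sum_(j < N.+1) \sum_(k < N.+1) gauss_coef (j%:R - k%:R)
  <= (1 + theta_ratio) / (1 - theta_ratio).
Proof.
rewrite mulrC ler_pdivrMr//.
apply: (@le_trans _ _ (\sum_(j < N.+1) (1 + theta_ratio) / (1 - theta_ratio))); last first.
  by rewrite sumr_const card_ord mulr_natr.
apply: ler_sum => j _; apply: le_trans (geometric_sum_dist N.+1 j theta_ratio_itv).
by apply: ler_sum => k _; exact: gauss_coef_le.
Qed.

Lemma theta_fejer_le N z : `|theta_fejer N z| <= (1 + theta_ratio) / (1 - theta_ratio).
Proof.
apply: le_trans (gauss_coef_sum N); rewrite /theta_fejer normrM ger0_norm ?invr_ge0//.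
rewrite ler_wpM2l ?invr_ge0//; apply: le_trans (ler_norm_sum _ _ _) _.
apply: ler_sum => j _; apply: le_trans (ler_norm_sum _ _ _) _.
apply: ler_sum => k _; rewrite normrM ger0_norm ?expR_ge0// ler_piMr ?expR_ge0//.
exact: cos_max.
Qed.

End poisson.

(** * Sampling in a Gaussian window *)

Section sampling.
Context {R : realType} {n : nat}.
Local Notation mun := (@lebesgue_measure_n R n).
Local Notation E := (euclidean R n).
Local Notation mun2 := (mun \x mun)%E.
Local Notation z0 := ([tuple 0 | j < n] : E).
Implicit Types f : E -> R[i].

(** The packet freed from its index: frequency and spacing are arbitrary, so that one frequency can
    be studied at a time. *)
Definition wpacket (xi : E) (a : R) (alpha : n.-tuple int) (x : E) : R[i] :=
  let y := subv x [tuple a * (tnth alpha j)%:~R | j < n] in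
  ((normv xi * a / (2 * pi)) `^ (n%:R / 2))%:C *
  expC ('i%C * (dotv xi y)%:C - (normv xi * normv y ^+ 2)%:C).

(** Coordinates of the midpoint measured in lattice steps, so that the lattice becomes the
    integers. *)
Definition midpoint (a : R) (z : E * E) (j : 'I_n) : R :=
  (tnth z.1 j + tnth z.2 j) / (2 * a).

Lemma measurable_midpoint a j : measurable_fun setT (fun z => midpoint a z j).
Proof.
apply: measurable_funM => //; apply: measurable_funD.
  exact: (measurableT_comp (measurable_tnth j) measurable_fst).
exact: (measurableT_comp (measurable_tnth j) measurable_snd).
Qed.

Variables (xi : E) (a : R).
Hypotheses (l0 : 0 < normv xi) (a0 : 0 < a).
Local Notation l := (normv xi).
Local Notation s := (2 * l * a ^+ 2).
Local Notation mid := (midpoint a).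
Local Notation w2 := ((l * a / (2 * pi)) ^+ n).

Let s0 : 0 < s. Proof. by rewrite !mulr_gt0// exprn_gt0. Qed.

Lemma packet_weight_sqr : ((l * a / (2 * pi)) `^ (n%:R / 2)) ^+ 2 = w2.
Proof.
rewrite -powR_mulrn ?powR_ge0// -powRrM divfK// powR_mulrn//.
by rewrite divr_ge0 ?mulr_ge0 ?pi_ge0// ltW.
Qed.

(** Parallelogram law: l |x - c|^2 + l |y - c|^2 = (l / 2) |x - y|^2 + 2 l |c - (x + y) / 2|^2. The
    first part is the kernel; the second, in lattice steps, has the parameter s = 2 l a^2. The
    phases of c cancel. *)
Lemma wpacket_prod alpha x y :
  ((wpacket xi a alpha x)^*)%C * wpacket xi a alpha y =
  w2%:C * (kernel l xi z0 z0 x y *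
    (\prod_(j < n) expR (- (s * ((tnth alpha j)%:~R - mid (x, y) j) ^+ 2)))%:C).
Proof.
rewrite -packet_weight_sqr /wpacket; set w := (_ `^ _).
set c : E := [tuple _ | j < n].
rewrite conjcM expCJ; have -> : ((w%:C)^*)%C = w%:C by apply: complex_ext => /=; rewrite ?oppr0.
rewrite -expR_sum -expC_real /kernel.
rewrite [LHS](_ : _ = (w%:C * w%:C) * (expC ('i%C * (dotv xi (subv x c))%:C - (l * normv (subv x c) ^+ 2)%:C)^*%C * expC ('i%C * (dotv xi (subv y c))%:C - (l * normv (subv y c) ^+ 2)%:C))); last by ring.
rewrite -realCM -expr2 -!expCD; congr (_ * expC _).
apply: complex_ext; rewrite !(ReD, ImD, ReJ, ImJ, ReN, ImN, ReM, ImM)/=; last first.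
  by rewrite !(dotv_subr, dotv_subl) !dotv0 (dotvC x xi) (dotvC y xi); ring.
rewrite [LHS](_ : _ = - (l * normv (subv x c) ^+ 2 + l * normv (subv y c) ^+ 2)); last by ring.
rewrite !normv_sqrE !mulr_sumr.
rewrite -big_split/= -!sumrN -big_split/=; apply: eq_bigr => j _.
rewrite !tnth_mktuple /midpoint/=; field; exact: lt0r_neq0.
Qed.

Lemma cmeas_wpacket alpha : cmeas (wpacket xi a alpha).
Proof.
apply: cmeasM; first exact: cmeas_cst.
have ms (c : E) : measurable_fun setT (fun x : E => subv x c) by exact: measurable_subv.
apply: cmeas_expC; apply: cmeasB.
  by apply: cmeasM; [exact: cmeas_cst|apply: cmeas_re; exact: measurable_dotv].
by apply: cmeas_re; apply: measurable_funM => //; exact: measurable_normv2.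
Qed.

Lemma normc_wpacket alpha x : normc (wpacket xi a alpha x) =
  (l * a / (2 * pi)) `^ (n%:R / 2) *
  expR (- (l * normv (subv x [tuple a * (tnth alpha j)%:~R | j < n]) ^+ 2)).
Proof.
rewrite /wpacket normcM normc_re ger0_norm ?powR_ge0// normc_expC.
by congr (_ * expR _); rewrite !(ReB, ReM)/=; ring.
Qed.

Lemma innerL2_cint f g : innerL2 f g = cint mun (fun x => (g x)^*%C * f x).
Proof. by []. Qed.

Let K0 f (z : E * E) : R[i] := f z.1 * (f z.2)^*%C * kernel l xi z0 z0 z.1 z.2.

Lemma cintegrable_K0 f (h : E * E -> R) (c : R) : cintegrable mun f ->
  measurable_fun setT h -> (forall z, `|h z| <= c) ->
  cintegrable mun2 (fun z => K0 f z * (h z)%:C).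
Proof.
move=> iF mh hc; apply: (cintegrable_bddM (c := c)); first exact: cmeas_re.
  by move=> z; rewrite normc_re.
apply: (cintegrable_bddM (cmeas_kernel l xi z0 z0)) (cintegrable_tensor iF).
by move=> z; exact: normc_kernel_le1.
Qed.

Lemma prod_norm_le (F : 'I_n -> R) (c : R) : (forall j, `|F j| <= c) ->
  `|\prod_(j < n) F j| <= c ^+ n.
Proof.
move=> Fc; rewrite normr_prod -[X in _ ^+ X]card_ord -prodr_const.
by apply: ler_prod => j _; rewrite normr_ge0/=.
Qed.

Lemma coef_sqr f alpha : cintegrable mun f ->
  (normc (innerL2 f (wpacket xi a alpha)) ^+ 2)%:C =
  w2%:C * cint mun2 (fun z => K0 f z *
    (\prod_(j < n) expR (- (s * ((tnth alpha j)%:~R - mid z j) ^+ 2)))%:C).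
Proof.
move=> iF; rewrite normc_sqrJ innerL2_cint.
have ig : cintegrable mun (fun x => (wpacket xi a alpha x)^*%C * f x).
  rewrite (_ : (fun x => _) = fun x => f x * (wpacket xi a alpha x)^*%C); last first.
    by apply/funext => x; rewrite mulrC.
  apply: (cintegrable_bddM (c := (l * a / (2 * pi)) `^ (n%:R / 2))) => //.
    by apply: cmeasJ; exact: cmeas_wpacket.
  move=> x; rewrite normcJ normc_wpacket ler_piMr ?powR_ge0//.
  by rewrite -[leRHS]expR0 ler_expR oppr_le0 mulr_ge0 ?sqr_ge0// ltW.
rewrite -cintJ//; have [_ <-] := cint_mul ig (cintegrableJ ig).
rewrite -cintZ; last first.
  apply: (@cintegrable_K0 _ _ (1 ^+ n)) => //.
    apply: measurable_prod => j _; apply: measurableT_comp => //; apply: measurable_funN.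
    apply: measurable_funM => //; apply: measurable_funX; apply: measurable_funB => //.
    exact: measurable_midpoint.
  move=> z; apply: prod_norm_le => j; rewrite ger0_norm ?expR_ge0//.
  by rewrite -[leRHS]expR0 ler_expR oppr_le0 mulr_ge0 ?sqr_ge0// ltW.
apply: eq_cint => -[x y]; rewrite [(x, y).1]/= [(x, y).2]/= (conjcM (wpacket xi a alpha y)^*%C).
have -> : (((wpacket xi a alpha y)^*)%C^*)%C = wpacket xi a alpha y.
  by apply: complex_ext; rewrite ?ReJ ?ImJ ?opprK.
rewrite [LHS](_ : _ = ((wpacket xi a alpha x)^*%C * wpacket xi a alpha y) * (f x * (f y)^*%C)); last by ring.
by rewrite wpacket_prod /K0 [(x, y).1]/= [(x, y).2]/=; ring.
Qed.

(** The cube [-M, M]^n of lattice points, coded by finite functions so that a sum over the cube of a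
    product over coordinates becomes a product of sums. *)
Definition boxpt M (A : {ffun 'I_n -> 'I_M.*2.+1}) : n.-tuple int :=
  [tuple (A j : nat)%:Z - M%:Z | j < n].

Definition box_energy f M : R :=
  \sum_(A : {ffun 'I_n -> 'I_M.*2.+1}) normc (innerL2 f (wpacket xi a (boxpt A))) ^+ 2.

Lemma measurable_theta_box M : measurable_fun setT (theta_box s M).
Proof.
apply: measurable_sum => k; apply: measurableT_comp => //; apply: measurable_funN.
by apply: measurable_funM => //; apply: measurable_funX; apply: measurable_funB.
Qed.

Lemma measurable_theta_fejer N : measurable_fun setT (theta_fejer s N).
Proof.
apply: measurable_funM => //; apply: measurable_sum => j; apply: measurable_sum => k.
apply: measurable_funM => //; apply: measurableT_comp; first exact: continuous_measurable_fun (@continuous_cos R).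
exact: measurable_funM.
Qed.

Lemma box_energyE f M : cintegrable mun f -> (box_energy f M)%:C =
  w2%:C * cint mun2 (fun z => K0 f z * (\prod_(j < n) theta_box s M (mid z j))%:C).
Proof.
move=> iF; rewrite /box_energy raddf_sum/=.
under eq_bigr do rewrite coef_sqr//.
rewrite -mulr_sumr -cint_sum; last first.
  move=> A _; apply: (@cintegrable_K0 _ _ (1 ^+ n)) => //.
    apply: measurable_prod => j _; apply: measurableT_comp => //; apply: measurable_funN.
    apply: measurable_funM => //; apply: measurable_funX; apply: measurable_funB => //.
    exact: measurable_midpoint.
  move=> z; apply: prod_norm_le => j; rewrite ger0_norm ?expR_ge0//.
  by rewrite -[leRHS]expR0 ler_expR oppr_le0 mulr_ge0 ?sqr_ge0// ltW.
congr (_ * _); apply: eq_cint => z; rewrite -mulr_sumr; congr (_ * _).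
rewrite bigA_distr_bigA raddf_sum/=; apply: eq_bigr => A _; congr (_%:C).
by apply: eq_bigr => j _; rewrite tnth_mktuple rmorphB.
Qed.

(* The sum of [normc (innerL2 f (wpacket xi a alpha)) ^+ 2] over all [alpha]: the
   lattice sum of the product of two Gaussians centred at [a * alpha] is a Gaussian in
   [x - y] times a theta function of the midpoint. *)
Definition sampling_limit f : R :=
  w2 * complex.Re (cint mun2 (fun z => K0 f z * (\prod_(j < n) theta s (mid z j))%:C)).

(** Kept general because two sequences converge to the same [theta]: the box sums, which give the
    coefficients, and the Fejer means, which give the spectral side. *)
Lemma K0_limit f (h : nat -> R -> R) (c : R) (k : R -> R) : cintegrable mun f ->
  (forall N, measurable_fun setT (h N)) -> (forall N z, `|h N z| <= c) ->
  (forall z, h ^~ z @ \oo --> k z) ->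
  complex.Re (cint mun2 (fun z => K0 f z * (\prod_(j < n) h N (mid z j))%:C)) @[N --> \oo] -->
  complex.Re (cint mun2 (fun z => K0 f z * (\prod_(j < n) k (mid z j))%:C)).
Proof.
move=> iF mh hc hk.
have iK : cintegrable mun2 (K0 f).
  rewrite (_ : K0 f = fun z => K0 f z * (1 : R)%:C); last by apply/funext => z; rewrite mulr1.
  by apply: (@cintegrable_K0 _ (fun=> 1) 1) => // z; rewrite normr1.
have ph z : (\prod_(j < n) h N (mid z j)) @[N --> \oo] --> \prod_(j < n) k (mid z j).
  elim: (index_enum _) => [|j r IH].
    by rewrite big_nil; under eq_cvg do rewrite big_nil; exact: cvg_cst.
  by rewrite big_cons; under eq_cvg do rewrite big_cons; exact: cvgM.
have mK := cintegrable_meas iK.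
have mp N : measurable_fun setT (fun z => \prod_(j < n) h N (mid z j)).
  apply: measurable_prod => j _; apply: (measurableT_comp (mh N)).
  exact: measurable_midpoint.
have [|z|z||N z|_ + _] := @cint_dct _ _ _ mun2 (fun N z => K0 f z * (\prod_(j < n) h N (mid z j))%:C)
   (fun z => K0 f z * (\prod_(j < n) k (mid z j))%:C)
   (fun z => c ^+ n * normc (K0 f z)).
- by move=> N; apply: cmeasM => //; apply: cmeas_re; exact: mp.
- by rewrite ReM /= mulr0 subr0; under eq_cvg do rewrite ReM /= mulr0 subr0; apply: cvgMr.
- by rewrite ImM /= mulr0 add0r; under eq_cvg do rewrite ImM /= mulr0 add0r; apply: cvgMr.
- by apply: integrable_scale; have [] := (cintegrableP _ _).1 iK.
- by rewrite normcM normc_re mulrC ler_wpM2r ?normc_ge0//; exact: prod_norm_le.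
- exact.
Qed.

Lemma box_energy_cvg f : cintegrable mun f -> box_energy f M @[M --> \oo] --> sampling_limit f.
Proof.
move=> iF; rewrite (_ : box_energy f = fun M => w2 * complex.Re (cint mun2 (fun z => K0 f z * (\prod_(j < n) theta_box s M (mid z j))%:C))).
  apply: cvgMr; apply: (@K0_limit _ _ (gauss_sum_bound s)) => //.
  - exact: measurable_theta_box.
  - by move=> M z; rewrite ger0_norm ?theta_box_ge0//; exact: theta_box_le.
  - by move=> z; exact: theta_box_cvg.
by apply/funext => M; have := congr1 (@complex.Re R) (box_energyE M iF); rewrite ReM/= mul0r subr0.
Qed.

(* Replacing [theta] by its Fejer means turns the Poisson summation formula into
   finite sums, with no convergence of Fourier series to be discussed. *)
Definition fejer_energy f N : R :=
  w2 * complex.Re (cint mun2 (fun z => K0 f z * (\prod_(j < n) (Num.sqrt (pi / s) * theta_fejer s N (mid z j)))%:C)).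

Lemma fejer_energy_cvg f : cintegrable mun f -> fejer_energy f N @[N --> \oo] --> sampling_limit f.
Proof.
move=> iF; apply: cvgMr.
apply: (@K0_limit _ (fun N z => Num.sqrt (pi / s) * theta_fejer s N z)
  (Num.sqrt (pi / s) * ((1 + theta_ratio s) / (1 - theta_ratio s)))) => //.
- by move=> N; apply: measurable_funM => //; exact: measurable_theta_fejer.
- move=> N z; rewrite normrM ger0_norm ?sqrtr_ge0// ler_wpM2l ?sqrtr_ge0//.
  exact: theta_fejer_le.
- by move=> z; exact: theta_fejer_cvg.
Qed.

(** The vector of the dual lattice carried by one term of the product of Fejer means. *)
Definition shiftv N (P : {ffun 'I_n -> 'I_N.+1 * 'I_N.+1}) : E :=
  [tuple (2 * pi * ((P j).1%:R - (P j).2%:R)) / a | j < n].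

Definition fejer_weight (t : R) N (P : {ffun 'I_n -> 'I_N.+1 * 'I_N.+1}) : R :=
  \prod_(j < n) (N.+1%:R^-1 * gauss_coef t ((P j).1%:R - (P j).2%:R)).

(** The sine terms cancel because exchanging the two indices changes their sign and keeps the
    coefficient. *)
Lemma theta_fejer_complex N z : (theta_fejer s N z)%:C =
  \sum_(p : 'I_N.+1 * 'I_N.+1) (N.+1%:R^-1 * gauss_coef s (p.1%:R - p.2%:R))%:C *
    expC (0 +i* (2 * pi * (p.1%:R - p.2%:R) * z)).
Proof.
pose D (j k : 'I_N.+1) : R := 2 * pi * (j%:R - k%:R) * z.
pose g (j k : 'I_N.+1) : R := N.+1%:R^-1 * gauss_coef s (j%:R - k%:R).
have E' (p : 'I_N.+1 * 'I_N.+1) : (N.+1%:R^-1 * gauss_coef s (p.1%:R - p.2%:R))%:C *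
    expC (0 +i* (2 * pi * (p.1%:R - p.2%:R) * z)) =
  (g p.1 p.2 * cos (D p.1 p.2)) +i* (g p.1 p.2 * sin (D p.1 p.2)).
  rewrite -/(g p.1 p.2) -/(D p.1 p.2); move: (g p.1 p.2) (D p.1 p.2) => x y.
  by rewrite /expC; apply: complex_ext; rewrite !(ReM, ImM)/= expR0; ring.
under eq_bigr do rewrite E'.
apply: complex_ext; rewrite ?Re_sum ?(big_morph _ (@ImD R) (erefl : complex.Im 0 = 0))/=.
  rewrite -(pair_big xpredT xpredT (fun j k => g j k * cos (D j k)))/=.
  rewrite /theta_fejer mulr_sumr; apply: eq_bigr => j _.
  by rewrite mulr_sumr; apply: eq_bigr => k _; rewrite mulrA.
rewrite -(pair_big xpredT xpredT (fun j k => g j k * sin (D j k)))/=.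
have : \sum_j \sum_k g j k * sin (D j k) = - (\sum_j \sum_k g j k * sin (D j k)).
  rewrite {1}exchange_big -sumrN; apply: eq_bigr => j _; rewrite -sumrN; apply: eq_bigr => k _.
  rewrite -mulrN -sinN; congr (_ * sin _); last by rewrite /D; ring.
  by rewrite /g /gauss_coef -(sqrrN (k%:R - j%:R)) opprB.
by move=> e; lra.
Qed.

(** The normalisation of the packet, the Poisson factor and the Gaussian factor of the kernel
    identity combine into a constant free of xi and a. This is what allows frame bounds uniform over
    all scales. *)
Lemma sampling_const : w2 * Num.sqrt (pi / s) ^+ n / Num.sqrt (2 * pi * l) ^+ n = (4 * pi) ^- n :> R.
Proof.
have p0 := @pi_gt0 R.
have q0 : 0 < 2 * pi * l by rewrite !mulr_gt0.
rewrite -exprMn -exprVn -exprMn -exprVn; congr (_ ^+ n).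
have -> : Num.sqrt (pi / s) = Num.sqrt (2 * pi * l) / (2 * l * a).
  have d0 : 0 <= Num.sqrt (2 * pi * l) / (2 * l * a).
    by rewrite divr_ge0 ?sqrtr_ge0// !mulr_ge0// ltW.
  rewrite -(ger0_norm d0) -sqrtr_sqr; congr Num.sqrt.
  rewrite expr_div_n sqr_sqrtr ?(ltW q0)//; field.
  by rewrite (lt0r_neq0 a0) (lt0r_neq0 l0).
have : Num.sqrt (2 * pi * l) != 0 by rewrite gt_eqF// sqrtr_gt0.
move: (Num.sqrt _) => r r0; move: (pi : R) p0 => p p0; field.
by rewrite (lt0r_neq0 a0) (lt0r_neq0 l0) (lt0r_neq0 p0) r0.
Qed.

(** The phase t . (x + y) / 2 of a term is shared equally between x and y, which gives the shifts -
    t / 2 and t / 2 in the kernel. *)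
Lemma fejer_integrand f N (z : E * E) :
  K0 f z * (\prod_(j < n) (Num.sqrt (pi / s) * theta_fejer s N (mid z j)))%:C =
  (Num.sqrt (pi / s) ^+ n)%:C * \sum_(P : {ffun 'I_n -> 'I_N.+1 * 'I_N.+1})
    (fejer_weight s P)%:C * (f z.1 * (f z.2)^*%C *
      kernel l xi (scalev (- 2^-1) (shiftv P)) (scalev 2^-1 (shiftv P)) z.1 z.2).
Proof.
rewrite big_split/= prodr_const card_ord realCM mulrCA; congr (_ * _).
rewrite rmorph_prod/=; under eq_bigr do rewrite theta_fejer_complex.
rewrite bigA_distr_bigA mulr_sumr; apply: eq_bigr => P _.
rewrite big_split/= -rmorph_prod/= -expC_sum -/(fejer_weight s P).
rewrite mulrCA; congr (_ * _); rewrite /K0 -(mulrA (f z.1 * (f z.2)^*%C)); congr (_ * _).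
rewrite -expCD; congr expC; apply: complex_ext.
  by rewrite ReD Re_sum/= big1 ?addr0.
rewrite ImD (big_morph _ (@ImD R) (erefl : complex.Im 0 = 0))/= !dotv0.
rewrite !dotv_scalel.
have -> : \sum_(j < n) 2 * pi * ((P j).1%:R - (P j).2%:R) * mid z j =
   2^-1 * dotv (shiftv P) z.1 + 2^-1 * dotv (shiftv P) z.2.
  rewrite -mulrDr /dotv -big_split mulr_sumr; apply: eq_bigr => j _ /=.
  by rewrite tnth_mktuple /midpoint; field; exact: lt0r_neq0.
ring.
Qed.

Lemma fejer_energyE f N : cintegrable mun f -> fejer_energy f N =
  (4 * pi) ^- n * \sum_(P : {ffun 'I_n -> 'I_N.+1 * 'I_N.+1})
    fejer_weight s P * complex.Re (cint mun (fun eta => (gaussW l xi eta)%:C *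
      (fourierL1 f (affv 1 (scalev (- 2^-1) (shiftv P)) eta) *
       ((fourierL1 f (affv 1 (scalev 2^-1 (shiftv P)) eta))^*)%C))).
Proof.
move=> iF; rewrite /fejer_energy.
have ik p q : cintegrable mun2 (fun z => f z.1 * (f z.2)^*%C * kernel l xi p q z.1 z.2).
  apply: (cintegrable_bddM (cmeas_kernel l xi p q)) (cintegrable_tensor iF).
  by move=> z; exact: normc_kernel_le1.
have -> : cint mun2 (fun z => K0 f z * (\prod_(j < n) (Num.sqrt (pi / s) * theta_fejer s N (mid z j)))%:C) =
  (Num.sqrt (pi / s) ^+ n)%:C * \sum_(P : {ffun 'I_n -> 'I_N.+1 * 'I_N.+1})
    (fejer_weight s P)%:C * cint mun2 (fun z => f z.1 * (f z.2)^*%C *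
      kernel l xi (scalev (- 2^-1) (shiftv P)) (scalev 2^-1 (shiftv P)) z.1 z.2).
  rewrite (eq_cint _ (fejer_integrand f N)) cintZ; last first.
    by apply: cintegrable_sum => P _; exact: cintegrableZ.
  by congr (_ * _); rewrite cint_sum => [|P _]; [apply: eq_bigr => P _; exact: cintZ|exact: cintegrableZ].
have ReZ (c : R) (w : R[i]) : complex.Re (c%:C * w) = c * complex.Re w.
  by rewrite ReM/= mul0r subr0.
rewrite -sampling_const ReZ mulrA -[RHS]mulrA; congr (_ * _).
rewrite Re_sum mulr_sumr; apply: eq_bigr => P _.
rewrite ReZ [RHS]mulrCA; congr (_ * _).
rewrite kernel_identity// ReZ mulKf//.
by rewrite expf_neq0// gt_eqF// sqrtr_gt0 !mulr_gt0// pi_gt0.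
Qed.

End sampling.

(** * Window energies and the cross terms of the Poisson formula *)

Section window_energy.
Context {R : realType} {n : nat}.
Local Notation mun := (@lebesgue_measure_n R n).
Local Notation E := (euclidean R n).
Implicit Types f : E -> R[i].

Definition window_energy (l : R) (xi : E) f : R :=
  \int[mun]_eta (gaussW l xi eta * normc (fourierL1 f eta) ^+ 2).

Lemma gaussW_ge0 l (xi eta : E) : 0 <= gaussW l xi eta.
Proof. exact: expR_ge0. Qed.

Lemma measurable_gaussW l (xi : E) : measurable_fun setT (gaussW l xi).
Proof.
apply: measurableT_comp => //; apply: measurable_funN; apply: measurable_funM => //.
by apply: measurable_normv2; exact: measurable_subv.
Qed.

Lemma integrable_windowM (g : E -> R) (M l : R) xi p : 0 < l -> measurable_fun setT g ->
  (forall u, 0 <= g u <= M) ->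
  mun.-integrable setT (EFin \o (fun eta => gaussW l xi eta * g (affv 1 p eta))).
Proof.
move=> l0 mg gM.
have b0 : 0 < (2 * l)^-1 by rewrite invr_gt0 mulr_gt0.
have [ig _] := integrable_gaussn xi b0.
apply: (le_integrable measurableT _ _ (integrable_scale M ig)).
  apply/measurable_EFinP; apply: measurable_funM; first exact: measurable_gaussW.
  by apply: (measurableT_comp mg); exact: measurable_affv.
move=> eta _ /=; rewrite -/(gaussW l xi eta) lee_fin; have g0 := gaussW_ge0 l xi eta.
have /andP[h0 hM] := gM (affv 1 p eta).
rewrite !normrM (ger0_norm g0) (ger0_norm h0) ger0_norm ?(le_trans h0)//.
by rewrite mulrC ler_wpM2r.
Qed.

(** Completing the square: with v = u - xi and c^2 = 1 / 4, the difference of the exponents is,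
    coordinate by coordinate, a positive multiple of (2 t - 6 c v)^2. The constants 8, 12 and 4 are
    matched to make it an exact square. *)
Lemma gaussW_shift_le (l c : R) (xi t u : E) : 0 < l -> c ^+ 2 = 4^-1 ->
  expR (- (normv t ^+ 2 / (8 * l))) * gaussW l xi (affv 1 (scalev (- c) t) u) <=
  expR (- (normv t ^+ 2 / (12 * l))) * gaussW (4 * l) xi u.
Proof.
move=> l0 c2; rewrite /gaussW -!expRD ler_expR -!opprD lerN2.
pose k := (24 * l)^-1; have k0 : 0 < k by rewrite invr_gt0 mulr_gt0.
have l1 := lt0r_neq0 l0.
have e1 x : x / (12 * l) = k * (2 * x) by rewrite /k; field.
have e2 x : x / (8 * l) = k * (3 * x) by rewrite /k; field.
have e3 x : (2 * l)^-1 * x = k * (12 * x) by rewrite /k; field.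
have e4 x : (2 * (4 * l))^-1 * x = k * (3 * x) by rewrite /k; field.
rewrite e1 e2 e3 e4 -!mulrDr ler_pM2l//.
rewrite !normv_sqrE !mulr_sumr -!big_split/=; apply: ler_sum => j _.
rewrite !tnth_mktuple mul1r.
set T := tnth t j; set U := tnth u j; set X := tnth xi j.
have := sqr_ge0 (2 * T - 6 * c * (U - X)).
have -> : (2 * T - 6 * c * (U - X)) ^+ 2 =
  4 * T ^+ 2 - 24 * (c * T * (U - X)) + 36 * c ^+ 2 * (U - X) ^+ 2 by ring.
have -> : (- c * T + U - X) ^+ 2 = c ^+ 2 * T ^+ 2 - 2 * (c * T * (U - X)) + (U - X) ^+ 2 by ring.
rewrite c2; move: (c * T * (U - X)) (T ^+ 2) ((U - X) ^+ 2) => p q r; lra.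
Qed.

Lemma shifted_window_le (g : E -> R) (M l c : R) (xi t : E) : 0 < l -> c ^+ 2 = 4^-1 ->
  measurable_fun setT g -> (forall u, 0 <= g u <= M) ->
  expR (- (normv t ^+ 2 / (8 * l))) *
    \int[mun]_eta (gaussW l xi eta * g (affv 1 (scalev c t) eta)) <=
  expR (- (normv t ^+ 2 / (12 * l))) * \int[mun]_eta (gaussW (4 * l) xi eta * g eta).
Proof.
move=> l0 c2 mg gM.
have [i e] := Rintegral_affv (scalev (- c) t) ltr01 (integrable_windowM xi (scalev c t) l0 mg gM).
have back u : affv 1 (scalev c t) (affv 1 (scalev (- c) t) u) = u.
  by apply: eq_from_tnth => j; rewrite !tnth_mktuple; ring.
rewrite e expr1n mul1r.
have E1 : (fun u => gaussW l xi (affv 1 (scalev (- c) t) u) *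
    g (affv 1 (scalev c t) (affv 1 (scalev (- c) t) u))) =
  (fun u => gaussW l xi (affv 1 (scalev (- c) t) u) * g u).
  by apply/funext => u; rewrite back.
rewrite E1 in i *.
have l4 : 0 < 4 * l by rewrite mulr_gt0.
have i4 := integrable_windowM xi [tuple 0 | j < n] l4 mg gM.
have E2 : (fun u => gaussW (4 * l) xi u * g (affv 1 [tuple 0 | j < n] u)) =
  (fun u => gaussW (4 * l) xi u * g u).
  by apply/funext => u; rewrite affv1_0.
rewrite E2 in i4.
set e8 := expR _; set e12 := expR _.
have z1 := RintegralZl e8 measurableT i; have z2 := RintegralZl e12 measurableT i4.
rewrite -z1 -z2.
apply: le_Rintegral => //; [exact: integrable_scale..|].
move=> u _; rewrite !mulrA ler_wpM2r//; last exact: gaussW_shift_le.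
by have /andP[] := gM u.
Qed.

Lemma spectrum_bounded f : cintegrable mun f ->
  forall u, 0 <= normc (fourierL1 f u) ^+ 2 <= (\int[mun]_u normc (f u)) ^+ 2.
Proof.
move=> iF u; rewrite sqr_ge0/= ler_pXn2r ?nnegrE ?normc_ge0//.
  exact: normc_fourierL1_le.
by apply: Rintegral_ge0 => v _; exact: normc_ge0.
Qed.

Let half_sum_le (e x y z : R) : e * x <= z -> e * y <= z -> e * (2^-1 * (y + x)) <= z.
Proof.
move=> h1 h2; rewrite [leLHS](_ : _ = 2^-1 * (e * y) + 2^-1 * (e * x)); last by ring.
move: (e * y) (e * x) h1 h2 => u v; lra.
Qed.

Definition cross_energy (l : R) (xi t : E) f : R :=
  complex.Re (cint mun (fun eta => (gaussW l xi eta)%:C *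
      (fourierL1 f (affv 1 (scalev (- 2^-1) t) eta) *
       ((fourierL1 f (affv 1 (scalev 2^-1 t) eta))^*)%C))).

(** The arithmetic-geometric inequality separates the two shifted transforms; each is then moved
    back by its half shift, at the price of a wider window and part of the decay in t. *)
Lemma cross_energy_le f (l : R) (xi t : E) : 0 < l -> cintegrable mun f ->
  expR (- (normv t ^+ 2 / (8 * l))) * `|cross_energy l xi t f| <=
  expR (- (normv t ^+ 2 / (12 * l))) * window_energy (4 * l) xi f.
Proof.
move=> l0 iF; have mf := cintegrable_meas iF.
pose g eta : R[i] := (gaussW l xi eta)%:C *
      (fourierL1 f (affv 1 (scalev (- 2^-1) t) eta) *
       ((fourierL1 f (affv 1 (scalev 2^-1 t) eta))^*)%C).
have mS : measurable_fun setT (fun u => normc (fourierL1 f u) ^+ 2).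
  by apply: cmeas_norm2; exact: cmeas_fourierL1.
have bS := spectrum_bounded iF.
pose A c eta := gaussW l xi eta * normc (fourierL1 f (affv 1 (scalev c t) eta)) ^+ 2.
have iA c : mun.-integrable setT (EFin \o A c) by exact: (integrable_windowM xi (scalev c t) l0 mS bS).
have iS : mun.-integrable setT (EFin \o (fun eta => 2^-1 * (A (- 2^-1) eta + A 2^-1 eta))).
  by apply: integrable_scale; exact: (integrableD measurableT (iA _) (iA _)).
have gle eta : normc (g eta) <= 2^-1 * (A (- 2^-1) eta + A 2^-1 eta).
  rewrite /g normcM normc_re ger0_norm ?gaussW_ge0// /A -mulrDr mulrCA.
  rewrite ler_wpM2l ?gaussW_ge0//; apply: le_trans (normc_AM_GM _ _) _.
  by rewrite normcJ mulrC.
have mg : cmeas g.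
  apply: cmeasM; first by apply: cmeas_re; exact: measurable_gaussW.
  apply: cmeasM; first by apply: (cmeas_comp (cmeas_fourierL1 mf)); exact: measurable_affv.
  by apply: cmeasJ; apply: (cmeas_comp (cmeas_fourierL1 mf)); exact: measurable_affv.
have ig : cintegrable mun g by exact: cintegrable_le mg iS gle.
have h : `|cross_energy l xi t f| <= 2^-1 * (\int[mun]_eta A (- 2^-1) eta + \int[mun]_eta A 2^-1 eta).
  apply: le_trans (normr_Re (cint mun g)) _; apply: le_trans (normc_cint_le ig) _.
  rewrite -RintegralD// -RintegralZl//; last exact: (integrableD measurableT (iA _) (iA _)).
  by apply: le_Rintegral => //; have [_] := (cintegrableP _ _).1 ig.
apply: le_trans (ler_wpM2l (expR_ge0 _) h) _.
have e1 : (- 2^-1) ^+ 2 = 4^-1 :> R by field.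
have e2 : 2^-1 ^+ 2 = 4^-1 :> R by field.
have : expR (- (normv t ^+ 2 / (8 * l))) * \int[mun]_eta A (- 2^-1) eta <=
  expR (- (normv t ^+ 2 / (12 * l))) * window_energy (4 * l) xi f.
  exact: (shifted_window_le xi t l0 e1 mS bS).
have : expR (- (normv t ^+ 2 / (8 * l))) * \int[mun]_eta A 2^-1 eta <=
  expR (- (normv t ^+ 2 / (12 * l))) * window_energy (4 * l) xi f.
  exact: (shifted_window_le xi t l0 e2 mS bS).
exact: half_sum_le.
Qed.

Lemma cross_energy0 f (l : R) (xi : E) (t : E) : (forall j, tnth t j = 0) ->
  cross_energy l xi t f = window_energy l xi f.
Proof.
move=> t0; have st c : scalev c t = [tuple 0 | j < n].
  by apply: eq_from_tnth => j; rewrite !tnth_mktuple t0 mulr0.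
rewrite /cross_energy !st /window_energy.
rewrite (_ : (fun eta => _) = fun eta => (gaussW l xi eta * normc (fourierL1 f eta) ^+ 2)%:C); first by rewrite cint_re.
by apply/funext => eta; rewrite affv1_0 realCM normc_sqrJ.
Qed.

End window_energy.

Section sampling_bound.
Context {R : realType} {n : nat}.
Local Notation mun := (@lebesgue_measure_n R n).
Local Notation E := (euclidean R n).
Implicit Types f : E -> R[i].
Variables (xi : E) (a : R).
Hypotheses (l0 : 0 < normv xi) (a0 : 0 < a).
Local Notation l := (normv xi).
Local Notation s := (2 * l * a ^+ 2).

(* Total weight of the nonzero frequencies [t] in the Poisson summation formula:
   after completing the square, the term [t] costs [expR (- (normv t ^+ 2 / (12 * l)))]
   relative to the window widened by a factor 2, whence [3 / 2 * s]. *)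
Definition sampling_defect : R :=
  ((1 + theta_ratio (3 / 2 * s)) / (1 - theta_ratio (3 / 2 * s))) ^+ n - 1.

Lemma fejer_weightE N (P : {ffun 'I_n -> 'I_N.+1 * 'I_N.+1}) :
  fejer_weight s P = N.+1%:R^-1 ^+ n * expR (- (normv (shiftv a P) ^+ 2 / (8 * l))) /\
  fejer_weight (3 / 2 * s) P = N.+1%:R^-1 ^+ n * expR (- (normv (shiftv a P) ^+ 2 / (12 * l))).
Proof.
split; rewrite /fejer_weight big_split/= prodr_const card_ord -expR_sum; congr (_ * expR _);
  rewrite normv_sqrE mulr_suml -sumrN; apply: eq_bigr => j _; congr (- _); rewrite tnth_mktuple;
  by field; rewrite (lt0r_neq0 l0) (lt0r_neq0 a0).
Qed.

(** The part of the Fejer weights on t = 0, of total mass 1: it carries the main term, and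
    subtracting it leaves only the nonzero dual vectors. *)
Let D N (P : {ffun 'I_n -> 'I_N.+1 * 'I_N.+1}) : R :=
  \prod_(j < n) (N.+1%:R^-1 * (nat_of_bool ((P j).1 == (P j).2))%:R).

Let sumD N : \sum_(P : {ffun 'I_n -> 'I_N.+1 * 'I_N.+1}) D P = 1.
Proof.
have -> : \sum_(P : {ffun 'I_n -> 'I_N.+1 * 'I_N.+1}) D P =
  \prod_(j < n) \sum_(p : 'I_N.+1 * 'I_N.+1) N.+1%:R^-1 * (nat_of_bool (p.1 == p.2))%:R.
  by rewrite bigA_distr_bigA.
apply: big1 => j _.
rewrite -(pair_big xpredT xpredT (fun x y : 'I_N.+1 => N.+1%:R^-1 * (nat_of_bool (x == y))%:R))/=.
rewrite (eq_bigr (fun=> N.+1%:R^-1)) => [|x _].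
  by rewrite sumr_const card_ord -[X in X = _]mulr_natl divff.
by rewrite (bigD1 x)//= eqxx mulr1 big1 ?addr0// => y; rewrite eq_sym => /negbTE ->; rewrite mulr0.
Qed.

(** If all pairs are diagonal, t = 0 and both sides vanish. Otherwise [D P] = 0 and the bound is
    that of a single cross term. *)
Lemma fejer_term_le f N (P : {ffun 'I_n -> 'I_N.+1 * 'I_N.+1}) : cintegrable mun f ->
  `|fejer_weight s P * cross_energy l xi (shiftv a P) f - D P * window_energy l xi f| <=
  (fejer_weight (3 / 2 * s) P - D P) * window_energy (4 * l) xi f.
Proof.
move=> iF; have [-> ->] := fejer_weightE P.
have w0 : 0 <= N.+1%:R^-1 ^+ n :> R by rewrite exprn_ge0// invr_ge0.
have [/forallP diag|/forallPn[j jP]] := boolP [forall j, (P j).1 == (P j).2].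
  have -> : D P = N.+1%:R^-1 ^+ n.
    rewrite /D (eq_bigr (fun=> N.+1%:R^-1)) ?prodr_const ?card_ord// => j _.
    by rewrite diag mulr1.
  have t0 j : tnth (shiftv a P) j = 0.
    by rewrite tnth_mktuple (eqP (diag j)) subrr mulr0 mul0r.
  rewrite cross_energy0// normv_sqrE big1 ?mul0r ?oppr0 ?expR0 ?mulr1 ?subrr ?normr0 ?mul0r// => j _.
  by rewrite t0 expr0n.
have -> : D P = 0 by rewrite /D (bigD1 j)//= (negbTE jP) mulr0 mul0r.
rewrite mul0r !subr0 -!(mulrA (N.+1%:R^-1 ^+ n)) normrM ger0_norm// ler_wpM2l//.
rewrite normrM ger0_norm ?expR_ge0//; exact: cross_energy_le.
Qed.

Lemma fejer_weight_sum N : \sum_(P : {ffun 'I_n -> 'I_N.+1 * 'I_N.+1}) fejer_weight (3 / 2 * s) P <=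
  ((1 + theta_ratio (3 / 2 * s)) / (1 - theta_ratio (3 / 2 * s))) ^+ n.
Proof.
have t0 : 0 < 3 / 2 * s by rewrite !mulr_gt0// ?exprn_gt0// ?divr_gt0.
have -> : \sum_(P : {ffun 'I_n -> 'I_N.+1 * 'I_N.+1}) fejer_weight (3 / 2 * s) P =
  \prod_(j < n) \sum_(p : 'I_N.+1 * 'I_N.+1) N.+1%:R^-1 * gauss_coef (3 / 2 * s) (p.1%:R - p.2%:R).
  by rewrite bigA_distr_bigA.
set c := (1 + theta_ratio _) / _; rewrite (_ : c ^+ n = \prod_(j < n) c); last by rewrite prodr_const card_ord.
apply: ler_prod => j _; apply/andP; split.
  by apply: sumr_ge0 => p _; rewrite mulr_ge0 ?invr_ge0 ?expR_ge0.
apply: le_trans (gauss_coef_sum t0 N); rewrite -mulr_sumr.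
by rewrite -(pair_big xpredT xpredT (fun x y : 'I_N.+1 => gauss_coef (3 / 2 * s) (x%:R - y%:R))).
Qed.

Lemma window_energy_ge0 (k : R) f : 0 <= window_energy k xi f.
Proof.
by apply: Rintegral_ge0 => eta _; rewrite mulr_ge0 ?gaussW_ge0 ?sqr_ge0.
Qed.

Lemma fejer_energy_bound f N : cintegrable mun f ->
  `|fejer_energy xi a f N - (4 * pi) ^- n * window_energy l xi f| <=
  (4 * pi) ^- n * (sampling_defect * window_energy (4 * l) xi f).
Proof.
move=> iF; have c0 : 0 <= (4 * pi) ^- n :> R.
  by rewrite invr_ge0 exprn_ge0// mulr_ge0// pi_ge0.
rewrite fejer_energyE// -mulrBr normrM ger0_norm// ler_wpM2l//.
rewrite [X in `|X|](_ : _ = \sum_(P : {ffun 'I_n -> 'I_N.+1 * 'I_N.+1})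
  (fejer_weight s P * cross_energy l xi (shiftv a P) f - D P * window_energy l xi f)); last first.
  by rewrite sumrB -mulr_suml sumD mul1r.
apply: le_trans (ler_norm_sum _ _ _) _.
apply: (@le_trans _ _ (\sum_(P : {ffun 'I_n -> 'I_N.+1 * 'I_N.+1}) (fejer_weight (3 / 2 * s) P - D P) * window_energy (4 * l) xi f)).
  by apply: ler_sum => P _; exact: fejer_term_le.
rewrite -mulr_suml sumrB sumD ler_wpM2r ?window_energy_ge0// lerB//.
exact: fejer_weight_sum.
Qed.

Lemma sampling_bound f : cintegrable mun f ->
  `|sampling_limit xi a f - (4 * pi) ^- n * window_energy l xi f| <=
  (4 * pi) ^- n * (sampling_defect * window_energy (4 * l) xi f).
Proof.
move=> iF.
have c := fejer_energy_cvg l0 a0 iF.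
have c2 : `|fejer_energy xi a f N - (4 * pi) ^- n * window_energy l xi f| @[N --> \oo] -->
    `|sampling_limit xi a f - (4 * pi) ^- n * window_energy l xi f|.
  by apply: cvg_norm; apply: cvgB => //; exact: cvg_cst.
rewrite -(cvg_lim _ c2)//; apply: limr_le; first by apply/cvg_ex; eexists; exact: c2.
by apply: nearW => N; exact: fejer_energy_bound.
Qed.

End sampling_bound.

(** * Dyadic frequencies *)

Section dyadic_bounds.
Context {R : realType}.

(** Counting without logarithms: the bounded increasing sequence min (2^k, 16 x) / x grows by at
    least 1 at each k whose 2^k lies in the window. *)
Lemma sum_dyadic_window (x : R) (K : nat) : 0 < x ->
  \sum_(k < K) (nat_of_bool (x < 2 ^+ k < 8 * x))%:R <= 16 :> R.
Proof.
move=> x0; pose g (k : nat) : R := Num.min (2 ^+ k) (16 * x) / x.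
have step k : (nat_of_bool (x < 2 ^+ k < 8 * x))%:R <= g k.+1 - g k.
  have y0 : 0 < 2 ^+ k :> R by rewrite exprn_gt0.
  rewrite /g exprS; move: (2 ^+ k) y0 => y y0.
  rewrite -mulrBl ler_pdivlMr//.
  case: (boolP (_ < _ < _)) => [/andP[h1 h2]|_]; rewrite ?mul1r ?mul0r.
    by rewrite !minElt; case: ifPn; case: ifPn; rewrite -?leNgt; lra.
  by rewrite !minElt; case: ifPn; case: ifPn; rewrite -?leNgt; lra.
apply: (@le_trans _ _ (\sum_(0 <= k < K) (g k.+1 - g k))).
  by rewrite big_mkord; apply: ler_sum => k _; exact: step.
rewrite telescope_sumr//; have g0 : 0 <= g 0%N.
  by rewrite divr_ge0 ?(ltW x0)// le_min expr0 ler01/= mulr_ge0// ltW.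
have gK : g K <= 16 by rewrite ler_pdivrMr// ge_min lexx orbT.
lra.
Qed.

(** One term of the exponential series, of order N + 1 with N an integer above p, beats y^p and
    leaves a factor 1 / y. *)
Lemma powR_le_expR (c p : R) : 0 < c -> 0 <= p ->
  exists2 D : R, 0 <= D & forall y, 1 <= y -> y `^ p * expR (- (c * y)) <= D / y.
Proof.
move=> c0 p0; pose N := (Num.truncn p).+1.
exists (N.+1`!%:R / c ^+ N.+1) => [|y y1].
  by rewrite divr_ge0// exprn_ge0// ltW.
have y0 : 0 < y by rewrite (lt_le_trans ltr01).
have h : y `^ p <= y ^+ N.
  rewrite -[y ^+ N]powR_mulrn ?(ltW y0)//; exact: (ler_powR y1 (ltW (truncnS_gt p))).
have e : (c * y) ^+ N.+1 / N.+1`!%:R <= expR (c * y).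
  have cy0 : 0 <= c * y by rewrite mulr_ge0// ltW.
  by apply: le_trans (expR_ge1Dxn N cy0); rewrite lerDr.
have f0 : 0 < N.+1`!%:R :> R by rewrite ltr0n fact_gt0.
rewrite ler_pdivlMr// expRN [leLHS]mulrAC ler_pdivrMr ?expR_gt0//.
rewrite [leRHS]mulrAC ler_pdivlMr ?exprn_gt0//.
move: e; rewrite ler_pdivrMr// exprMn => e; rewrite [leRHS]mulrC; apply: le_trans e.
rewrite [leLHS]mulrC ler_pM2l ?exprn_gt0// exprSr ler_pM2r//.
Qed.

(** At y = 2^k the bound D / y of [powR_le_expR] is geometric, with sum at most 2 D. The rate 1 /
    256 is the one of [annulus_decay]. *)
Lemma dyadic_exp_sum (m : R) : 0 <= m -> exists2 D : R, 0 <= D & forall K : nat,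
  \sum_(k < K) (2 `^ (k%:R * m)) ^+ 2 * expR (- (2 ^+ k / 256)) <= D.
Proof.
move=> m0; have c0 : 0 < 256^-1 :> R by rewrite invr_gt0.
have m20 : 0 <= m * 2 by rewrite mulr_ge0.
have [D D0 hD] := powR_le_expR c0 m20.
exists (D * 2) => [|K]; first by rewrite mulr_ge0.
apply: (@le_trans _ _ (D * \sum_(k < K) (2^-1) ^+ k)).
  rewrite mulr_sumr; apply: ler_sum => k _.
  have k1 : 1 <= 2 ^+ k :> R by rewrite exprn_ege1// ler1n.
  have := hD _ k1; rewrite exprVn (mulrC _^-1).
  rewrite (_ : (2 `^ (k%:R * m)) ^+ 2 = (2 ^+ k) `^ (m * 2))//.
  by rewrite -[LHS]powR_mulrn ?powR_ge0// -powRrM -[(k%:R * m) * 2]mulrA powRrM powR_mulrn.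
rewrite ler_wpM2l//.
have h : (1 - 2^-1) * \sum_(k < K) 2^-1 ^+ k <= 1 :> R.
  have := @geometric_sum_right R 2^-1 K 0; rewrite subn0.
  under eq_bigr do rewrite subn0; move=> ->.
  by rewrite gerBl exprn_ge0.
lra.
Qed.

End dyadic_bounds.

(** * The frequency lattice in dyadic annuli *)

Section frequencies.
Context {R : realType} (n : nat).
Local Notation E := (euclidean R n).

(** Comparable to the window width 2^(k/2). The factor 4 n bounds the rounding displacement by n
    times the step: at most 2^k / 4, which fits in the annulus, and with square 2^k / 16, well below
    2 |xi|. *)
Definition lattice_step (k : nat) : R := Num.sqrt (2 ^+ k) / (4 * n%:R).

Definition lattice_point k (l : n.-tuple int) : E :=
  [tuple lattice_step k * (tnth l j)%:~R | j < n].

Definition annulus (k : nat) (x : E) := 2^-1 * 2 ^+ k <= normv x < 2 ^+ k.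

(** A crude bound on the integer coordinates of lattice points in the annulus: 2^k divided by the
    step is 4 n 2^(k/2). *)
Definition lattice_radius (k : nat) : nat := (4 * n * 2 ^ k)%N.

Definition lattice_box k : seq (n.-tuple int) :=
  [seq l <- [seq boxpt A | A <- enum {ffun 'I_n -> 'I_(lattice_radius k).*2.+1}] |
   annulus k (lattice_point k l)].

Definition freq_index (k : nat) : {fset int} :=
  seq_fset tt [seq (choice.pickle l)%:Z | l <- lattice_box k].

Definition lattice_of_index (i : int) : n.-tuple int :=
  odflt [tuple 0 | j < n] (choice.unpickle (absz i)).

(* The integer [i] is the code of a lattice vector, so that [freq] is injective on
   the codes; integers that code nothing are sent to 0 and never belong to
   [freq_index]. *)
Definition freq (i : int) (k : nat) : E := lattice_point k (lattice_of_index i).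

Lemma pickleZK (l : n.-tuple int) : lattice_of_index (choice.pickle l)%:Z = l.
Proof. by rewrite /lattice_of_index/= choice.pickleK. Qed.

Lemma boxpt_inj M : injective (@boxpt n M).
Proof.
move=> A B AB; apply/ffunP => j; apply: val_inj => /=.
have := congr1 (fun l => tnth l j) AB; rewrite !tnth_mktuple.
by move=> /addIr [].
Qed.

Lemma mem_boxpt M (l : n.-tuple int) : (forall j, (absz (tnth l j) <= M)%N) ->
  l \in [seq boxpt A | A <- enum {ffun 'I_n -> 'I_M.*2.+1}].
Proof.
move=> lb; pose A := [ffun j : 'I_n => inord (absz (tnth l j + M%:Z)) : 'I_M.*2.+1].
apply/mapP; exists A; first by rewrite mem_enum.
apply: eq_from_tnth => j; rewrite tnth_mktuple ffunE.
have := lb j; move: (tnth l j) => z zM.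
rewrite inordK; last by lia.
by lia.
Qed.

Lemma lattice_box_uniq k : uniq (lattice_box k).
Proof. by rewrite filter_uniq// map_inj_uniq ?enum_uniq//; exact: boxpt_inj. Qed.

Lemma freq_indexP k i : reflect (exists2 l, l \in lattice_box k & i = (choice.pickle l)%:Z)
  (i \in freq_index k).
Proof. by rewrite /freq_index seq_fsetE; exact: mapP. Qed.

Lemma freq_annulus k i : i \in freq_index k -> annulus k (freq i k).
Proof.
by move=> /freq_indexP[l + ->]; rewrite mem_filter /freq pickleZK => /andP[].
Qed.

Lemma sum_freq_index k (h : E -> R) :
  \sum_(i <- freq_index k) h (freq i k) = \sum_(l <- lattice_box k) h (lattice_point k l).
Proof.
rewrite (perm_big [seq (choice.pickle l)%:Z | l <- lattice_box k])/=.
  by rewrite big_map; apply: eq_bigr => l _; rewrite /freq pickleZK.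
have u : uniq [seq (choice.pickle l)%:Z | l <- lattice_box k].
  rewrite map_inj_uniq ?lattice_box_uniq// => x y [] /(congr1 (@choice.unpickle (n.-tuple int))).
  by rewrite !choice.pickleK => -[].
by have := seq_fset_perm tt [seq (choice.pickle l)%:Z | l <- lattice_box k]; rewrite undup_id.
Qed.

Hypothesis n_gt0 : (0 < n)%N.

Let n0 : 0 < n%:R :> R. Proof. by rewrite ltr0n. Qed.

Lemma lattice_step_gt0 k : 0 < lattice_step k.
Proof. by rewrite divr_gt0 ?sqrtr_gt0 ?exprn_gt0// mulr_gt0. Qed.

Lemma lattice_step_sqr k : lattice_step k ^+ 2 = 2 ^+ k / (16 * n%:R ^+ 2).
Proof.
rewrite expr_div_n sqr_sqrtr ?exprn_ge0//; congr (_ / _); ring.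
Qed.

Lemma mem_lattice_box k (l : n.-tuple int) : annulus k (lattice_point k l) -> l \in lattice_box k.
Proof.
move=> ann; rewrite mem_filter ann/=.
have lb j : (absz (tnth l j) <= lattice_radius k)%N.
  have /andP[_ h] := ann.
  have := le_lt_trans (abs_tnth_le (lattice_point k l) j) h.
  rewrite tnth_mktuple normrM gtr0_norm ?lattice_step_gt0// => h1.
  have p1 : 1 <= 2 ^+ k :> R by rewrite exprn_ege1// ler1n.
  have s1 : 1 <= Num.sqrt (2 ^+ k) :> R by rewrite -[leLHS]sqrtr1 ler_wsqrtr.
  have h2 : `|(tnth l j)%:~R| * Num.sqrt (2 ^+ k) < 2 ^+ k * (4 * n%:R) :> R.
    rewrite mulrC -ltr_pdivrMr ?mulr_gt0// mulrAC; exact: h1.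
  have h3 : `|(tnth l j)%:~R| < 2 ^+ k * (4 * n%:R) :> R.
    by apply: le_lt_trans h2; rewrite ler_peMr.
  rewrite -(ler_nat R) natr_absz intr_norm; apply: le_trans (ltW h3) _.
  by rewrite !natrM natrX mulrC.
exact: mem_boxpt.
Qed.

Lemma normv_close (x y : E) (d : R) : 0 <= d ->
  (forall j, `|tnth x j - tnth y j| <= d) -> normv (subv x y) <= n%:R * d.
Proof.
move=> d0 h; rewrite -(@ler_pXn2r _ 2)// ?nnegrE ?normv_ge0 ?mulr_ge0// normv_sqrE.
apply: (@le_trans _ _ (\sum_(j < n) d ^+ 2)).
  apply: ler_sum => j _; rewrite tnth_mktuple -(real_normK (num_real _)).
  by rewrite ler_pXn2r ?nnegrE.
rewrite sumr_const card_ord exprMn -[leLHS]mulr_natl ler_wpM2r ?sqr_ge0// expr2 ler_peMr//.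
by rewrite ler1n.
Qed.

Lemma normv_mono (x y : E) : (forall j, `|tnth x j| <= `|tnth y j|) -> normv x <= normv y.
Proof.
move=> h; rewrite -(@ler_pXn2r _ 2)// ?nnegrE ?normv_ge0// !normv_sqrE.
apply: ler_sum => j _; rewrite -(real_normK (num_real (tnth x j))) -(real_normK (num_real (tnth y j))).
by rewrite ler_pXn2r ?nnegrE.
Qed.

(* Rounding all coordinates towards 0, or all away from 0, moves the norm in a
   known direction; this keeps the lattice point in the annulus. *)
Lemma round_down (s t : R) : 0 < s -> exists z : int,
  `|s * z%:~R| <= `|t| /\ `|t - s * z%:~R| <= s.
Proof.
move=> s0; wlog t0 : t / 0 <= t => [H|].
  have [/H//|/ltW t0] := leP 0 t.
  have [|z [h1 h2]] := H (- t); first by rewrite oppr_ge0.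
  exists (- z); rewrite mulrNz mulrN normrN; split; first by rewrite normrN in h1.
  by rewrite opprK -normrN opprD.
have /andP[h1 h2] := truncn_itv (divr_ge0 t0 (ltW s0)).
exists (Num.truncn (t / s)); rewrite -pmulrn.
move: h1 h2; rewrite ler_pdivlMr// ltr_pdivrMr// -natr1 => h1 h2.
have p0 : 0 <= s * (Num.truncn (t / s))%:R by rewrite mulr_ge0// ltW.
rewrite !ger0_norm// ?subr_ge0 1?mulrC//; split => //.
rewrite lerBlDr; lra.
Qed.

Lemma round_up (s t : R) : 0 < s -> exists z : int,
  `|t| <= `|s * z%:~R| /\ `|t - s * z%:~R| <= s.
Proof.
move=> s0; wlog t0 : t / 0 <= t => [H|].
  have [/H//|/ltW t0] := leP 0 t.
  have [|z [h1 h2]] := H (- t); first by rewrite oppr_ge0.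
  exists (- z); rewrite mulrNz mulrN normrN; split; first by rewrite normrN in h1.
  by rewrite opprK -normrN opprD.
have /andP[h1 h2] := truncn_itv (divr_ge0 t0 (ltW s0)).
exists (Num.truncn (t / s)).+1; rewrite -pmulrn.
move: h1 h2; rewrite ler_pdivlMr// ltr_pdivrMr// -natr1 => h1 h2.
have p0 : 0 <= s * ((Num.truncn (t / s))%:R + 1) by rewrite mulr_ge0 ?addr_ge0// ltW.
rewrite (ger0_norm t0) (ger0_norm p0) ler_norml; split; first by lra.
by apply/andP; split; lra.
Qed.

Lemma lattice_diam k : n%:R * lattice_step k <= 4^-1 * 2 ^+ k /\
  (n%:R * lattice_step k) ^+ 2 = 2 ^+ k / 16.
Proof.
split; last by rewrite exprMn lattice_step_sqr; field; exact: lt0r_neq0.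
rewrite /lattice_step; set q := Num.sqrt _.
have -> : n%:R * (q / (4 * n%:R)) = 4^-1 * q by field; exact: lt0r_neq0.
rewrite ler_pM2l ?invr_gt0//.
have q1 : 1 <= q by rewrite -[leLHS]sqrtr1 ler_wsqrtr// exprn_ege1// ler1n.
have <- : q ^+ 2 = 2 ^+ k by rewrite sqr_sqrtr// exprn_ge0.
by rewrite expr2 ler_peMr// (le_trans ler01).
Qed.

Lemma dyadic_scale (y : R) : 2^-1 <= y -> exists k : nat, 2^-1 * 2 ^+ k <= y < 2 ^+ k.
Proof.
move=> y2; have [N hN] : exists N : nat, y < 2 ^+ N.
  exists (Num.truncn y).+1; apply: lt_le_trans (truncnS_gt y) _.
  by rewrite -natrX ler_nat ltnW// ltn_expl.
have ex : exists N : nat, y < 2 ^+ N by exists N.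
pose k := ex_minn ex; exists k; rewrite /k; case: ex_minnP => -[|j] hj mj.
  by rewrite expr0 mulr1 y2 -[X in _ < X](expr0 2).
rewrite hj andbT exprS mulKf// leNgt; apply/negP => /mj.
by rewrite ltnn.
Qed.

(** The norm of eta selects the scale. Below 3/4 2^k the coordinates are rounded away from 0, above
    it towards 0, so a displacement of at most 2^k / 4 cannot leave the annulus. *)
Lemma near_frequency (eta : E) : exists k, exists2 l : n.-tuple int,
  annulus k (lattice_point k l) &
  normv (subv eta (lattice_point k l)) ^+ 2 <= 2 * normv (lattice_point k l).
Proof.
have [small|big] := ltP (normv eta) 2^-1.
  (* No annulus reaches norms below 1 / 2, so the vector (1/2, 0, ..., 0) of scale 0 serves instead;
     the step there is 1 / (4 n), whence the coordinate 2 n. *)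
  pose l : n.-tuple int := [tuple if j == Ordinal n_gt0 then (2 * n)%:Z else 0 | j < n].
  have nx : normv (lattice_point 0 l) = 2^-1.
    apply/eqP; rewrite -(@eqrXn2 _ 2)// ?normv_ge0 ?invr_ge0// normv_sqrE.
    rewrite (bigD1 (Ordinal n_gt0))//= big1 ?addr0 => [|j /negbTE jn].
      rewrite !tnth_mktuple eqxx exprMn lattice_step_sqr expr0 -pmulrn natrM; apply/eqP.
      by field; exact: lt0r_neq0.
    by rewrite !tnth_mktuple jn mulr0 expr0n.
  exists 0%N, l; first by rewrite /annulus nx expr0 mulr1 lexx/= invf_lt1// ltr1n.
  rewrite nx divff// expr_le1// ?normv_ge0//.
  apply: le_trans (ler_normv_sub _ eta) _.
  rewrite (_ : normv (subv (subv eta (lattice_point 0 l)) eta) = 2^-1); first by lra.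
  rewrite -nx /normv; congr Num.sqrt; apply: eq_bigr => j _; rewrite !(tnth_mktuple (fun j => _ - _)); ring.
have [k /andP[k1 k2]] := dyadic_scale big.
have [d1 d2] := lattice_diam k; have s0 := lattice_step_gt0 k.
have fin (l : n.-tuple int) : annulus k (lattice_point k l) ->
    (forall j, `|tnth eta j - tnth (lattice_point k l) j| <= lattice_step k) ->
  normv (subv eta (lattice_point k l)) ^+ 2 <= 2 * normv (lattice_point k l).
  move=> /andP[a1 _] /(normv_close (ltW s0)) h.
  apply: (@le_trans _ _ ((n%:R * lattice_step k) ^+ 2)).
    by rewrite ler_pXn2r ?nnegrE ?normv_ge0// mulr_ge0// ltW.
  have : 0 < 2 ^+ k :> R by rewrite exprn_gt0.
  rewrite d2; lra.
have [lo|hi] := ltP (normv eta) (3 / 4 * 2 ^+ k).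
  have Z j := cid (round_up (tnth eta j) s0).
  pose l := [tuple sval (Z j) | j < n].
  have lE j : tnth (lattice_point k l) j = lattice_step k * (sval (Z j))%:~R by rewrite !tnth_mktuple.
  have c j : `|tnth eta j - tnth (lattice_point k l) j| <= lattice_step k.
    by rewrite lE; case: (Z j) => z [].
  have ge : normv eta <= normv (lattice_point k l).
    by apply: normv_mono => j; rewrite lE; case: (Z j) => z [].
  have le := ler_normv_sub (lattice_point k l) eta.
  have := normv_close (ltW s0) c; rewrite normv_subC => cl.
  have ann : annulus k (lattice_point k l) by apply/andP; split; lra.
  by exists k, l => //; exact: fin.
have Z j := cid (round_down (tnth eta j) s0).
pose l := [tuple sval (Z j) | j < n].
have lE j : tnth (lattice_point k l) j = lattice_step k * (sval (Z j))%:~R by rewrite !tnth_mktuple.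
have c j : `|tnth eta j - tnth (lattice_point k l) j| <= lattice_step k.
  by rewrite lE; case: (Z j) => z [].
have ge : normv (lattice_point k l) <= normv eta.
  by apply: normv_mono => j; rewrite lE; case: (Z j) => z [].
have le := ler_normv_sub eta (lattice_point k l).
have cl := normv_close (ltW s0) c.
have ann : annulus k (lattice_point k l) by apply/andP; split; lra.
by exists k, l => //; exact: fin.
Qed.

(** A single near frequency suffices: |eta - xi|^2 <= 2 |xi| makes its window at least exp (- 1).
    How large K must be depends on eta. *)
Lemma freq_lower (eta : E) : \forall K \near \oo,
  expR (- 1) <= \sum_(k < K) \sum_(i <- freq_index k) gaussW (normv (freq i k)) (freq i k) eta.
Proof.
have [k [l ann le]] := near_frequency eta.
have mem := mem_lattice_box ann.
near=> K; have kK : (k < K)%N by near: K; exact: nbhs_infty_gt.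
rewrite (bigD1 (Ordinal kK))//= -[leLHS]addr0 lerD//; last first.
  by apply: sumr_ge0 => j _; apply: sumr_ge0 => i _; exact: gaussW_ge0.
rewrite (sum_freq_index k (fun x => gaussW (normv x) x eta)).
rewrite (bigD1_seq l)//= ?lattice_box_uniq// -[leLHS]addr0 lerD//; last first.
  by apply: sumr_ge0 => j _; exact: gaussW_ge0.
rewrite /gaussW ler_expR lerN2; have /andP[a1 _] := ann.
have x0 : 0 < normv (lattice_point k l).
  by apply: lt_le_trans a1; rewrite mulr_gt0 ?invr_gt0// exprn_gt0.
by rewrite mulrC ler_pdivrMr ?mulr_gt0// mul1r.
Unshelve. all: end_near. Qed.

(** Independent of k: the squared step 2^k / (16 n^2) divided by 16 2^k is 1 / (256 n^2). *)
Definition lattice_gauss_bound : R := gauss_sum_bound (256 * n%:R ^+ 2)^-1 ^+ n.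

Lemma lattice_gauss_sum k (eta : E) :
  \sum_(l <- lattice_box k) expR (- (normv (subv eta (lattice_point k l)) ^+ 2 / (16 * 2 ^+ k)))
  <= lattice_gauss_bound.
Proof.
pose b : R := (256 * n%:R ^+ 2)^-1.
have b0 : 0 < b by rewrite invr_gt0 mulr_gt0// exprn_gt0.
set M := lattice_radius k.
have s0 := lattice_step_gt0 k.
rewrite /lattice_box big_filter big_mkcond/=.
pose h (l : n.-tuple int) := expR (- (normv (subv eta (lattice_point k l)) ^+ 2 / (16 * 2 ^+ k))).
apply: (@le_trans _ _ (\sum_(l <- [seq boxpt A | A <- enum {ffun 'I_n -> 'I_M.*2.+1}]) h l)).
  by apply: ler_sum => l _; case: ifP => // _; exact: expR_ge0.
rewrite big_map big_enum/=.
have E (A : {ffun 'I_n -> 'I_M.*2.+1}) : h (boxpt A) =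
    \prod_(j < n) expR (- (b * ((A j)%:R - (M%:R + tnth eta j / lattice_step k)) ^+ 2)).
  rewrite -expR_sum; congr expR; rewrite normv_sqrE mulr_suml -sumrN; apply: eq_bigr => j _.
  have y0 : 0 < 2 ^+ k :> R by rewrite exprn_gt0.
  have -> : tnth (subv eta (lattice_point k (boxpt A))) j =
     - (lattice_step k * ((A j)%:R - (M%:R + tnth eta j / lattice_step k))).
    by rewrite !tnth_mktuple rmorphB/= -!pmulrn; field; exact: lt0r_neq0.
  rewrite sqrrN exprMn lattice_step_sqr /b; congr (- _).
  move: (2 ^+ k) y0 => y y0; field.
  by rewrite (lt0r_neq0 s0) (lt0r_neq0 n0) (lt0r_neq0 y0).
under eq_bigr do rewrite E.
rewrite -(bigA_distr_bigA (fun j (i : 'I_M.*2.+1) => expR (- (b * (i%:R - (M%:R + tnth eta j / lattice_step k)) ^+ 2)))).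
have -> : lattice_gauss_bound = \prod_(j < n) gauss_sum_bound b by rewrite prodr_const card_ord.
apply: ler_prod => j _; apply/andP; split; last exact: gauss_sum_le.
by apply: sumr_ge0 => i _; exact: expR_ge0.
Qed.

(** Unless |eta| / 2 < 2^k < 4 |eta|, the distance from eta to the annulus is at least 2^k / 4, and
    (2^k / 4)^2 / (16 2^k) = 2^k / 256. *)
Lemma annulus_decay k (eta x : E) : annulus k x ->
  expR (- (normv (subv eta x) ^+ 2 / (16 * 2 ^+ k))) <=
  (nat_of_bool (normv eta / 2 < 2 ^+ k < 8 * (normv eta / 2)))%:R + expR (- (2 ^+ k / 256)).
Proof.
move=> /andP[x1 x2]; have y0 : 0 < 2 ^+ k :> R by rewrite exprn_gt0.
have e0 := expR_ge0 (- (2 ^+ k / 256)) : 0 <= _ :> R.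
case: (boolP (_ < _ < _)) => [_|].
  rewrite -[leLHS]addr0 lerD// -[leRHS]expR0 ler_expR oppr_le0.
  by rewrite divr_ge0 ?sqr_ge0// mulr_ge0// ltW.
rewrite negb_and -!leNgt add0r => out.
rewrite ler_expR lerN2 ler_pdivlMr ?mulr_gt0//.
have h : 4^-1 * 2 ^+ k <= normv (subv eta x).
  case/orP: out => h.
    by have := ler_normv_sub eta x; lra.
  by have := ler_normv_sub x eta; rewrite normv_subC; lra.
rewrite (_ : 2 ^+ k / 256 * (16 * 2 ^+ k) = (4^-1 * 2 ^+ k) ^+ 2); last by field.
by rewrite ler_pXn2r ?nnegrE ?normv_ge0 ?mulr_ge0 ?invr_ge0 ?(ltW y0).
Qed.

(** Half of the Gaussian decay sums over the lattice, uniformly in the scale; the other half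
    measures the distance to the annulus. Scales comparable to |eta| have weight at most (16
    |eta|^2)^m and are boundedly many; the remaining ones sum through their exponential factor. *)
Lemma freq_upper (m : R) : 0 <= m -> exists2 B : R, 0 < B & forall (eta : E) (K : nat),
  \sum_(k < K) \sum_(i <- freq_index k)
     (2 `^ (k%:R * m)) ^+ 2 * gaussW (4 * normv (freq i k)) (freq i k) eta <=
  B * (1 + normv eta ^+ 2) `^ m.
Proof.
move=> m0; have [D D0 hD] := dyadic_exp_sum m0.
have G0 : 0 <= lattice_gauss_bound.
  have b0 : 0 < (256 * n%:R ^+ 2)^-1 :> R by rewrite invr_gt0 mulr_gt0// exprn_gt0.
  exact: exprn_ge0 (gauss_sum_bound_ge0 b0).
(* The added 1 makes the constant positive without a lower bound on the other factors. *)
exists (lattice_gauss_bound * (16 * 16 `^ m + D) + 1) => [|eta K].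
  by rewrite ltr_wpDl// mulr_ge0// addr_ge0// mulr_ge0// powR_ge0.
pose W k : R := (2 `^ (k%:R * m)) ^+ 2.
pose v k : R := (nat_of_bool (normv eta / 2 < 2 ^+ k < 8 * (normv eta / 2)))%:R.
pose T : R := (1 + normv eta ^+ 2) `^ m.
have e1 : 1 <= 1 + normv eta ^+ 2 by rewrite lerDl sqr_ge0.
have T1 : 1 <= T.
  have p1 : 1 `^ m = 1 :> R by rewrite powR1.
  have : 1 `^ m <= T by apply: ge0_ler_powR; rewrite // ?nnegrE// (le_trans ler01).
  by rewrite p1.
have term k : \sum_(i <- freq_index k) W k * gaussW (4 * normv (freq i k)) (freq i k) eta <=
    lattice_gauss_bound * (W k * (v k + expR (- (2 ^+ k / 256)))).
  have y0 : 0 < 2 ^+ k :> R by rewrite exprn_gt0.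
  rewrite (sum_freq_index k (fun x => W k * gaussW (4 * normv x) x eta)).
  have W0 : 0 <= W k by exact: sqr_ge0.
  apply: (@le_trans _ _ (\sum_(l <- lattice_box k)
     expR (- (normv (subv eta (lattice_point k l)) ^+ 2 / (16 * 2 ^+ k))) * (W k * (v k + expR (- (2 ^+ k / 256)))))).
    rewrite big_seq [leRHS]big_seq; apply: ler_sum => l; rewrite mem_filter => /andP[ann _].
    rewrite [leRHS]mulrCA ler_wpM2l//.
    have := annulus_decay eta ann; set p := expR (- (normv _ ^+ 2 / _)) => hp.
    (* The wide window has exponent 1 / (8 l) with l < 2^k, hence is at most the square of [p],
       whose exponent is 1 / (16 2^k). *)
    apply: (@le_trans _ _ (p * p)); last by rewrite ler_wpM2l// expR_ge0.
    rewrite /gaussW /p -expRD ler_expR -opprD lerN2 -mulrDr.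
    have /andP[a1 a2] := ann; have l0 : 0 < normv (lattice_point k l) by apply: lt_le_trans a1; rewrite mulr_gt0 ?invr_gt0.
    rewrite mulrC ler_wpM2r ?sqr_ge0//.
    rewrite (_ : (16 * 2 ^+ k)^-1 + (16 * 2 ^+ k)^-1 = (2 * (4 * 2 ^+ k))^-1).
      by rewrite lef_pV2 ?posrE ?mulr_gt0// !ler_pM2l// ltW.
    by move: (2 ^+ k) y0 => y y0; field; exact: lt0r_neq0.
  rewrite -mulr_suml; apply: ler_wpM2r; last exact: lattice_gauss_sum.
  by apply: mulr_ge0 => //; apply: addr_ge0 => //; exact: expR_ge0.
have Wv k : W k * v k <= v k * (16 `^ m * T).
  rewrite /v; case: (boolP (_ < _ < _)) => [/andP[_ h]|_]; last by rewrite mulr0 mul0r.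
  rewrite mulr1 mul1r /T -powRM ?(le_trans ler01 e1)//.
  rewrite /W -[X in X <= _]powR_mulrn ?powR_ge0// -powRrM.
  rewrite (_ : k%:R * m * 2 = k%:R * 2 * m); last by ring.
  rewrite powRrM ge0_ler_powR ?nnegrE ?powR_ge0 ?mulr_ge0 ?(le_trans ler01 e1)//.
  rewrite powRrM powR_mulrn// powR_mulrn ?exprn_ge0//.
  have y0 : 0 < 2 ^+ k :> R by rewrite exprn_gt0.
  move: (2 ^+ k) y0 h => y y0 h; nra.
apply: (@le_trans _ _ (\sum_(k < K) lattice_gauss_bound * (v k * (16 `^ m * T) + W k * expR (- (2 ^+ k / 256))))).
  apply: ler_sum => k _; apply: le_trans (term k) _; rewrite ler_wpM2l// mulrDr lerD2r; exact: Wv.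
rewrite -mulr_sumr big_split/= -mulr_suml.
have vs : \sum_(k < K) v k <= 16.
  have [z|p] := eqVneq (normv eta) 0.
    rewrite big1// => k _; rewrite /v z mul0r mulr0.
    by case: (boolP (_ < _ < _)) => // /andP[h1 h2]; have := lt_trans h1 h2; rewrite ltxx.
  by apply: sum_dyadic_window; rewrite divr_gt0// lt_def p normv_ge0.
have DK := hD K.
have c0 : 0 <= 16 `^ m * T by rewrite mulr_ge0 ?powR_ge0.
apply: (@le_trans _ _ (lattice_gauss_bound * (16 * (16 `^ m * T) + D))).
  by rewrite ler_wpM2l// lerD// ler_wpM2r.
rewrite -/T.
have h : lattice_gauss_bound * D <= lattice_gauss_bound * (D * T) by rewrite ler_wpM2l// ler_peMr.
move: (lattice_gauss_bound) h => g h.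
rewrite [leRHS](_ : _ = g * (16 * (16 `^ m * T)) + g * (D * T) + T); last by ring.
rewrite mulrDr -[leLHS]addr0; apply: lerD; last exact: le_trans ler01 T1.
by rewrite lerD2l.
Qed.

End frequencies.

Lemma ler_sum_subset (R : numDomainType) (I : eqType) (s t : seq I) (F : I -> R) :
  uniq s -> uniq t -> {subset s <= t} -> (forall i, 0 <= F i) ->
  \sum_(i <- s) F i <= \sum_(i <- t) F i.
Proof.
move=> us ut st F0; rewrite [leRHS](bigID (mem s))/= -[leLHS]addr0 lerD//; last by rewrite sumr_ge0.
rewrite -[X in _ <= X]big_filter.
have p : perm_eq s [seq i <- t | i \in s].
  apply: uniq_perm => //; first exact: filter_uniq.
  by move=> x; rewrite mem_filter; case: (boolP (x \in s)) => //= /st.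
by rewrite (perm_big _ p).
Qed.

Lemma cvg_sum_seq (R : realType) (I : eqType) (s : seq I) (F : I -> nat -> R) (l : I -> R) :
  (forall i, i \in s -> F i M @[M --> \oo] --> l i) ->
  (\sum_(i <- s) F i M) @[M --> \oo] --> \sum_(i <- s) l i.
Proof.
elim: s => [|i s IH] h.
  by rewrite big_nil; under eq_cvg do rewrite big_nil; exact: cvg_cst.
rewrite big_cons; under eq_cvg do rewrite big_cons.
apply: cvgD; first by apply: h; rewrite mem_head.
by apply: IH => j js; apply: h; rewrite in_cons js orbT.
Qed.

(** * Frame bounds *)

Section esum_seq.
Context {R : realType} {T : choiceType}.
Variables (J : set T) (h : T -> R).
Hypothesis h0 : forall x, 0 <= h x.

Lemma esum_ge_seq (s : seq T) : uniq s -> (forall x, x \in s -> J x) ->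
  ((\sum_(x <- s) h x)%:E <= \esum_(x in J) (h x)%:E)%E.
Proof.
move=> us sJ; apply: esum_ge; exists [set` s].
  by split; [exact: finite_seq|move=> x /= /sJ].
by rewrite -fsbig_seq// sumEFin.
Qed.

Lemma esum_le_seq (c : \bar R) :
  (forall s : seq T, uniq s -> (forall x, x \in s -> J x) -> ((\sum_(x <- s) h x)%:E <= c)%E) ->
  (\esum_(x in J) (h x)%:E <= c)%E.
Proof.
move=> hc; apply: ge_ereal_sup => _ [F [finF FJ] <-].
rewrite fsbig_finite//= sumEFin; apply: hc; first exact: fset_uniq.
by move=> x; rewrite in_fset_set// inE => /FJ.
Qed.

End esum_seq.

(** * Coefficient sums and their finite boxes *)

Section packet_sums.
Context {R : realType} {n : nat}.
Local Notation mun := (@lebesgue_measure_n R n).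
Local Notation E := (euclidean R n).
Implicit Types f : E -> R[i].
Variables (I : nat -> {fset int}) (xi : int -> nat -> E) (a : nat -> R).
Hypotheses (xi0 : forall k i, i \in I k -> 0 < normv (xi i k)) (a0 : forall k, 0 < a k).

Definition coef f (g : packet_index n) : R[i] :=
  innerL2 f (wpacket (xi g.1.1 g.1.2) (a g.1.2) g.2).

Definition coef_sum (W : nat -> R) f : \bar R :=
  \esum_(g in packet_indices n I) (W g.1.2 * normc (coef f g) ^+ 2)%:E.

(** The part of the coefficient sum with scale below K and translates in the cube [-M, M]^n: finite,
    hence continuous in f, and with a limit in M given by the sampling formula. *)
Definition box_total (W : nat -> R) K M f : R :=
  \sum_(k < K) \sum_(i <- I k) W k * box_energy (xi i k) (a k) f M.

Definition box_seq M : seq (n.-tuple int) := [seq boxpt A | A <- enum {ffun 'I_n -> 'I_M.*2.+1}].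

Lemma box_seq_uniq M : uniq (box_seq M).
Proof. by rewrite map_inj_uniq ?enum_uniq//; exact: boxpt_inj. Qed.

Definition freq_pairs K : seq (int * nat) :=
  @allpairs_dep nat (fun=> int) _ (fun k i => (i, k)) (iota 0 K) (fun k => enum_fset (I k)).

Definition box_index K M : seq (packet_index n) :=
  @allpairs_dep (int * nat)%type (fun=> n.-tuple int) _ (fun ik l => (ik, l)) (freq_pairs K)
    (fun=> box_seq M).

Lemma freq_pairsP K i k : ((i, k) \in freq_pairs K) = (k < K)%N && (i \in I k).
Proof.
apply/allpairsPdep/andP => [[k' [i' [+ + [-> ->]]]]|[kK iI]].
  by rewrite mem_iota.
by exists k, i; rewrite mem_iota.
Qed.

Lemma box_indexP K M i k l :
  (((i, k), l) \in box_index K M) = [&& (k < K)%N, i \in I k & l \in box_seq M].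
Proof.
apply/allpairsPdep/and3P => [[[i' k'] [l' [+ + [-> -> ->]]]]|[kK iI lM]].
  by rewrite freq_pairsP => /andP[].
by exists (i, k), l; rewrite freq_pairsP kK iI.
Qed.

Lemma box_index_uniq K M : uniq (box_index K M).
Proof.
apply: allpairs_uniq_dep => [|ik _|[[i k] l] [[i' k'] l'] _ _ /= [-> -> ->]//]; last exact: box_seq_uniq.
apply: allpairs_uniq_dep => [|k _|[k i] [k' i'] _ _ /= [-> ->]//].
  exact: iota_uniq.
exact: fset_uniq.
Qed.

Lemma box_totalE W K M f : box_total W K M f =
  \sum_(g <- box_index K M) (W g.1.2 * normc (coef f g) ^+ 2).
Proof.
rewrite big_allpairs_dep/= big_allpairs_dep/= /box_total -(big_mkord xpredT (fun k =>
  \sum_(i <- I k) W k * box_energy (xi i k) (a k) f M)).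
rewrite /index_iota subn0; apply: eq_bigr => k _; apply: eq_bigr => i _.
by rewrite big_map big_enum/= /box_energy mulr_sumr; apply: eq_bigr.
Qed.

Section weight.
Variable W : nat -> R.
Hypothesis W0 : forall k, 0 <= W k.

Let term0 f g : 0 <= W g.1.2 * normc (coef f g) ^+ 2.
Proof. by rewrite mulr_ge0// sqr_ge0. Qed.

Lemma coef_sum_ge0 f : (0 <= coef_sum W f)%E.
Proof. by apply: esum_ge0 => g _; rewrite lee_fin. Qed.

Lemma box_total_le K M f : ((box_total W K M f)%:E <= coef_sum W f)%E.
Proof.
rewrite box_totalE; apply: esum_ge_seq => //; first exact: box_index_uniq.
by move=> [[i k] l]; rewrite box_indexP => /and3P[].
Qed.

(** Every finite set of indices lies in a box, with K and M read off as maxima over it. *)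
Lemma coef_sum_le f (c : \bar R) : (forall K M, ((box_total W K M f)%:E <= c)%E) ->
  (coef_sum W f <= c)%E.
Proof.
move=> hc; apply: esum_le_seq => // s us sJ.
pose K := (\max_(g <- s) g.1.2).+1.
pose M := \max_(g <- s) \max_(j < n) absz (tnth g.2 j).
apply: le_trans (hc K M); rewrite lee_fin box_totalE.
apply: ler_sum_subset => //; first exact: box_index_uniq.
move=> [[i k] l] gs; rewrite box_indexP ltnS; apply/and3P; split.
- by have := @leq_bigmax_seq _ s xpredT (fun g : packet_index n => g.1.2) _ gs isT.
- exact: sJ gs.
- apply: mem_boxpt => j.
  have h1 := @leq_bigmax_seq _ s xpredT (fun g : packet_index n => \max_(j < n) absz (tnth g.2 j)) _ gs isT.
  have h2 := @leq_bigmax _ (fun j : 'I_n => absz (tnth l j)) j.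
  exact: leq_trans h2 h1.
Qed.

Lemma box_totalD K M f g h :
  (forall p, packet_indices n I p -> coef f p = coef g p + coef h p) ->
  box_total W K M f <= 2 * box_total W K M g + 2 * box_total W K M h.
Proof.
move=> fgh; rewrite !box_totalE !mulr_sumr -big_split big_seq [leRHS]big_seq.
apply: ler_sum => p; case: p => [[i k] l]; rewrite box_indexP => /and3P[_ iI _]; cbv beta.
rewrite fgh//; have h2 := normc_sqrD (coef g (i, k, l)) (coef h (i, k, l)).
apply: le_trans (ler_wpM2l (W0 k) h2) _.
by rewrite mulrDr !(mulrCA (W k)).
Qed.

Lemma coef_sumD f g h :
  (forall p, packet_indices n I p -> coef f p = coef g p + coef h p) ->
  (coef_sum W f <= 2%:E * coef_sum W g + 2%:E * coef_sum W h)%E.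
Proof.
move=> fgh; apply: coef_sum_le => K M.
apply: (@le_trans _ _ (2 * box_total W K M g + 2 * box_total W K M h)%:E).
  by rewrite lee_fin box_totalD.
by rewrite EFinD !EFinM leeD// lee_wpmul2l// box_total_le.
Qed.

End weight.

Lemma box_energy_mono (x : E) (b : R) f M M' : (M <= M')%N ->
  box_energy x b f M <= box_energy x b f M'.
Proof.
have E1 N : box_energy x b f N = \sum_(l <- box_seq N) normc (innerL2 f (wpacket x b l)) ^+ 2.
  by rewrite /box_seq big_map big_enum.
move=> MM; rewrite !E1; apply: ler_sum_subset; rewrite ?box_seq_uniq//.
  move=> l /mapP[A _ ->]; apply: mem_boxpt => j; rewrite tnth_mktuple.
  by move: (nat_of_ord (A j)) (ltn_ord (A j)) => v vM; lia.
by move=> l; exact: sqr_ge0.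
Qed.

Lemma box_energy_le_limit (x : E) (b : R) f M : 0 < normv x -> 0 < b -> cintegrable mun f ->
  box_energy x b f M <= sampling_limit x b f.
Proof.
move=> x0 b0 iF; have c := box_energy_cvg x0 b0 iF.
rewrite -(cvg_lim _ c)//; apply: nondecreasing_cvgn_le; last by apply/cvg_ex; eexists; exact: c.
by move=> N N'; exact: box_energy_mono.
Qed.

Lemma box_total_cvg W K f : cintegrable mun f ->
  box_total W K M f @[M --> \oo] --> \sum_(k < K) \sum_(i <- I k) W k * sampling_limit (xi i k) (a k) f.
Proof.
move=> iF; rewrite /box_total.
apply: (cvg_sum_seq (F := fun (k : 'I_K) M => \sum_(i <- I k) W k * box_energy (xi i k) (a k) f M)) => k _.
apply: (cvg_sum_seq (F := fun i M => W k * box_energy (xi i k) (a k) f M)) => i /xi0 x0.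
by apply: cvgMr; exact: box_energy_cvg.
Qed.

Lemma sqn_wpacket (x : E) (b : R) l : 0 < normv x -> 0 < b -> (sqn mun (wpacket x b l) < +oo)%E.
Proof.
move=> x0 b0.
have c0 : 0 < 2 * normv x by rewrite mulr_gt0.
pose c : E := [tuple b * (tnth l j)%:~R | j < n].
have [ig _] := integrable_gaussn c c0.
pose w := (normv x * b / (2 * pi)) `^ (n%:R / 2).
have iw := integrable_scale (w ^+ 2) ig.
have e y : normc (wpacket x b l y) ^+ 2 = w ^+ 2 * expR (- (2 * normv x * normv (subv y c) ^+ 2)).
  by rewrite normc_wpacket -/w -/c exprMn -expRM_natl mulrN !mulrA.
rewrite /sqn; under eq_integral do rewrite e.
exact: (integrable_lty measurableT iw).
Qed.

(** Cauchy-Schwarz with the larger constant (p + 1)^2 / 4 in place of p: the weighted inequality x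
    <= t p / 2 + q / (2 t) is taken at t = sqrt q, which avoids optimising in p. The bound stays
    linear in the squared norm of f. *)
Lemma inner_sqr_le f g : cmeas f -> cmeas g -> (sqn mun f < +oo)%E -> (sqn mun g < +oo)%E ->
  ((normc (innerL2 f g) ^+ 2)%:E <= sqn mun f * ((fine (sqn mun g) + 1) ^+ 2 / 4)%:E)%E.
Proof.
move=> mf mg fy gy.
set p := fine (sqn mun g); set q := fine (sqn mun f).
have p0 : 0 <= p by rewrite fine_ge0// sqn_ge0.
have q0 : 0 <= q by rewrite fine_ge0// sqn_ge0.
have fq : sqn mun f = q%:E by rewrite fineK// ge0_fin_numE// sqn_ge0.
set x := normc _.
have x0 : 0 <= x by exact: normc_ge0.
have sqgf := sqn_integrable mg gy; have sqff := sqn_integrable mf fy.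
have pE : \int[mun]_y (normc (g y) ^+ 2) = p by [].
have qE : \int[mun]_y (normc (f y) ^+ 2) = q by [].
have key t : 0 < t -> x <= t / 2 * p + (2 * t)^-1 * q.
  move=> t0; rewrite /x innerL2_cint.
  have gJy : (sqn mun (fun y => (g y)^*%C) < +oo)%E.
    by rewrite (_ : sqn _ _ = sqn mun g)//; apply: eq_integral => y _; rewrite normcJ.
  have ic := cintegrable_sqnM (cmeasJ mg) mf gJy fy.
  apply: le_trans (normc_cint_le ic) _.
  have [_ iN] := (cintegrableP _ _).1 ic.
  rewrite -pE -qE -!RintegralZl// -RintegralD//; [|exact: integrable_scale..].
  apply: le_Rintegral => //.
    exact: (integrableD measurableT (integrable_scale _ sqgf) (integrable_scale _ sqff)).
  move=> y _; rewrite normcM normcJ; have := sqr_ge0 (t * normc (g y) - normc (f y)).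
  move: (normc (g y)) (normc (f y)) => u v h.
  rewrite -(ler_pM2l (mulr_gt0 (ltr0n R 2) t0)) [leRHS](_ : _ = t ^+ 2 * u ^+ 2 + v ^+ 2); last first.
    by field; exact: lt0r_neq0.
  rewrite -subr_ge0 (_ : _ - _ = (t * u - v) ^+ 2)//; ring.
rewrite fq -EFinM lee_fin.
have [q00|qn0] := eqVneq q 0.
  have x00 : x <= 0.
    rewrite leNgt; apply/negP => xp; have p1 : 0 < p + 1 by rewrite ltr_wpDl.
    (* If q = 0 and x > 0, this t gives x <= x p / (2 (p + 1)) < x. *)
    have := key (x / (p + 1)) (divr_gt0 xp p1); rewrite q00 mulr0 addr0.
    rewrite (_ : x / (p + 1) / 2 * p = x * (p / (p + 1) / 2)); last by ring.
    apply/negP; rewrite -ltNge gtr_pMr//.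
    by rewrite ltr_pdivrMr// mul1r ltr_pdivrMr//; lra.
  by rewrite (_ : x = 0) ?expr0n/= ?q00 ?mul0r//; apply/eqP; rewrite eq_le x00.
have qp : 0 < q by rewrite lt_def qn0.
set r := Num.sqrt q; have r0 : 0 < r by rewrite sqrtr_gt0.
have r2 : r ^+ 2 = q by rewrite sqr_sqrtr.
have := key r r0; rewrite -r2 (_ : _ + _ = r * ((p + 1) / 2)); last by field; exact: lt0r_neq0.
move=> h; rewrite (_ : _ * _ = (r * ((p + 1) / 2)) ^+ 2); last by field.
by rewrite ler_pXn2r ?nnegrE// (le_trans x0).
Qed.

Lemma coef_split f g p : packet_indices n I p -> cmeas f -> (sqn mun f < +oo)%E ->
  cmeas g -> (sqn mun g < +oo)%E ->
  coef f p = coef g p + coef (fun x => f x - g x) p.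
Proof.
move: p => [[i k] l] iI mf fy mg gy; rewrite /coef !innerL2_cint.
have x0 := xi0 iI.
have mp := cmeasJ (cmeas_wpacket (xi i k) (a k) l).
have py : (sqn mun (fun y => (wpacket (xi i k) (a k) l y)^*%C) < +oo)%E.
  rewrite (_ : sqn _ _ = sqn mun (wpacket (xi i k) (a k) l)); first exact: sqn_wpacket.
  by apply: eq_integral => y _; rewrite normcJ.
have ig := cintegrable_sqnM mp mg py gy.
have iF := cintegrable_sqnM mp mf py fy.
rewrite -cintD//.
  by apply: eq_cint => y; rewrite -mulrDr addrCA subrr addr0.
rewrite (_ : (fun x => _) = fun x => (wpacket (xi i k) (a k) l x)^*%C * f x + -1 * ((wpacket (xi i k) (a k) l x)^*%C * g x)).
  by apply: cintegrableD => //; exact: cintegrableZ.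
by apply/funext => y; rewrite mulrBr mulN1r.
Qed.

End packet_sums.

Lemma tends0_lee (R : realType) (u : nat -> \bar R) (x y : \bar R) : tends0 u ->
  (forall N, (x <= y + u N)%E) -> (x <= y)%E.
Proof.
move=> tu xy; apply/lee_addgt0Pr => e e0; have [N hN] := tu e e0.
by apply: le_trans (xy N) _; rewrite leeD2l// hN.
Qed.

Lemma cvg_lee (R : realType) (u : nat -> R) (l : R) (x : \bar R) : u @ \oo --> l ->
  (forall N, ((u N)%:E <= x)%E) -> (l%:E <= x)%E.
Proof.
move=> ul; case: x => [r||] h.
- rewrite lee_fin -(cvg_lim _ ul)//; apply: limr_le; first by apply/cvg_ex; exists l.
  by apply: nearW => N; rewrite -lee_fin.
- by rewrite leey.
- by have := h 0%N.
Qed.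

(** * Upper and lower bounds for the coefficient sums *)

Section frame_bounds.
Context {R : realType} {n : nat}.
Local Notation mun := (@lebesgue_measure_n R n).
Local Notation E := (euclidean R n).
Implicit Types f : E -> R[i].
Variables (I : nat -> {fset int}) (xi : int -> nat -> E) (a : nat -> R).
Hypotheses (xi0 : forall k i, i \in I k -> 0 < normv (xi i k)) (a0 : forall k, 0 < a k).
Variable d : R.
Hypotheses (d0 : 0 <= d) (d1 : d <= 1)
  (hd : forall k i, i \in I k -> sampling_defect (xi i k) (a k) <= d).
Local Notation c0 := ((4 * pi) ^- n : R).
Local Notation coef_sum := (coef_sum I xi a).
Local Notation box_total := (box_total I xi a).

Let c0_gt0 : 0 < c0. Proof. by rewrite invr_gt0 exprn_gt0// mulr_gt0// pi_gt0. Qed.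

Definition wide_sum (W : nat -> R) K (eta : E) : R :=
  \sum_(k < K) \sum_(i <- I k) W k * gaussW (4 * normv (xi i k)) (xi i k) eta.

Definition narrow_sum K (eta : E) : R :=
  \sum_(k < K) \sum_(i <- I k) gaussW (normv (xi i k)) (xi i k) eta.

Lemma measurable_wide_sum W K : measurable_fun setT (wide_sum W K).
Proof.
apply: measurable_sum => k; apply: measurable_sum => i; apply: measurable_funM => //.
exact: measurable_gaussW.
Qed.

Lemma measurable_narrow_sum K : measurable_fun setT (narrow_sum K).
Proof.
by apply: measurable_sum => k; apply: measurable_sum => i; exact: measurable_gaussW.
Qed.

Lemma gaussW_le1 l (x eta : E) : 0 <= l -> gaussW l x eta <= 1.
Proof.
move=> l0; rewrite /gaussW -[leRHS]expR0 ler_expR oppr_le0.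
by rewrite mulr_ge0 ?sqr_ge0// invr_ge0 mulr_ge0.
Qed.

Lemma gaussW_widen l (x eta : E) : 0 < l -> gaussW l x eta <= gaussW (4 * l) x eta.
Proof.
move=> l0; rewrite /gaussW ler_expR lerN2 ler_wpM2r ?sqr_ge0//.
by rewrite lef_pV2 ?posrE ?mulr_gt0// ler_pM2l//; lra.
Qed.

Lemma integrable_spectrum l (x : E) f : 0 < l -> cintegrable mun f ->
  mun.-integrable setT (EFin \o (fun eta => gaussW l x eta * normc (fourierL1 f eta) ^+ 2)).
Proof.
move=> l0 iF; have mf := cintegrable_meas iF.
have mS : measurable_fun setT (fun u => normc (fourierL1 f u) ^+ 2).
  by apply: cmeas_norm2; exact: cmeas_fourierL1.
have := integrable_windowM x [tuple 0 | j < n] l0 mS (spectrum_bounded iF).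
rewrite (_ : (fun eta => _) = (fun eta => gaussW l x eta * normc (fourierL1 f eta) ^+ 2))//.
by apply/funext => eta; rewrite affv1_0.
Qed.

Lemma window_energy_widen l (x : E) f : 0 < l -> cintegrable mun f ->
  window_energy l x f <= window_energy (4 * l) x f.
Proof.
move=> l0 iF; apply: le_Rintegral => //; [exact: integrable_spectrum| |].
  by apply: integrable_spectrum => //; rewrite mulr_gt0.
by move=> eta _; rewrite ler_wpM2r ?sqr_ge0// gaussW_widen.
Qed.

Lemma sampling_limit_le k i f : i \in I k -> cintegrable mun f ->
  sampling_limit (xi i k) (a k) f <= 2 * c0 * window_energy (4 * normv (xi i k)) (xi i k) f.
Proof.
move=> iI iF; have x0 := xi0 iI.
have := sampling_bound x0 (a0 k) iF; rewrite ler_norml => /andP[_].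
rewrite lerBlDr => h; apply: le_trans h _.
have w := window_energy_widen (xi i k) x0 iF.
have w0 := window_energy_ge0 (xi i k) (4 * normv (xi i k)) f.
rewrite -mulrDr -mulrA mulrCA ler_pM2l//.
apply: (@le_trans _ _ (1 * window_energy (4 * normv (xi i k)) (xi i k) f + window_energy (4 * normv (xi i k)) (xi i k) f)); last by lra.
apply: lerD => //; rewrite ler_wpM2r// (le_trans (hd iI))//.
Qed.

Lemma sampling_limit_ge k i f : i \in I k -> cintegrable mun f ->
  c0 * (window_energy (normv (xi i k)) (xi i k) f - d * window_energy (4 * normv (xi i k)) (xi i k) f)
  <= sampling_limit (xi i k) (a k) f.
Proof.
move=> iI iF; have x0 := xi0 iI.
have := sampling_bound x0 (a0 k) iF; rewrite ler_norml => /andP[+ _].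
rewrite lerBrDl; apply: le_trans; rewrite -mulrBr ler_pM2l// lerD2l lerN2.
by rewrite ler_wpM2r ?window_energy_ge0// hd.
Qed.

Lemma wide_integral W K f : cintegrable mun f ->
  mun.-integrable setT (EFin \o (fun eta => wide_sum W K eta * normc (fourierL1 f eta) ^+ 2)) /\
  \int[mun]_eta (wide_sum W K eta * normc (fourierL1 f eta) ^+ 2) =
  \sum_(k < K) \sum_(i <- I k | i \in I k) W k * window_energy (4 * normv (xi i k)) (xi i k) f.
Proof.
move=> iF.
pose F (k : 'I_K) i eta := W k * (gaussW (4 * normv (xi i k)) (xi i k) eta * normc (fourierL1 f eta) ^+ 2).
have iF1 (k : 'I_K) i : i \in I k -> mun.-integrable setT (EFin \o F k i).
  by move=> /xi0 x0; apply: integrable_scale; apply: integrable_spectrum => //; rewrite mulr_gt0.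
have h (k : 'I_K) := Rintegral_fin_sum (I k : seq int) (iF1 k).
have [ii e] := Rintegral_fin_sum (index_enum 'I_K) (fun (k : 'I_K) (_ : xpredT k) => (h k).1).
have E : (fun eta => wide_sum W K eta * normc (fourierL1 f eta) ^+ 2) =
  (fun eta => \sum_(k < K) \sum_(i <- I k | i \in I k) F k i eta).
  apply/funext => eta; rewrite /wide_sum mulr_suml; apply: eq_bigr => k _.
  by rewrite mulr_suml big_seq; apply: eq_bigr => i _; rewrite /F mulrA.
rewrite E; split => //; rewrite e; apply: eq_bigr => k _; rewrite (h k).2.
apply: eq_bigr => i iI; rewrite RintegralZl//.
by apply: integrable_spectrum => //; rewrite mulr_gt0// xi0.
Qed.

Lemma narrow_integral K f : cintegrable mun f ->
  mun.-integrable setT (EFin \o (fun eta => narrow_sum K eta * normc (fourierL1 f eta) ^+ 2)) /\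
  \int[mun]_eta (narrow_sum K eta * normc (fourierL1 f eta) ^+ 2) =
  \sum_(k < K) \sum_(i <- I k | i \in I k) window_energy (normv (xi i k)) (xi i k) f.
Proof.
move=> iF.
pose F (k : 'I_K) i eta := gaussW (normv (xi i k)) (xi i k) eta * normc (fourierL1 f eta) ^+ 2.
have iF1 (k : 'I_K) i : i \in I k -> mun.-integrable setT (EFin \o F k i).
  by move=> /xi0 x0; exact: integrable_spectrum.
have h (k : 'I_K) := Rintegral_fin_sum (I k : seq int) (iF1 k).
have [ii e] := Rintegral_fin_sum (index_enum 'I_K) (fun (k : 'I_K) (_ : xpredT k) => (h k).1).
have E : (fun eta => narrow_sum K eta * normc (fourierL1 f eta) ^+ 2) =
  (fun eta => \sum_(k < K) \sum_(i <- I k | i \in I k) F k i eta).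
  apply/funext => eta; rewrite /narrow_sum mulr_suml; apply: eq_bigr => k _.
  by rewrite mulr_suml big_seq; apply: eq_bigr.
rewrite E; split => //; rewrite e; apply: eq_bigr => k _; rewrite (h k).2.
by apply: eq_bigr.
Qed.

Lemma box_total_le_wide W K M f : (forall k, 0 <= W k) -> cintegrable mun f ->
  box_total W K M f <= 2 * c0 * \int[mun]_eta (wide_sum W K eta * normc (fourierL1 f eta) ^+ 2).
Proof.
move=> W0 iF; rewrite (wide_integral W K iF).2 mulr_sumr; apply: ler_sum => k _.
rewrite mulr_sumr big_seq; apply: ler_sum => i iI; rewrite mulrCA ler_wpM2l//.
by apply: le_trans (sampling_limit_le iI iF); apply: box_energy_le_limit => //; exact: xi0.
Qed.

(** The constant depends on K and M. It serves only to make the truncation error disappear while the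
    box is fixed. *)
Lemma box_total_sqn W K M : (forall k, 0 <= W k) -> exists2 C : R, 0 <= C &
  forall f, cmeas f -> (sqn mun f < +oo)%E -> ((box_total W K M f)%:E <= C%:E * sqn mun f)%E.
Proof.
move=> W0.
pose p (g : packet_index n) : R := (fine (sqn mun (wpacket (xi g.1.1 g.1.2) (a g.1.2) g.2)) + 1) ^+ 2 / 4.
have p0 g : 0 <= p g by rewrite divr_ge0// sqr_ge0.
exists (\sum_(g <- box_index I K M) W g.1.2 * p g) => [|f mf fy].
  by apply: sumr_ge0 => g _; exact: mulr_ge0.
have fq : sqn mun f = (fine (sqn mun f))%:E by rewrite fineK// ge0_fin_numE// sqn_ge0.
set q := fine _ in fq *.
rewrite box_totalE fq -EFinM lee_fin mulr_suml big_seq [leRHS]big_seq.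
apply: ler_sum => -[[i k] l]; rewrite box_indexP => /and3P[_ iI _].
rewrite -[leRHS]mulrA ler_wpM2l// -lee_fin [X in (_ <= X)%E]EFinM -fq muleC.
by apply: inner_sqr_le => //; [exact: cmeas_wpacket|apply: sqn_wpacket => //; exact: xi0].
Qed.

Definition spectral_energy (h : E -> R) (F : E -> R[i]) : \bar R :=
  (\int[mun]_eta (h eta * normc (F eta) ^+ 2)%:E)%E.

Lemma spectral_energyE (h : E -> R) (F : E -> R[i]) : (forall eta, 0 <= h eta) ->
  spectral_energy h F = sqn mun (fun eta => (Num.sqrt (h eta))%:C * F eta).
Proof.
move=> h0; apply: eq_integral => eta _.
by rewrite normcM normc_re exprMn ger0_norm ?sqrtr_ge0// sqr_sqrtr.
Qed.

Lemma spectral_energy_le (h k : E -> R) (F : E -> R[i]) : measurable_fun setT h ->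
  measurable_fun setT k -> cmeas F -> (forall eta, 0 <= h eta <= k eta) ->
  (spectral_energy h F <= spectral_energy k F)%E.
Proof.
move=> mh mk mF hk; have h0 eta : 0 <= h eta by have /andP[] := hk eta.
have k0 eta : 0 <= k eta by have /andP[h1 /(le_trans h1)] := hk eta.
have mm (g : E -> R) : measurable_fun setT g -> measurable_fun setT (fun eta => (g eta * normc (F eta) ^+ 2)%:E).
  by move=> mg; apply/measurable_EFinP; apply: measurable_funM => //; exact: cmeas_norm2.
have gg (g : E -> R) : (forall eta : E, 0 <= g eta) -> forall eta : E, setT eta -> (0 <= (g eta * normc (F eta) ^+ 2)%:E)%E.
  by move=> g0 eta _; rewrite lee_fin mulr_ge0 ?sqr_ge0.
rewrite /spectral_energy; apply: ge0_le_integral => //; [exact: gg|exact: mm|exact: mm|].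
by move=> eta _; rewrite lee_fin ler_wpM2r ?sqr_ge0//; have /andP[] := hk eta.
Qed.

Lemma spectral_energy_cst (c : R) (F : E -> R[i]) : 0 <= c -> cmeas F ->
  spectral_energy (fun=> c) F = (c%:E * sqn mun F)%E.
Proof.
move=> c0 mF; rewrite /sqn -ge0_integralZl//.
  exact: emeas_norm2.
by move=> x _; exact: norm2_ge0.
Qed.

Lemma wide_sum_ge0 W K eta : (forall k, 0 <= W k) -> 0 <= wide_sum W K eta.
Proof.
by move=> W0; apply: sumr_ge0 => k _; apply: sumr_ge0 => i _; rewrite mulr_ge0 ?gaussW_ge0.
Qed.

Lemma box_total_le_spectral W K M f : (forall k, 0 <= W k) -> cintegrable mun f ->
  ((box_total W K M f)%:E <= (2 * c0)%:E * spectral_energy (wide_sum W K) (fourierL1 f))%E.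
Proof.
move=> W0 iF; have [ii e] := wide_integral W K iF.
have h0 eta : 0 <= wide_sum W K eta * normc (fourierL1 f eta) ^+ 2.
  by rewrite mulr_ge0 ?sqr_ge0// wide_sum_ge0.
have -> : spectral_energy (wide_sum W K) (fourierL1 f) =
    (\int[mun]_eta (wide_sum W K eta * normc (fourierL1 f eta) ^+ 2))%:E.
  rewrite /Rintegral fineK// ge0_fin_numE; first exact: (integrable_lty measurableT ii).
  by apply: integral_ge0 => eta _; rewrite lee_fin.
by rewrite -EFinM lee_fin; exact: box_total_le_wide.
Qed.

Let collect_terms (c C D : R) (V S1 S2 : \bar R) : 0 <= c -> 0 <= C -> 0 <= D ->
  (0 <= V)%E -> (0 <= S1)%E -> (0 <= S2)%E ->
  (2%:E * ((2 * c)%:E * (2%:E * V + 2%:E * (D%:E * S1))) + 2%:E * (C%:E * S2) =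
   (8 * c)%:E * V + ((2 * C)%:E * S2 + (8 * c * D)%:E * S1))%E.
Proof.
move=> c0' C0 D0 V0 S10 S20.
have -> : (2%:E * V + 2%:E * (D%:E * S1) = 2%:E * (V + D%:E * S1))%E.
  by rewrite ge0_muleDr// mule_ge0.
have -> : (8 * c)%:E = (2%:E * ((2 * c)%:E * 2%:E))%E by rewrite -!EFinM; congr EFin; ring.
have -> : (8 * c * D)%:E = (2%:E * ((2 * c)%:E * 2%:E) * D%:E)%E by rewrite -!EFinM; congr EFin; ring.
have -> : (2 * C)%:E = (2%:E * C%:E)%E by rewrite EFinM.
rewrite !muleA ge0_muleDr//; last by rewrite mule_ge0.
by rewrite !muleA -addeA; congr (_ + _)%E; rewrite addeC.
Qed.

Section upper.
Variables (W : nat -> R) (B : R).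
Hypotheses (W0 : forall k, 0 <= W k) (B0 : 0 <= B).

Lemma box_total_truncation K M N f : cmeas f -> (sqn mun f < +oo)%E ->
  box_total W K M f <= 2 * box_total W K M (ball_truncation N f) +
    2 * box_total W K M (fun x => f x - ball_truncation N f x).
Proof.
move=> mf fy; apply: box_totalD => // p pI.
apply: (coef_split xi0 a0 pI mf fy (cmeas_truncation N mf)).
exact: le_lt_trans (sqn_truncation N mf) fy.
Qed.

Lemma sqn_diff_truncation_lty N f : cmeas f -> (sqn mun f < +oo)%E ->
  (sqn mun (fun x => f x - ball_truncation N f x)%R < +oo)%E.
Proof.
move=> mf fy; have mN := cmeas_truncation N mf.
apply: le_lt_trans (sqnB _ mf mN) _.
have Ny := le_lt_trans (sqn_truncation N mf) fy.
by rewrite lte_add_pinfty// lte_mul_pinfty.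
Qed.

(** For a fixed box, f is split into a truncation, to which the sampling bound and Plancherel apply,
    and an error that tends to 0. The surviving constant no longer sees the box; splitting turns the
    2 of the sampling bound into 4. *)
Lemma coef_sum_le_sqn f : (forall K eta, wide_sum W K eta <= B) ->
  cmeas f -> (sqn mun f < +oo)%E ->
  (coef_sum W f <= (4 * c0 * B * (2 * pi) ^+ n)%:E * sqn mun f)%E.
Proof.
move=> hB mf fy; apply: coef_sum_le => // K M.
have [C C0 hC] := box_total_sqn K M W0.
have C20 : 0 <= 2 * C by rewrite mulr_ge0.
have tN := tends0Z C20 (tends0_truncation mf fy).
apply: (tends0_lee tN) => N.
have mN := cmeas_truncation N mf; have iN := cintegrable_truncation N mf fy.
have Ny := le_lt_trans (sqn_truncation N mf) fy.
have b1 : ((box_total W K M (ball_truncation N f))%:E <= (2 * c0 * B * (2 * pi) ^+ n)%:E * sqn mun f)%E.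
  apply: le_trans (box_total_le_spectral K M W0 iN) _.
  have mF := cmeas_fourierL1 mN.
  have s1 : (spectral_energy (wide_sum W K) (fourierL1 (ball_truncation N f)) <=
      (B * (2 * pi) ^+ n)%:E * sqn mun f)%E.
    apply: (@le_trans _ _ (spectral_energy (fun=> B) (fourierL1 (ball_truncation N f)))).
      apply: spectral_energy_le => //; first exact: measurable_wide_sum.
      by move=> eta; rewrite wide_sum_ge0// hB.
    rewrite spectral_energy_cst// plancherel_L1// EFinM -muleA.
    rewrite lee_wpmul2l// lee_wpmul2l ?sqn_truncation// lee_fin ltW//; exact: pi2n_gt0.
  apply: le_trans (lee_wpmul2l _ s1) _; first by rewrite lee_fin mulr_ge0// ltW.
  by rewrite muleA -EFinM mulrA.
have b2 := hC _ (cmeasB mf mN) (sqn_diff_truncation_lty N mf fy).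
apply: (@le_trans _ _ (2%:E * (box_total W K M (ball_truncation N f))%:E + 2%:E * (box_total W K M (fun x => f x - ball_truncation N f x))%:E)%E).
  by rewrite -!EFinM -EFinD lee_fin box_total_truncation.
apply: leeD.
  apply: le_trans (lee_wpmul2l _ b1) _ => //.
  by rewrite muleA -EFinM !mulrA -natrM.
by apply: le_trans (lee_wpmul2l _ b2) _ => //; rewrite muleA -EFinM.
Qed.

(** Convergence of the truncated transforms in L^2 says nothing about energies weighted by an
    unbounded v. For fixed K the wide sum is bounded, so the passage to the limit happens there, and
    v replaces the wide sum only in front of the limit transform. *)
Lemma coef_sum_le_spectral f (v : E -> R) : measurable_fun setT v ->
  (forall K eta, wide_sum W K eta <= v eta) ->
  cmeas f -> (sqn mun f < +oo)%E ->
  (coef_sum W f <= (8 * c0)%:E * spectral_energy v (fourierL2 f))%E.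
Proof.
move=> mv hv mf fy; apply: coef_sum_le => // K M.
have [mF Fy tF] := fourierL2P mf fy.
have [C C0 hC] := box_total_sqn K M W0.
(* A bound for the wide sum that grows with K; it multiplies only an error tending to 0. *)
pose D : R := \sum_(k < K) \sum_(i <- I k) W k.
have D0 : 0 <= D by apply: sumr_ge0 => k _; exact: sumr_ge0.
have hD eta : wide_sum W K eta <= D.
  apply: ler_sum => k _; rewrite big_seq [leRHS]big_seq; apply: ler_sum => i /xi0 x0.
  by rewrite ler_piMr// gaussW_le1// mulr_ge0// ltW.
have C20 : 0 <= 2 * C by rewrite mulr_ge0.
have t1 := tends0Z C20 (tends0_truncation mf fy).
have cD0 : 0 <= 8 * c0 * D by rewrite !mulr_ge0// ltW.
have t2 := tends0Z cD0 tF.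
apply: (tends0_lee (tends0D t1 t2)) => N.
have mN := cmeas_truncation N mf; have iN := cintegrable_truncation N mf fy.
have Ny := le_lt_trans (sqn_truncation N mf) fy.
have mFN := cmeas_fourierL1 mN.
have s1 : (spectral_energy (wide_sum W K) (fourierL1 (ball_truncation N f)) <=
   2%:E * spectral_energy v (fourierL2 f) +
   2%:E * (D%:E * sqn mun (fun eta => fourierL2 f eta - fourierL1 (ball_truncation N f) eta)%R))%E.
  have w0 eta := wide_sum_ge0 K eta W0.
  rewrite (spectral_energyE _ w0).
  pose sw eta : R[i] := (Num.sqrt (wide_sum W K eta))%:C.
  have msw : cmeas sw.
    apply: cmeas_re; apply: measurableT_comp; last exact: measurable_wide_sum.
    by apply: continuous_measurable_fun; exact: sqrt_continuous.
  rewrite (_ : (fun eta => _) = fun eta => sw eta * fourierL2 f eta +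
     -1 * (sw eta * (fourierL2 f eta - fourierL1 (ball_truncation N f) eta))); last first.
    by apply/funext => eta; rewrite /sw; ring.
  have m1 : cmeas (fun eta => sw eta * fourierL2 f eta) by exact: cmeasM.
  have m2 : cmeas (fun eta => sw eta * (fourierL2 f eta - fourierL1 (ball_truncation N f) eta)).
    by apply: cmeasM => //; exact: cmeasB.
  apply: le_trans (sqnD _ m1 (cmeasM (cmeas_cst _ (-1)) m2)) _.
  apply: leeD; apply: lee_wpmul2l => //.
    rewrite -(spectral_energyE _ w0); apply: spectral_energy_le => //.
      exact: measurable_wide_sum.
    by move=> eta; rewrite w0 hv.
  rewrite sqnZ// normcN normc1 expr1n mul1e -(spectral_energyE _ w0) -spectral_energy_cst//; last exact: cmeasB.
  apply: spectral_energy_le => //; [exact: measurable_wide_sum|exact: cmeasB|].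
  by move=> eta; rewrite w0 hD.
have b1 := le_trans (box_total_le_spectral K M W0 iN) (lee_wpmul2l (ltac:(by rewrite lee_fin mulr_ge0// ltW) : (0 <= (2 * c0)%:E)%E) s1).
have b2 := hC _ (cmeasB mf mN) (sqn_diff_truncation_lty N mf fy).
apply: (@le_trans _ _ (2%:E * (box_total W K M (ball_truncation N f))%:E + 2%:E * (box_total W K M (fun x => f x - ball_truncation N f x))%:E)%E).
  by rewrite -!EFinM -EFinD lee_fin box_total_truncation.
apply: le_trans (leeD (lee_wpmul2l _ b1) (lee_wpmul2l _ b2)) _ => //.
set V := spectral_energy v _; set S1 := sqn mun _; set S2 := sqn mun _.
have V0 : (0 <= V)%E.
  apply: integral_ge0 => eta _; rewrite lee_fin mulr_ge0 ?sqr_ge0//.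
  exact: le_trans (wide_sum_ge0 0 eta W0) (hv 0%N eta).
have S10 : (0 <= S1)%E by exact: sqn_ge0.
have S20 : (0 <= S2)%E by exact: sqn_ge0.
by rewrite collect_terms// ltW.
Qed.

End upper.

(** The narrow sum exceeds A at eta only from some K on, so it is used on the set [S K] alone; these
    sets exhaust the space as K grows. The loss d B never exceeds half of A. *)
Lemma coef_sum_ge_L1 (A B : R) f : 0 < A ->
  (forall eta, \forall K \near \oo, A <= narrow_sum K eta) ->
  (forall K eta, wide_sum (fun=> 1%R) K eta <= B) -> d * B <= A / 2 ->
  cintegrable mun f -> (sqn mun f < +oo)%E ->
  ((c0 * (A / 2) * (2 * pi) ^+ n)%:E * sqn mun f <= coef_sum (fun=> 1%R) f)%E.
Proof.
move=> A0 hA hB dB iF fy; have mf := cintegrable_meas iF; have mF := cmeas_fourierL1 mf.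
have P1 := plancherel_L1 iF fy.
have Fy : (sqn mun (fourierL1 f) < +oo)%E.
  by rewrite P1 lte_mul_pinfty// lee_fin ltW//; exact: pi2n_gt0.
have iS := sqn_integrable mF Fy.
set P := \int[mun]_eta (normc (fourierL1 f eta) ^+ 2).
have PE : sqn mun (fourierL1 f) = P%:E.
  by rewrite /P /Rintegral fineK// ge0_fin_numE// sqn_ge0.
have -> : ((c0 * (A / 2) * (2 * pi) ^+ n)%:E * sqn mun f = (c0 * (A / 2) * P)%:E)%E.
  by rewrite !EFinM -PE P1 !muleA.
have P0 : 0 <= P by apply: Rintegral_ge0 => eta _; exact: sqr_ge0.
pose S K := [set eta : E | A <= narrow_sum K eta].
have mS K : measurable (S K).
  have := measurable_narrow_sum K measurableT (measurable_itv `[A, +oo[); rewrite setTI.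
  by rewrite (_ : _ @^-1` _ = S K)//; apply/seteqP; split=> eta /=; rewrite in_itv/= andbT.
have ex := Rintegral_exhaust mS hA iS.
have step K : ((c0 * (A * \int[mun]_(eta in S K) (normc (fourierL1 f eta) ^+ 2) - d * (B * P)))%:E <= coef_sum (fun=> 1%R) f)%E.
  apply: (@le_trans _ _ ((\sum_(k < K) \sum_(i <- I k) 1 * sampling_limit (xi i k) (a k) f)%R)%:E); last first.
    have le1 M : ((box_total (fun=> 1%R) K M f)%:E <= coef_sum (fun=> 1%R) f)%E.
      by apply: box_total_le => _; exact: ler01.
    have lm := @box_total_cvg _ _ _ _ _ xi0 a0 (fun=> 1%R) K _ iF.
    have := cvg_lee lm le1; exact.
  rewrite lee_fin.
  have [iN eN] := narrow_integral K iF; have [iW eW] := wide_integral (fun=> 1%R) K iF.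
  have mR : measurable_fun setT ((fun eta => normc (fourierL1 f eta) ^+ 2) \_ (S K)).
    by apply/(measurable_restrictT _ (mS K)); apply: measurable_funTS; exact: cmeas_norm2.
  have hN : A * \int[mun]_(eta in S K) normc (fourierL1 f eta) ^+ 2 <= \int[mun]_eta (narrow_sum K eta * normc (fourierL1 f eta) ^+ 2).
    rewrite Rintegral_mkcond -RintegralZl//; last first.
      apply: (le_integrable measurableT _ _ iS).
        by apply/measurable_EFinP.
      move=> eta _ /=; rewrite lee_fin patchE; case: ifP => // _.
      by rewrite normr0.
    apply: le_Rintegral => //.
      apply: (le_integrable measurableT _ _ (integrable_scale A iS)).
        apply/measurable_EFinP; exact: measurable_funM.
      move=> eta _ /=; rewrite lee_fin patchE; case: ifP => // _.
      by rewrite mulr0 normr0.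
    move=> eta _; rewrite patchE; case: ifPn => [/set_mem SK|_].
      by rewrite ler_wpM2r// sqr_ge0.
    rewrite mulr0 mulr_ge0 ?sqr_ge0//.
    by apply: sumr_ge0 => k _; apply: sumr_ge0 => i _; exact: gaussW_ge0.
  have hW : \int[mun]_eta (wide_sum (fun=> 1%R) K eta * normc (fourierL1 f eta) ^+ 2) <= B * P.
    rewrite /P -RintegralZl//; apply: le_Rintegral => //; first exact: integrable_scale.
    by move=> eta _; rewrite ler_wpM2r// sqr_ge0.
  have c00 := ltW c0_gt0.
  apply: (@le_trans _ _ (c0 * (\int[mun]_eta (narrow_sum K eta * normc (fourierL1 f eta) ^+ 2) - d * \int[mun]_eta (wide_sum (fun=> 1%R) K eta * normc (fourierL1 f eta) ^+ 2)))).
    by rewrite ler_wpM2l// lerB// ler_wpM2l.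
  rewrite eN eW mulr_sumr -sumrB mulr_sumr; apply: ler_sum => k _.
  rewrite mulr_sumr -sumrB mulr_sumr [leRHS]big_seq; apply: ler_sum => i iI.
  by rewrite !mul1r; exact: sampling_limit_ge.
have lim : c0 * (A * \int[mun]_(eta in S K) (normc (fourierL1 f eta) ^+ 2) - d * (B * P)) @[K --> \oo] --> c0 * (A * P - d * (B * P)).
  by apply: cvgMr; apply: cvgB; [exact: cvgMr|exact: cvg_cst].
have := cvg_lee lim step; apply: le_trans; rewrite lee_fin -mulrA ler_pM2l//.
have : d * B * P <= A / 2 * P by rewrite ler_wpM2r.
rewrite -mulrA; lra.
Qed.

(** The factor 1 / 4 comes from two splittings with factors 2, one for the norm of f and one for its
    coefficients. The coefficients of the truncation error are controlled by the upper bound. *)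
Lemma coef_sum_ge_sqn (q B : R) f : 0 <= q ->
  (forall g, cintegrable mun g -> (sqn mun g < +oo)%E ->
    (q%:E * sqn mun g <= coef_sum (fun=> 1%R) g)%E) ->
  (forall g, cmeas g -> (sqn mun g < +oo)%E ->
    (coef_sum (fun=> 1%R) g <= B%:E * sqn mun g)%E) ->
  cmeas f -> (sqn mun f < +oo)%E ->
  ((q / 4)%:E * sqn mun f <= coef_sum (fun=> 1%R) f)%E.
Proof.
move=> q0 lo up mf fy.
have sf g : (sqn mun g < +oo)%E -> sqn mun g = (fine (sqn mun g))%:E.
  by move=> gy; rewrite fineK// ge0_fin_numE// sqn_ge0.
have cf g : cmeas g -> (sqn mun g < +oo)%E ->
    coef_sum (fun=> 1%R) g = (fine (coef_sum (fun=> 1%R) g))%:E.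
  move=> mg gy; rewrite fineK// ge0_fin_numE; last by apply: coef_sum_ge0 => _; exact: ler01.
  by apply: le_lt_trans (up _ mg gy) _; rewrite (sf _ gy) -EFinM ltry.
(* The sign of B is not known here, and the error term requires a nonnegative factor. *)
have B0 : 0 <= Num.max B 0 by rewrite le_max lexx orbT.
have qB0 : 0 <= q / 2 + Num.max B 0 by rewrite addr_ge0// divr_ge0.
have tN := tends0Z qB0 (tends0_truncation mf fy).
apply: (tends0_lee tN) => N.
have mN := cmeas_truncation N mf; have iN := cintegrable_truncation N mf fy.
have Ny := le_lt_trans (sqn_truncation N mf) fy.
have Dy := sqn_diff_truncation_lty N mf fy; have mD := cmeasB mf mN.
have Dy' : (sqn mun (fun x => ball_truncation N f x - f x)%R < +oo)%E by rewrite sqnB_sym.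
have mD' := cmeasB mN mf.
have h1 : (sqn mun f <= 2%:E * sqn mun (fun x => f x - ball_truncation N f x)%R + 2%:E * sqn mun (ball_truncation N f))%E.
  rewrite [X in (sqn mun X <= _)%E](_ : f = fun x => (f x - ball_truncation N f x) + ball_truncation N f x).
    exact: sqnD mD mN.
  by apply/funext => x; rewrite subrK.
have h2 := lo _ iN Ny.
have h3 : (coef_sum (fun=> 1%R) (ball_truncation N f) <= 2%:E * coef_sum (fun=> 1%R) f +
    2%:E * coef_sum (fun=> 1%R) (fun x => ball_truncation N f x - f x)%R)%E.
  apply: coef_sumD => [_|p pI]; first exact: ler01.
  exact: coef_split pI mN Ny mf fy.
have h4 := up _ mD' Dy'.
move: h1 h2 h3 h4; rewrite (sqnB_sym _ (ball_truncation N f)) (cf _ mf fy) (cf _ mN Ny) (cf _ mD' Dy').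
rewrite (sf _ fy) (sf _ Ny) (sf _ Dy) -!EFinM -!EFinD !lee_fin.
set x := fine (sqn mun f); set y := fine (sqn mun (ball_truncation N f)).
set z := fine (sqn mun (fun x => f x - ball_truncation N f x)).
have z0 : 0 <= z by rewrite fine_ge0// sqn_ge0.
set c := fine _; set c1 := fine _; set c2 := fine _ => h1 h2 h3 h4.
have h5 : B * z <= Num.max B 0 * z by rewrite ler_wpM2r// le_max lexx.
have h6 : q * x <= q * (2 * z + 2 * y) by rewrite ler_wpM2l.
rewrite mulrDl; move: (Num.max B 0 * z) h5 => w h5.
rewrite (_ : q / 4 * x = (q * x) / 4); last by ring.
rewrite (_ : q / 2 * z = (q * z) / 2); last by ring.
rewrite mulrDr !(mulrCA q) in h6.
move: (q * x) (q * y) (q * z) (B * z) h2 h4 h5 h6 => qx qy qz bz h2 h4 h5 h6; lra.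
Qed.

End frame_bounds.

(** * Choice of the spacing *)

Section spacing_choice.
Context {R : realType} {n : nat}.
Local Notation E := (euclidean R n).

Lemma theta_ratio_le (t : R) : 0 < t -> theta_ratio t <= t / pi ^+ 2.
Proof.
move=> t0; have p0 : 0 < pi ^+ 2 / t :> R by rewrite divr_gt0// exprn_gt0// pi_gt0.
rewrite /theta_ratio expRN -[leRHS]invf_div lef_pV2 ?posrE ?expR_gt0//.
by apply: le_trans (expR_ge1Dx _); rewrite lerDr.
Qed.

(** The ratio r is at most C^2, by exp (- y) <= 1 / y and pi^2 >= 4. Then C <= 1 / 3 gives (1 + r) /
    (1 - r) <= 1 + 3 r and 3 r <= C <= x0, so the n-th power is at most exp (n x0) <= 1 + d. *)
Lemma spacing_small (d : R) : 0 < d -> exists2 C : R, 0 < C &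
  forall (x : E) (b : R), 0 < normv x -> 0 < b -> normv x * b ^+ 2 <= C ^+ 2 ->
  sampling_defect x b <= d.
Proof.
move=> d0; have d1 : 1 < 1 + d by rewrite ltrDl.
(* Dividing by n + 1 keeps [x0] positive in every dimension and still gives n x0 <= ln (1 + d). *)
pose x0 : R := ln (1 + d) / n.+1%:R.
have x00 : 0 < x0 by rewrite divr_gt0// ln_gt0.
exists (Num.min 3^-1 x0) => [|x b xp bp h]; first by rewrite lt_min x00 invr_gt0 ltr0n.
set C := Num.min _ _ in h.
have C3 : C <= 3^-1 by rewrite ge_min lexx.
have Cx : C <= x0 by rewrite ge_min lexx orbT.
have C0 : 0 < C by rewrite lt_min x00 invr_gt0 ltr0n.
rewrite /sampling_defect; set t := 3 / 2 * _.
have t0 : 0 < t by rewrite !mulr_gt0// exprn_gt0.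
have tE : t = 3 * (normv x * b ^+ 2) by rewrite /t; field.
have /andP[r0 r1] := theta_ratio_itv t0.
have rC : theta_ratio t <= C ^+ 2.
  apply: le_trans (theta_ratio_le t0) _; rewrite ler_pdivrMr ?exprn_gt0 ?pi_gt0//.
  have p4 : 4 <= pi ^+ 2 :> R by have := @pi_ge2 R; nra.
  have := sqr_ge0 C; rewrite tE; nra.
set r := theta_ratio t in r0 r1 rC *.
have r3 : r <= 3^-1 by nra.
have base : (1 + r) / (1 - r) <= expR x0.
  apply: le_trans (expR_ge1Dx x0); rewrite ler_pdivrMr ?subr_gt0//.
  have : 3 * r <= x0 by nra.
  nra.
have b0 : 0 <= (1 + r) / (1 - r) by apply: divr_ge0; [exact: addr_ge0|rewrite subr_ge0 ltW].
rewrite lerBlDl; apply: (@le_trans _ _ (expR x0 ^+ n)).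
  by rewrite lerXn2r ?nnegrE ?expR_ge0.
rewrite -expRM_natl -[leRHS]lnK ?posrE; last by rewrite (lt_trans ltr01).
rewrite ler_expR /x0 mulrA ler_pdivrMr// mulrC ler_wpM2l ?ler_nat//.
by rewrite ln_ge0// ltW.
Qed.

Lemma spacing_gt0 (C eps : R) k : 0 < C -> 0 < spacing C eps k.
Proof. by move=> C0; rewrite mulr_gt0// powR_gt0. Qed.

Lemma spacing_sqr_le (C eps l : R) k : 0 <= eps -> 0 < l -> l < 2 ^+ k ->
  l * spacing C eps k ^+ 2 <= C ^+ 2.
Proof.
move=> e0 l0 lk; rewrite /spacing exprMn mulrCA ler_piMr ?sqr_ge0//.
set p := _ `^ _.
have h : p ^+ 2 <= 2 ^- k.
  rewrite -[p ^+ 2]powR_mulrn ?powR_ge0// -powRrM -powR_invn// ler_powR ?ler1n//.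
  have : 0 <= eps * k%:R by rewrite mulr_ge0.
  move: (eps * k%:R) => w w0; lra.
apply: (@le_trans _ _ (2 ^+ k * 2 ^- k)); last by rewrite divff// expf_neq0.
by apply: ler_pM => //; [exact: ltW|exact: sqr_ge0|exact: ltW].
Qed.

End spacing_choice.

Section null_spectrum.
Context {R : realType} {n : nat}.
Local Notation mun := (@lebesgue_measure_n R n).
Local Notation E := (euclidean R n).

Lemma sqn_ae0 (F : E -> R[i]) : cmeas F -> {ae mun, forall x, F x = 0} -> sqn mun F = 0%E.
Proof.
move=> mF h; rewrite /sqn -[RHS](integral0 mun setT); apply: ae_eq_integral => //.
  exact: emeas_norm2.
by apply: filterS h => x -> _; rewrite normc0 expr0n.
Qed.

Lemma sqn_mul_eq0 (w F : E -> R[i]) : cmeas w -> cmeas F -> sqn mun F = 0%E ->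
  sqn mun (fun x => w x * F x) = 0%E.
Proof.
move=> mw mF /(sqn_eq0 mF) h; apply: sqn_ae0; first exact: cmeasM.
by apply: filterS h => x ->; rewrite mulr0.
Qed.

(** The weight can vanish at the origin only, which is a null set in positive dimension. *)
Lemma sqn_powM_eq0 (m : R) (F : E -> R[i]) : (0 < n)%N -> cmeas F ->
  cmeas (fun x : E => (normv x `^ m)%:C * F x) ->
  sqn mun (fun x => (normv x `^ m)%:C * F x) = 0%E -> sqn mun F = 0%E.
Proof.
move=> n0 mF mw /(sqn_eq0 mw) h; apply: sqn_ae0 => //.
have mZ : measurable [set x : E | normv x = 0].
  have := @measurable_normv R n _ _ id (@measurable_id _ _ setT).
  by move=> /(_ measurableT [set 0] (measurable_set1 _)); rewrite setTI.
have h0 : {ae mun, forall x : E, normv x <> 0}.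
  exists [set x : E | normv x = 0]; split => //; first exact: lebesgue_normv0.
  by move=> x /= /contrapT.
apply: filterS2 h h0 => x xF x0.
move/eqP : xF; rewrite mulf_eq0 => /orP[|/eqP//].
by move=> /eqP/complexI/powR_eq0_eq0/x0.
Qed.

End null_spectrum.

Lemma lee_scale_ratio (R : realType) (S H : \bar R) : (0 <= S < +oo)%E ->
  (0 <= H < +oo)%E -> (S = 0 <-> H = 0)%E ->
  exists C1 C2 : R, [/\ 0 < C1, C1 <= C2 & (C1%:E * H <= S <= C2%:E * H)%E].
Proof.
move=> /andP[S0 Sy] /andP[H0 Hy] SH.
have [S00|Sn0] := eqVneq S 0%E.
  exists 1, 1; split; rewrite ?lexx ?ltr01//.
  by rewrite S00 (SH.1 S00) mule0 lexx.
have Hn0 : H != 0%E by apply: contra_neq Sn0 => /SH.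
have Sp : (0 < S)%E by rewrite lt_neqAle eq_sym Sn0.
have Hp : (0 < H)%E by rewrite lt_neqAle eq_sym Hn0.
have ES : S = (fine S)%:E by rewrite fineK// ge0_fin_numE.
have EH : H = (fine H)%:E by rewrite fineK// ge0_fin_numE.
rewrite ES EH; rewrite ES lte_fin in Sp; rewrite EH lte_fin in Hp.
exists (fine S / fine H), (fine S / fine H); split; rewrite ?divr_gt0 ?lexx//.
by rewrite -EFinM divfK ?gt_eqF// lexx.
Qed.

(** * The frame of wave packets *)

Section packet_frame.
Context {R : realType} {n : nat}.
Local Notation mun := (@lebesgue_measure_n R n).
Local Notation E := (euclidean R n).
Implicit Types f : E -> R[i].
Hypothesis n_gt0 : (0 < n)%N.
Local Notation index := (@freq_index R n).

Definition direction i k : E := scalev (2 ^- k) (freq n i k).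

Lemma packet_freq_direction g : packet_freq direction g = freq n g.1.1 g.1.2.
Proof.
by apply: eq_from_tnth => j; rewrite !tnth_mktuple mulrA divff ?mul1r.
Qed.

Lemma normv_direction k i : i \in index k -> 2^-1 <= normv (direction i k) < 1.
Proof.
move=> /freq_annulus /andP[h1 h2].
have k0 : 0 < 2 ^+ k :> R by rewrite exprn_gt0.
rewrite normv_scale gtr0_norm ?invr_gt0// mulrC ler_pdivlMr// ltr_pdivrMr//.
by rewrite mul1r h1.
Qed.

Lemma freq_gt0 k i : i \in index k -> 0 < normv (freq n i k : E).
Proof.
move=> /freq_annulus /andP[h1 _]; apply: lt_le_trans h1.
by rewrite mulr_gt0 ?invr_gt0// exprn_gt0.
Qed.

Lemma innerL2_packet dx f g :
  innerL2 f (packet direction dx g) = coef (freq n) dx f g.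
Proof. by rewrite /coef -packet_freq_direction. Qed.

Lemma packet_energy dx f :
  (\esum_(g in packet_indices n index) (normc (innerL2 f (packet direction dx g)) ^+ 2)%:E =
  coef_sum index (freq n) dx (fun=> 1%R) f)%E.
Proof. by apply: eq_esum => g _; rewrite innerL2_packet mul1r. Qed.

Definition dyadic_weight (m : R) (k : nat) : R := (2 `^ (k%:R * m)) ^+ 2.

Lemma weighted_packet_energy dx m f :
  (\esum_(g in packet_indices n index) (normc ((2 `^ (g.1.2%:R * m))%:C *
     innerL2 f (packet direction dx g)) ^+ 2)%:E =
  coef_sum index (freq n) dx (dyadic_weight m) f)%E.
Proof.
apply: eq_esum => g _.
by rewrite innerL2_packet normcM normc_re ger0_norm ?powR_ge0// exprMn.
Qed.

(** The bound B is [freq_upper] at m = 0, where all dyadic weights are 1; it depends on the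
    frequencies alone. The defect d and then the spacing constant C can therefore be chosen after it
    without circularity. *)
Lemma frame_constants (eps : R) : 0 <= eps -> exists C d B : R,
  [/\ [/\ 0 < C, 0 < B, 0 <= d, d <= 1 & d * B <= expR (-1) / 2],
      forall k i, i \in index k -> sampling_defect (freq n i k : E) (spacing C eps k) <= d &
      forall K eta, wide_sum index (freq n) (fun=> 1%R) K (eta : E) <= B].
Proof.
move=> e0; have [B B0 hB] := freq_upper (R := R) n_gt0 (lexx 0).
pose d : R := Num.min 1 (expR (-1) / 2 / B).
have d0 : 0 < d by rewrite lt_min ltr01 !divr_gt0// expR_gt0.
have [C C0 hC] := spacing_small (n := n) d0.
exists C, d, B; split.
- split => //; rewrite ?(ltW d0) ?ge_min ?lexx//.
  by rewrite -ler_pdivlMr// ge_min lexx orbT.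
- move=> k i iI; apply: hC; [exact: freq_gt0 iI|exact: spacing_gt0|].
  apply: spacing_sqr_le => //; first exact: freq_gt0 iI.
  by have /andP[] := freq_annulus iI.
- move=> K eta; move: (hB eta K); rewrite powRr0 mulr1; apply: le_trans.
  by apply: ler_sum => k _; apply: ler_sum => i _; rewrite mulr0 powRr0 expr1n.
Qed.

Lemma homogeneous_weight_le (m : R) (x : E) : 0 <= m ->
  normv x `^ m <= (1 + normv x ^+ 2) `^ (m / 2).
Proof.
move=> m0; have x0 : 0 <= normv x by exact: sqrtr_ge0.
rewrite {1}(_ : m = 2 * (m / 2)); last by field.
rewrite powRrM -[2 in X in _ `^ X `^ _]/(2%:R) powR_mulrn//.
by rewrite ge0_ler_powR ?nnegrE ?divr_ge0 ?addr_ge0 ?sqr_ge0// lerDr.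
Qed.

(** With the majorant B (1 + |eta|^2)^m of [freq_upper], the spectral energy is exactly B times the
    squared inhomogeneous Sobolev norm, since the Sobolev weight has exponent m / 2 before
    squaring. *)
Lemma sobolev_energy_fin (dx : nat -> R) (d m : R) f :
  (forall k, 0 < dx k) -> d <= 1 ->
  (forall k i, i \in index k -> sampling_defect (freq n i k : E) (dx k) <= d) ->
  0 <= m -> sobolev m f -> (coef_sum index (freq n) dx (dyadic_weight m) f < +oo)%E.
Proof.
move=> dx0 d1 hd m0 [/L2P[mf fy] /L2norm_ltyE wy].
have [B B0 hB] := freq_upper (R := R) n_gt0 m0.
have [mF _ _] := fourierL2P mf fy.
pose v (eta : E) : R := B * (1 + normv eta ^+ 2) `^ m.
have mn : measurable_fun setT (fun x : E => 1 + normv x ^+ 2).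
  by apply: measurable_funD => //; apply: measurable_funX; exact: measurable_normv.
have mv : measurable_fun setT v.
  by apply: measurable_funM => //; apply: (measurableT_comp (measurable_powR _)).
have W0 k : 0 <= dyadic_weight m k by exact: sqr_ge0.
have hv K eta : wide_sum index (freq n) (dyadic_weight m) K eta <= v eta by exact: hB.
apply: le_lt_trans (coef_sum_le_spectral freq_gt0 dx0 d1 hd W0 mv hv mf fy) _.
have -> : (spectral_energy v (fourierL2 f) = B%:E *
    sqn mun (fun x : E => (((1 + normv x ^+ 2) `^ (m / 2))%:C * fourierL2 f x)%R))%E.
  rewrite /spectral_energy /sqn -ge0_integralZl//; last exact: ltW.
  - apply: eq_integral => x _; rewrite -EFinM; congr EFin.
    rewrite normcM normc_re ger0_norm ?powR_ge0// exprMn /v -mulrA; congr (_ * (_ * _)).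
    rewrite -[RHS]powR_mulrn ?powR_ge0// -powRrM; congr (_ `^ _); by field.
  - apply: emeas_norm2; apply: cmeasM => //; apply: cmeas_re.
    by apply: (measurableT_comp (measurable_powR _)).
  - by move=> x _; rewrite lee_fin sqr_ge0.
by rewrite !lte_mul_pinfty// ?lee_fin ?mulr_ge0 ?invr_ge0 ?exprn_ge0 ?mulr_ge0 ?pi_ge0 ?(ltW B0)// mule_ge0 ?sqn_ge0// lee_fin ltW.
Qed.

End packet_frame.

Unset Implicit Arguments.
Set Strict Implicit.
Set Printing Implicit Defensive.

Theorem theorem1 (R : realType) (n : nat) (n_gt0 : (0 < n)%N)
    (eps : R) (eps_gt0 : 0 < eps) :
  exists (I : nat -> {fset int}) (omega : int -> nat -> euclidean R n) (C : R),
    [/\ 0 < C,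
        forall k i, i \in I k -> 2^-1 <= normv (omega i k) < 1,
        is_frame (packet_indices n I) (packet omega (spacing C eps))
      & forall m : R, 0 <= m -> forall f : euclidean R n -> R[i], sobolev m f ->
        exists C1 C2 : R,
          [/\ 0 < C1, C1 <= C2 &
           (C1%:E * homogeneous_sobolev_norm m f ^+ 2
            <= \esum_(g in packet_indices n I)
                 (normc ((2 `^ (g.1.2%:R * m))%:C *
                          innerL2 f (packet omega (spacing C eps) g)) ^+ 2)%:E
            <= C2%:E * homogeneous_sobolev_norm m f ^+ 2)%E]].
Proof.
have [C [d [B [[C0 B0 d0 d1 dB] hd hB]]]] := frame_constants n_gt0 (ltW eps_gt0).
have x0 := @freq_gt0 R n.
have a0 k : 0 < spacing C eps k by exact: spacing_gt0.
pose mun := @lebesgue_measure_n R n.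
pose total W f := coef_sum (@freq_index R n) (freq n) (spacing C eps) W f.
pose c0 : R := (4 * pi) ^- n; pose p : R := (2 * pi) ^+ n.
have c00 : 0 < c0 by rewrite invr_gt0 exprn_gt0// mulr_gt0// pi_gt0.
have p0 : 0 < p by rewrite exprn_gt0// mulr_gt0// pi_gt0.
pose q : R := c0 * (expR (-1) / 2) * p.
have q0 : 0 < q by rewrite !mulr_gt0// expR_gt0.
have upper g : cmeas g -> (sqn mun g < +oo)%E ->
    (total (fun=> 1%R) g <= (4 * c0 * B * p)%:E * sqn mun g)%E.
  by move=> mg gy; apply: (coef_sum_le_sqn x0 a0 d1 hd _ (ltW B0) hB mg gy) => _; exact: ler01.
have lower g : cmeas g -> (sqn mun g < +oo)%E ->
    ((q / 4)%:E * sqn mun g <= total (fun=> 1%R) g)%E.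
  apply: (coef_sum_ge_sqn x0 a0 (ltW q0) _ upper) => h ih hy.
  exact: (coef_sum_ge_L1 x0 a0 d0 hd (expR_gt0 _) (freq_lower n_gt0) hB dB ih hy).
exists (@freq_index R n), (direction (R := R) (n := n)), C; split => //.
- exact: normv_direction.
- split=> [[[i k] l] iI|].
    apply/L2P; split; first exact: cmeas_wpacket.
    by apply: sqn_wpacket; rewrite ?packet_freq_direction//; exact: x0.
  (* Adding q / 4 to the upper constant makes the order of the two bounds immediate. *)
  exists (q / 4), (q / 4 + 4 * c0 * B * p); split => [||f].
  + by rewrite divr_gt0.
  + by rewrite lerDl !mulr_ge0// ltW.
  move=> /L2P[mf fy]; rewrite packet_energy L2norm_sqr lower//=.
  apply: le_trans (upper f mf fy) _; rewrite lee_wpmul2r ?sqn_ge0// lee_fin.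
  by rewrite lerDr divr_ge0// ltW.
move=> m m0 f sf; have [/L2P[mf fy] /L2norm_ltyE wy] := sf.
have [mF Fy _] := fourierL2P mf fy.
have mn : measurable_fun setT (fun x : euclidean R n => 1 + normv x ^+ 2).
  by apply: measurable_funD => //; apply: measurable_funX; exact: measurable_normv.
have mw : cmeas (fun x : euclidean R n => (normv x `^ m)%:C).
  by apply: cmeas_re; apply: (measurableT_comp (measurable_powR _)); exact: measurable_normv.
have mwF := cmeasM mw mF.
have W0 k : 0 <= dyadic_weight m k by exact: sqr_ge0.
rewrite weighted_packet_energy /homogeneous_sobolev_norm L2norm_sqr.
have total_ge0 (W : nat -> R) : (forall k, 0 <= W k) -> (0 <= total W f)%E by move=> hW; exact: coef_sum_ge0.
apply: lee_scale_ratio.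
- apply/andP; split; first exact: total_ge0.
  exact: (sobolev_energy_fin n_gt0 a0 d1 hd m0 sf).
- rewrite sqn_ge0/=; apply: le_lt_trans wy; apply: sqn_le => // [|x].
    apply: cmeasM => //; apply: cmeas_re.
    by apply: (measurableT_comp (measurable_powR _)).
  rewrite !normcM !normc_re !ger0_norm ?powR_ge0// ler_wpM2r ?normc_ge0//.
  exact: homogeneous_weight_le.
(* Since m >= 0, every dyadic weight is at least 1; a vanishing weighted sum thus forces f to vanish
   through the lower frame bound. *)
have le1W : (total (fun=> 1%R) f <= total (dyadic_weight m) f)%E.
  apply: le_esum => g _; rewrite lee_fin ler_wpM2r ?sqr_ge0//.
  by rewrite exprn_ege1// -[leLHS](powRr0 2) ler_powR ?ler1n// mulr_ge0.
split => h.
  have f0 : sqn mun f = 0%E.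
    apply/eqP; rewrite eq_le sqn_ge0 andbT -(@lee_pmul2l _ (q / 4)%:E) ?lte_fin ?divr_gt0//.
    by rewrite mule0 -h; apply: le_trans (lower f mf fy) le1W.
  by apply: sqn_mul_eq0 => //; apply/sqn_fourierL2_eq0.
(* Conversely, a zero homogeneous norm kills the transform almost everywhere, hence f, hence each
   coefficient. *)
have F0 := sqn_powM_eq0 n_gt0 mF mwF h.
have f0 : sqn mun f = 0%E by apply/sqn_fourierL2_eq0.
apply: esum1 => g gI.
suff -> : normc (coef (freq n) (spacing C eps) f g) ^+ 2 = 0 by rewrite mulr0.
apply/eqP; rewrite eq_le sqr_ge0 andbT -lee_fin.
have wg := sqn_wpacket g.2 (x0 _ _ gI) (a0 g.1.2).
have := inner_sqr_le mf (cmeas_wpacket _ _ _) fy wg.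
by rewrite f0 mul0e.
Qed.
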